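(* Let $f(x,u)=xu^2$ and $g(x,u)=\operatorname{sgn}(u)f(x,u)=\operatorname{sgn}(u)\,xu^2$. Let $u_0\in L^\infty(\mathbb{R})$ be such that $x\mapsto g(x,u_0(x))$ belongs to $BV(\mathbb{R})$. Then there exists an entropy solution of the Cauchy problem $u_t+f(x,u)_x=0$ in $\mathbb{R}\times[0,\infty)$, $u(x,0)=u_0(x)$.
   Context: Entropy solution: $u$ is an entropy solution of $u_t+f(x,u)_x=0$, $u(x,0)=u_0(x)$, with $u_0\in L^\infty(\mathbb{R})$, if for every $k\in\mathbb{R}$ and every $\varphi\in C_c^\infty(\mathbb{R}\times[0,\infty))$ with $\varphi\geq0$, $$\iint |u(x,t)-k|\varphi_t+\operatorname{sgn}(u(x,t)-k)\left[f(x,u(x,t))-f(x,k)\right]\varphi_x\,dx\,dt\ \geq\ \iint\operatorname{sgn}(u(x,t)-k)f_x(x,k)\varphi(x,t)\,dx\,dt-\int|u_0(x)-k|\varphi(x,0)\,dx,$$ where the double integrals are over $\mathbb{R}\times[0,\infty)$, $f_x$ is the partial derivative of $f$ in its first argument, and $\operatorname{sgn}(0)=0$. The function $u$ itself is not required to be bounded; it is only required that $u$ and $f(x,u)$ be locally integrable. *)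

(* Defs.v *)
From HB Require Import structures.
From mathcomp Require Import all_boot all_order all_algebra.
From mathcomp Require Import all_classical all_reals all_analysis.

Set Implicit Arguments.
Unset Strict Implicit.
Unset Printing Implicit Defensive.
Import Order.TTheory GRing.Theory Num.Theory.
Import numFieldNormedType.Exports.
Local Open Scope classical_set_scope.
Local Open Scope ring_scope.

(* Points of the plane are pairs p = (x, t). *)

Definition lebesgue2 (R : realType) :=
  ((@lebesgue_measure R) \x (@lebesgue_measure R))%E.
Arguments lebesgue2 R : clear implicits.

Definition half_plane (R : realType) : set (R * R) := [set p | 0 <= p.2].
Arguments half_plane R : clear implicits.

Definition partial_x (R : realType) (phi : R * R -> R) (p : R * R) : R :=
  'D_((1, 0) : R * R) phi p.

Definition partial_t (R : realType) (phi : R * R -> R) (p : R * R) : R :=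
  'D_((0, 1) : R * R) phi p.

Fixpoint Cn (R : realType) (n : nat) (phi : R * R -> R) : Prop :=
  continuous phi /\
  if n is m.+1 then
    [/\ forall p, derivable phi p (1, 0),
        forall p, derivable phi p (0, 1),
        Cn m (partial_x phi) & Cn m (partial_t phi)]
  else True.

Definition smooth (R : realType) (phi : R * R -> R) : Prop :=
  forall n, Cn n phi.

(* Elements of C_c^oo(R x [0, oo[) are represented as restrictions to the
   closed half plane of functions in C_c^oo(R^2); in particular phi need not
   vanish on t = 0, and its sign is only prescribed for t >= 0. *)
Definition nonneg_test_function (R : realType) (phi : R * R -> R) : Prop :=
  [/\ smooth phi,
      compact (closure [set p | phi p != 0]) &
      forall p, half_plane R p -> 0 <= phi p].

(* Compact sets may touch the line t = 0. *)
Definition locally_integrable_half_plane (R : realType) (w : R * R -> R) :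
    Prop :=
  forall K : set (R * R), compact K -> K `<=` half_plane R ->
    (lebesgue2 R).-integrable K (EFin \o w).

(* Entropy solutions of u_t + f(x, u)_x = 0 on R x [0, oo[, u(x, 0) = u0(x).
   Under the local integrability conditions all the integrals below are those
   of integrable functions as soon as u0 is locally integrable and f(., k) and
   f_x(., k) are measurable and locally bounded. *)
Definition entropy_solution (R : realType) (f : R -> R -> R) (u0 : R -> R)
    (u : R * R -> R) : Prop :=
  [/\ locally_integrable_half_plane u,
      locally_integrable_half_plane (fun p => f p.1 (u p)) &
      forall (k : R) (phi : R * R -> R), nonneg_test_function phi ->
        \int[lebesgue2 R]_(p in half_plane R)
          (`|u p - k| * partial_t phi p
           + Num.sg (u p - k) * (f p.1 (u p) - f p.1 k) * partial_x phi p)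
        >=
        \int[lebesgue2 R]_(p in half_plane R)
          (Num.sg (u p - k) * derive1 (fun y => f y k) p.1 * phi p)
        - \int[@lebesgue_measure R]_x (`|u0 x - k| * phi (x, 0))].

(* BV(R) as a space of a.e.-classes: w agrees almost everywhere with a function
   whose total variation over R is finite; membership in L^1(R) is not
   required. *)
Definition BV_line (R : realType) (w : R -> R) : Prop :=
  exists h : R -> R,
    {ae @lebesgue_measure R, forall x, w x = h x} /\
    exists C : R, forall a b : R, a <= b -> (total_variation a b h <= C%:E)%E.

Definition flux (R : realType) (x v : R) : R := x * v ^+ 2.

Definition signed_flux (R : realType) (x v : R) : R := Num.sg v * flux x v.

(* Main.v *)
Require Import Defs.
From HB Require Import structures.
From mathcomp Require Import all_boot all_order all_algebra.
From mathcomp Require Import all_classical all_reals all_analysis.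
From mathcomp Require Import measurable_realfun ring lra.
Import Order.TTheory GRing.Theory Num.Theory.
Import numFieldNormedType.Exports.
Local Open Scope classical_set_scope.
Local Open Scope ring_scope.
Set Implicit Arguments.
Unset Strict Implicit.
Unset Printing Implicit Defensive.

(* The change of variables [x = y |y| / 4], [w = (y / 2) u] removes the spatial dependence of the
   flux: [u_t + (x u ^ 2)_x = 0] becomes the Burgers equation [w_t + (w ^ 2)_y = 0], and the bound
   [|x| u0 ^ 2 <= C] given by the BV hypothesis says exactly that [w] is initially bounded.  The
   Hopf-Lax formula applied to a primitive of the initial datum then gives a bounded [w].

   The constants [u = k] become the linear profiles [k y / 2], which are not stationary: Hopf-Lax
   maps them in time [h] to [k y / (2 (1 + k h))].  The maximum and the minimum of [w (., t)] and
   of this profile have primitives that bracket, up to monotone differences, the two potentials;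
   since the Hopf-Lax operator preserves such monotonicity, comparing after a time step [h] yields
   the Kruzkov inequality on [t, t + h] up to an error o(h), where the motion of the profile gives
   the source term.  Summing over the steps is replaced by integrating in [t] the difference
   quotient of this inequality and letting [h] tend to 0. *)

(** The coefficient of the flux changes sign at [x = 0], and [u] may blow up there like
    [1 / sqrt |x|]. The signed factor [y / 2] settles both points. With [w = sqrt |x| u] the new
    flux would be [sgn y * w ^ 2], discontinuous in space; with [w = (y / 2) u] the sign becomes an
    orientation and a single convex flux remains on the whole line. The Jacobian [|y| / 2] is the
    modulus of the same factor, so [|u - k| dx] is exactly [|w - k y / 2| dy], and all integrands in
    [y] are bounded on the support of the test function. This has two costs. The map [y |y| / 4] is
    not twice differentiable at 0, so the inequality is proved for test functions that are only
    Lipschitz and differentiable in [y]. The profile [k y / 2] is unbounded, so it is truncated at a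
    level that, by finite speed of propagation, is not felt on the support during a short step.
    Working with potentials needs neither compactness nor traces: Hopf-Lax provides a right
    derivative at every point and every positive time. *)

(** * Bounded functions supported in a set of finite measure *)

Section tame.
Context {d} {T : measurableType d} {R : realType}.
Variable mu : {measure set T -> \bar R}.
Implicit Types (f g : T -> R) (A : set T) (C K : R).

(** This class is stable under sums, bounded multipliers and translations, so integrability is
    checked compositionally; the multiple of the indicator also serves as the dominating function in
    limits. *)
Definition tame (f : T -> R) := measurable_fun setT f /\
  exists (A : set T) (C : R), [/\ measurable A, (mu A < +oo)%E &
    forall x, `|f x| <= C * \1_A x].

Lemma integrable_cindic A (C : R) : measurable A -> (mu A < +oo)%E ->
  mu.-integrable setT (fun x => (C * \1_A x)%:E).
Proof.
move=> mA fA.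
have := @measurable_bounded_integrable _ _ _ mu (cst C) A mA fA.
rewrite integrable_mkcond// => h.
apply: eq_integrable (h _ _) => //.
- by move=> x _; rewrite patchE indicE; case: ifP; rewrite /= ?mulr1 ?mulr0.
- by exists `|C|; split => // M CM y _ /=; exact: ltW.
Qed.

Lemma tame_integrable f : tame f -> mu.-integrable setT (EFin \o f).
Proof.
move=> [mf [A [C [mA fA Af]]]].
apply: (le_integrable measurableT _ _ (@integrable_cindic A C mA fA)).
  exact/measurable_EFinP.
by move=> x _ /=; rewrite lee_fin (le_trans (Af x))// ler_norm.
Qed.

Lemma tame_le f g (K : R) : tame f -> measurable_fun setT g ->
  (forall x, `|g x| <= K * `|f x|) -> tame g.
Proof.
move=> [mf [A [C [mA fA Af]]]] mg gf; split => //.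
exists A, (`|K| * C); split => // x.
rewrite (le_trans (gf x))// (le_trans (y := `|K| * `|f x|))//.
  by rewrite ler_wpM2r// ler_norm.
by rewrite -mulrA ler_wpM2l.
Qed.

Lemma tame_dom f A C : measurable_fun setT f -> measurable A ->
  (mu A < +oo)%E -> (forall x, `|f x| <= C * \1_A x) -> tame f.
Proof. by move=> mf mA fA Af; split => //; exists A, C. Qed.

Lemma tame_supp f A C : measurable_fun setT f -> measurable A ->
  (mu A < +oo)%E -> (forall x, `|f x| <= C) -> (forall x, ~ A x -> f x = 0) ->
  tame f.
Proof.
move=> mf mA fA fC f0; apply: (@tame_dom _ A C) => // x.
rewrite indicE; have [xA|/negP xA] := boolP (x \in A); first by rewrite mulr1.
by rewrite f0 ?normr0 ?mulr0// => Ax; apply: xA; exact: mem_set.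
Qed.

Lemma tameD f g : tame f -> tame g -> tame (f \+ g).
Proof.
move=> [mf [A [C [mA fA Af]]]] [mg [B [D [mB fB Bg]]]].
split; first exact: measurable_funD.
exists (A `|` B), (`|C| + `|D|); split; first exact: measurableU.
  by rewrite (le_lt_trans (measureU2 _ mA mB))// lte_add_pinfty.
move=> x; rewrite (le_trans (ler_normD _ _))// mulrDl lerD//.
  rewrite (le_trans (Af x))// (le_trans (y := `|C| * \1_A x))//.
    by rewrite ler_wpM2r// ler_norm.
  rewrite ler_wpM2l// !indicE ler_nat; case: (boolP (x \in A)) => // xA.
  by rewrite in_setU xA.
rewrite (le_trans (Bg x))// (le_trans (y := `|D| * \1_B x))//.
  by rewrite ler_wpM2r// ler_norm.
rewrite ler_wpM2l// !indicE ler_nat; case: (boolP (x \in B)) => // xA.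
by rewrite in_setU xA orbT.
Qed.

Lemma tameN f : tame f -> tame (\- f).
Proof.
move=> tf; apply: (@tame_le _ _ 1 tf).
  by case: tf => mf _; exact: measurableT_comp.
by move=> x; rewrite mul1r normrN.
Qed.

Lemma tameB f g : tame f -> tame g -> tame (f \- g).
Proof. by move=> tf tg; apply: tameD => //; exact: tameN. Qed.

Lemma tameM f g (K : R) : measurable_fun setT g -> (forall x, `|g x| <= K) ->
  tame f -> tame (g \* f).
Proof.
move=> mg gK tf; apply: (@tame_le _ _ K tf).
  by case: tf => mf _; exact: measurable_funM.
by move=> x /=; rewrite normrM ler_wpM2r.
Qed.

Lemma tame_norm f : tame f -> tame (fun x => `|f x|).
Proof.
move=> tf; apply: (@tame_le _ _ 1 tf).
  by case: tf => mf _; exact: measurableT_comp.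
by move=> x; rewrite mul1r normr_id.
Qed.

Lemma tameZ f c : tame f -> tame (fun x => c * f x).
Proof. by move=> tf; apply: (@tameM _ (cst c) `|c|). Qed.

Lemma Rintegral_dominated (f_ : nat -> T -> R) f A C :
  (forall n, measurable_fun setT (f_ n)) -> measurable_fun setT f ->
  measurable A -> (mu A < +oo)%E ->
  (forall n x, `|f_ n x| <= C * \1_A x) ->
  {ae mu, forall x, f_ n x @[n --> \oo] --> f x} ->
  (\int[mu]_x f_ n x)%R @[n --> \oo] --> (\int[mu]_x f x)%R.
Proof.
move=> mf_ mf mA fA bf cf.
have [||||| /[dup] intf /(integrable_fin_num measurableT) ff _ h] :=
    @dominated_convergence _ _ _ mu setT measurableT (fun n x => (f_ n x)%:E)
    (EFin \o f) (fun x => (C * \1_A x)%:E).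
- by move=> n; exact/measurable_EFinP.
- exact/measurable_EFinP.
- apply: filterS cf => x h _.
  by apply: cvg_comp h _; exact: cvg_id.
- exact: integrable_cindic.
- by apply: aeW => x n _; rewrite lee_fin.
by apply: fine_cvg; rewrite /Rintegral fineK.
Qed.

Lemma le_Rint f g : tame f -> tame g -> (forall x, f x <= g x) ->
  \int[mu]_x f x <= \int[mu]_x g x.
Proof.
by move=> tf tg fg; apply: le_Rintegral => //; exact: tame_integrable.
Qed.

Lemma RintD f g : tame f -> tame g ->
  \int[mu]_x (f x + g x) = \int[mu]_x f x + \int[mu]_x g x.
Proof. by move=> tf tg; apply: RintegralD => //; exact: tame_integrable. Qed.

Lemma RintB f g : tame f -> tame g ->
  \int[mu]_x (f x - g x) = \int[mu]_x f x - \int[mu]_x g x.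
Proof. by move=> tf tg; apply: RintegralB => //; exact: tame_integrable. Qed.

Lemma RintZ f c : tame f -> \int[mu]_x (c * f x) = c * \int[mu]_x f x.
Proof. by move=> tf; apply: RintegralZl => //; exact: tame_integrable. Qed.

Lemma RintN f : tame f -> \int[mu]_x (- f x) = - \int[mu]_x f x.
Proof.
move=> tf; rewrite -mulN1r -RintZ//.
by apply: eq_Rintegral => x _; rewrite mulN1r.
Qed.

Lemma eqRint (f g : T -> R) : (forall x, f x = g x) ->
  \int[mu]_x f x = \int[mu]_x g x.
Proof. by move=> fg; apply: eq_Rintegral => x _. Qed.

Lemma normr_Rint_le f A C : measurable_fun setT f -> measurable A ->
  (mu A < +oo)%E -> (forall x, `|f x| <= C * \1_A x) ->
  `|\int[mu]_x f x| <= C * fine (mu A).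
Proof.
move=> mf mA fA Af; have tf := tame_dom mf mA fA Af.
rewrite (le_trans (le_normr_Rintegral _ _))//; first exact: tame_integrable.
have tA : tame (\1_A : T -> R).
  by apply: (@tame_supp _ A 1 _ mA) => // x;
   rewrite indicE; [rewrite normr_nat lern1 leq_b1|move=> nA; rewrite memNset].
rewrite (le_trans (@le_Rint _ (fun x => C * \1_A x) _ _ Af))//.
- exact: tame_norm.
- exact: tameZ.
- by rewrite RintZ// /Rintegral integral_indic// setIT.
Qed.

(** The upper bounds [c_ n] come without measurability and the [B_ n] without a limit, so neither
    sequence can be passed to the limit under the integral. The functions [B_ n \max c] are
    measurable, inherit the domination, and differ from [c] by at most [|c_ n - c|]. *)
Lemma Rintegral_cvg_le (B_ c_ : nat -> T -> R) (c : T -> R) A C :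
  (forall n, tame (B_ n)) -> measurable_fun setT c ->
  measurable A -> (mu A < +oo)%E ->
  (forall n x, B_ n x <= c_ n x) -> (forall n x, `|c_ n x| <= C * \1_A x) ->
  (forall x, c_ n x @[n --> \oo] --> c x) ->
  exists s : nat -> R, s n @[n --> \oo] --> \int[mu]_x c x /\
    forall n, \int[mu]_x B_ n x <= s n.
Proof.
move=> tB mc mA fA Bc bc cc.
have bc' x : `|c x| <= C * \1_A x.
  have h : `|c_ n x| @[n --> \oo] --> `|c x| by exact: cvg_norm.
  by rewrite -(cvg_lim _ h)//; apply: limr_le; [exact: cvgP h|exact: nearW].
pose m n := B_ n \max c.
have mm n : measurable_fun setT (m n).
  by case: (tB n) => mB _; exact: measurable_maxr.
have bm n x : `|m n x| <= C * \1_A x.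
  rewrite /m /= /Order.max; case: ltP => // cB.
  move: (bc n x) (bc' x) (Bc n x); rewrite !ler_norml => /andP[? ?] /andP[? ?] ?.
  by apply/andP; split; lra.
exists (fun n => \int[mu]_x m n x); split.
  apply: (@Rintegral_dominated m c A C) => //.
  apply: aeW => x; apply/cvgrPdistC_lt => e e0.
  have /cvgrPdistC_lt/(_ _ e0) := cc x.
  apply: filterS => n; apply: le_lt_trans.
  rewrite /m /= /Order.max; case: ltP => cB; first by rewrite subrr normr0.
  by rewrite !ger0_norm ?subr_ge0 ?(le_trans cB)// lerD2r.
move=> n; apply: le_Rint => //; first exact: tame_dom (bm n).
by move=> x; rewrite le_max lexx.
Qed.

End tame.

(** * Measurability in the plane *)

Section plane.
Context {R : realType}.
Implicit Types (O : set (R * R)).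

(** The sigma-algebra is the product one, known through rectangles, so [O] is exhausted by countably
    many squares with rational centre and radius. *)
Lemma open_measurable2 O : open O -> measurable O.
Proof.
move=> oO.
pose bx (q : rat * rat * rat) : set (R * R) :=
  ball (ratr q.1.1 : R) (ratr q.2) `*` ball (ratr q.1.2 : R) (ratr q.2).
have -> : O = \bigcup_(q : rat * rat * rat) if `[< bx q `<=` O >] then bx q else set0.
  apply/seteqP; split=> [p Op|p [q _]]; last by case: asboolP => // h; exact: h.
  have /(nbhs_ballP) [e /= e0 eO] : nbhs p O by exact: open_nbhs_nbhs.
  have [r /andP[r0 re]] : exists r : rat, (0 < (ratr r : R) < e / 2).
    have [//|r] := @rat_in_itvoo R 0 (e / 2); first by rewrite divr_gt0.
    by rewrite in_itv /= => ?; exists r.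
  have aux (x : R) : exists q : rat, `|x - ratr q| < ratr r.
    have [|q] := @rat_in_itvoo R (x - ratr r) (x + ratr r); first by lra.
    by rewrite in_itv /= => ?; exists q; rewrite ltr_norml; lra.
  have [q1 h1] := aux p.1; have [q2 h2] := aux p.2.
  exists (q1, q2, r) => //.
  case: asboolP; first by rewrite /bx /ball/= => _; split => /=; rewrite distrC.
  move=> nO; exfalso; apply: nO => z [/= z1 z2]; apply: eO; split => /=.
    move: z1 h1; rewrite /ball/= => z1 h1.
    by rewrite (le_lt_trans (ler_distD (ratr q1) _ _))//; lra.
  move: z2 h2; rewrite /ball/= => z2 h2.
  by rewrite (le_lt_trans (ler_distD (ratr q2) _ _))//; lra.
apply: countable_bigcupT_measurable => [|q]; first exact: countableP.
by case: ifP => // _; apply: measurableX; exact: measurable_ball.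
Qed.

Lemma closed_measurable2 O : closed O -> measurable O.
Proof.
by move=> cO; rewrite -(setCK O); apply: measurableC; apply: open_measurable2;
  exact: closed_openC.
Qed.

Lemma continuous_measurable_fun2 (f : R * R -> R) :
  continuous f -> measurable_fun setT f.
Proof.
move=> /continuousP cf.
apply: (measurability _ (RGenOpens.measurableE R)) => _ [_ [a [b ->] <-]].
by rewrite setTI; apply: open_measurable2; exact/cf/interval_open.
Qed.

Lemma lips2_continuous (A : R) (f : R * R -> R) :
  (forall p q, `|f p - f q| <= A * (`|p.1 - q.1| + `|p.2 - q.2|)) -> continuous f.
Proof.
move=> fA p; apply/cvgrPdist_le => e e0.
have A1 : 0 < `|A| + 1 by rewrite ltr_wpDl.
have d0 : 0 < e / (2 * (`|A| + 1)) by rewrite divr_gt0// mulr_gt0.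
apply: filterS (nbhsx_ballx p _ d0) => q [] /=.
rewrite /ball/= => h1 h2.
apply: (le_trans (fA p q)).
apply: (@le_trans _ _ ((`|A| + 1) * (`|p.1 - q.1| + `|p.2 - q.2|))).
  by rewrite ler_wpM2r ?addr_ge0// (le_trans (ler_norm _))// lerDl.
rewrite mulrC -ler_pdivlMr//.
apply: (le_trans (lerD (ltW h1) (ltW h2))).
by rewrite le_eqVlt; apply/orP; left; apply/eqP; field; rewrite gt_eqF.
Qed.

End plane.

(** * The substitution [x = y |y| / 4] *)

Section density.
Context {d} {T : measurableType d} {R : realType}.
Variables (mu : {measure set T -> \bar R}) (g : T -> R).
Hypotheses (mg : measurable_fun setT g) (g0 : forall x, 0 <= g x).

(** Made into a measure so that its image under [xof] can be identified with Lebesgue measure by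
    uniqueness. *)
Definition density (A : set T) : \bar R := (\int[mu]_(x in A) (g x)%:E)%E.

Let density0 : density set0 = 0%E.
Proof. by rewrite /density integral_set0. Qed.

Let density_ge0 A : (0 <= density A)%E.
Proof. by apply: integral_ge0 => x _; rewrite lee_fin. Qed.

Let density_sigma_additive : semi_sigma_additive density.
Proof.
move=> F mF tF mUF; rewrite /density ge0_integral_bigcup//.
- by apply: is_cvg_nneseries => n *; exact: density_ge0.
- by apply/measurable_EFinP; exact: measurable_funTS.
- by move=> x _; rewrite lee_fin.
Qed.

HB.instance Definition _ := isMeasure.Build _ _ _ density
  density0 density_ge0 density_sigma_additive.

Import HBNNSimple.

Lemma ge0_integral_density (f : T -> \bar R) : measurable_fun setT f ->
  (forall x, (0 <= f x)%E) ->
  (\int[density]_x f x = \int[mu]_x (f x * (g x)%:E))%E.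
Proof.
move=> mf f0.
pose f_ := nnsfun_approx measurableT mf.
have f_f x : (f_ n x)%:E @[n --> \oo] --> f x.
  by apply: cvg_nnsfun_approx => // y _; exact: f0.
have nd x : {homo (fun n => (f_ n x)%:E) : m n / (m <= n)%N >-> (m <= n)%E}.
  by move=> m n mn; rewrite lee_fin; exact/lefP/nd_nnsfun_approx.
have mf_ n : measurable_fun setT (EFin \o f_ n).
  by apply/measurable_EFinP; exact: measurable_funTS.
have h1 : (\int[density]_x (f_ n x)%:E)%E @[n --> \oo] --> (\int[density]_x f x)%E.
  rewrite (_ : (\int[density]_x f x)%E =
     (\int[density]_x (limn (fun n => (f_ n x)%:E)))%E).
    apply: cvg_monotone_convergence => //.
    by move=> n x _; rewrite lee_fin.
  by apply: eq_integral => x _; apply/esym/cvg_lim.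
have h2 : (\int[mu]_x ((f_ n x)%:E * (g x)%:E))%E @[n --> \oo] -->
    (\int[mu]_x (f x * (g x)%:E))%E.
  rewrite (_ : (\int[mu]_x (f x * (g x)%:E))%E =
     (\int[mu]_x (limn (fun n => (f_ n x)%:E * (g x)%:E)%E))%E).
    apply: cvg_monotone_convergence => //.
    - by move=> n; apply: emeasurable_funM => //; exact/measurable_EFinP.
    - by move=> n x _; rewrite mule_ge0 ?lee_fin.
    - by move=> x _ m n mn; apply: lee_wpmul2r; [rewrite lee_fin|exact: nd].
  by apply: eq_integral => x _; apply/esym/cvg_lim => //; exact: cvgeZr.
rewrite -(cvg_lim _ h1)// -(cvg_lim _ h2)//.
congr (lim (_ @ \oo)); apply/funext => n.
have s0 r x : (0 <= (r * \1_(f_ n @^-1` [set r]) x)%:E)%E.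
  by rewrite EFinM nnfun_muleindic_ge0.
have mI r : measurable_fun setT (fun x => (r * \1_(f_ n @^-1` [set r]) x)%:E).
  by apply/measurable_EFinP/measurable_funM.
have e1 x : (f_ n x)%:E =
    (\sum_(r \in range (f_ n)) (r * \1_(f_ n @^-1` [set r]) x)%:E)%E.
  by rewrite fimfunE -fsumEFin.
transitivity (\int[density]_x
  (\sum_(r \in range (f_ n)) (r * \1_(f_ n @^-1` [set r]) x)%:E))%E.
  by apply: eq_integral => x _; exact: e1.
transitivity (\int[mu]_x
  (\sum_(r \in range (f_ n)) ((r * \1_(f_ n @^-1` [set r]) x)%:E * (g x)%:E)))%E;
  last by apply: eq_integral => x _; rewrite e1 ge0_mule_fsuml.
rewrite ge0_integral_fsum// ge0_integral_fsum//; last 2 first.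
- by move=> r; apply: emeasurable_funM => //; exact/measurable_EFinP.
- by move=> r x _; rewrite mule_ge0// lee_fin.
apply: eq_fsbigr => r /set_mem[x _ <-{r}].
have f0' : 0 <= f_ n x by [].
under [in LHS]eq_integral do rewrite EFinM.
rewrite ge0_integralZl_EFin//; last exact/measurable_EFinP.
under [in RHS]eq_integral do rewrite EFinM -muleA.
rewrite ge0_integralZl_EFin//; last 2 first.
- by move=> y _; rewrite mule_ge0 ?lee_fin.
- by apply: emeasurable_funM; exact/measurable_EFinP.
congr (_ * _)%E; rewrite integral_indic// setIT.
change (density (f_ n @^-1` [set f_ n x]) =
  \int[mu]_y ((\1_(f_ n @^-1` [set f_ n x]) y)%:E * (g y)%:E))%E.
rewrite /density integral_mkcond; apply: eq_integral => y _.
by rewrite patchE indicE; case: ifP => _; rewrite ?mul1e ?mul0e.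
Qed.

End density.

Section quadratic_substitution.
Context {R : realType}.
Implicit Types x y z : R.
Local Notation mu := (@lebesgue_measure R).

(** A quadratic remainder yields the derivative of [y |y|] uniformly in [y], with no separate
    treatment of the origin, where [|y|] is not differentiable. *)
Lemma is_derive_quadratic_error (f : R -> R) (y d C : R) :
  (forall z, `|f z - f y - d * (z - y)| <= C * (z - y) ^+ 2) ->
  is_derive y 1 f d.
Proof.
move=> fd.
have h : h^-1 *: (f (h *: 1 + y) - f y) @[h --> 0^'] --> d.
  apply/cvgrPdist_le => e e0; have C1 : 0 < `|C| + 1 by rewrite ltr_wpDl.
  near=> h.
  have h0 : h != 0 by near: h; exact: nbhs_dnbhs_neq.
  have := fd (h *: 1 + y); rewrite addrK /GRing.scale /= mulr1 => hd.
  have -> : d - h^-1 * (f (h + y) - f y) =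
    - (h^-1 * (f (h + y) - f y - d * h)) by field.
  rewrite normrN normrM normfV ler_pdivrMl ?normr_gt0//.
  rewrite (le_trans hd)// -(real_normK (num_real h)) expr2 mulrCA ler_wpM2l//.
  have : `|h| < e / (`|C| + 1).
    by near: h; apply: dnbhs0_lt; exact: divr_gt0.
  rewrite ltr_pdivlMr// => /ltW; apply: le_trans.
  by rewrite mulrC ler_wpM2l// (le_trans (ler_norm _))// lerDl.
apply: DeriveDef; first by apply/cvg_ex; exists d.
by apply/cvg_lim.
Unshelve. all: by end_near. Qed.

Lemma measurable_sgr : measurable_fun setT (@Num.sg R).
Proof.
rewrite (_ : @Num.sg R = fun x => if x < 0 then -1 else if x <= 0 then 0 else 1).
  apply: measurable_fun_ifT => //; first exact: measurable_fun_ltr.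
  by apply: measurable_fun_ifT => //; exact: measurable_fun_ler.
by apply/funext => x; case: sgrP.
Qed.

Lemma measurable_sqrtr : measurable_fun setT (@Num.sqrt R).
Proof. by apply: continuous_measurable_fun; exact: sqrt_continuous. Qed.

(* In the variable [x = xof y] the weight [sqrt |x|] becomes [|y| / 2]; [yof] is the inverse. *)
Definition xof y := y * `|y| / 4.
Definition yof x := 2 * Num.sg x * Num.sqrt `|x|.

Lemma xofK : cancel xof yof.
Proof.
move=> y; rewrite /yof /xof; have [y0|y0] := leP 0 y.
  have -> : y * `|y| / 4 = (y / 2) ^+ 2 by rewrite ger0_norm//; field.
  rewrite ger0_norm ?sqr_ge0// sqrtr_sqr ger0_norm ?divr_ge0//.
  have [->|yN0] := eqVneq y 0; first by rewrite mul0r mulr0.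
  rewrite gtr0_sg; last by rewrite exprn_gt0// divr_gt0// lt_neqAle eq_sym yN0.
  by field.
have -> : y * `|y| / 4 = - (y / 2) ^+ 2 by rewrite ltr0_norm//; field.
rewrite normrN ger0_norm ?sqr_ge0// sqrtr_sqr ltr0_norm; last by lra.
rewrite sgrN gtr0_sg; last by nra.
by field.
Qed.

Lemma yofK : cancel yof xof.
Proof.
move=> x; rewrite /yof /xof !normrM (ger0_norm (sqrtr_ge0 _)) normr_sg.
have [->|x0] := eqVneq x 0; first by rewrite sgr0 !mulr0 !mul0r.
rewrite mulr1 (ger0_norm (ler0n _ 2)).
rewrite -[RHS]mulr_sg_norm -[in RHS](sqr_sqrtr (normr_ge0 x)); lra.
Qed.

Lemma xof_error y z :
  `|xof z - xof y - `|y| / 2 * (z - y)| <= 4^-1 * (z - y) ^+ 2.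
Proof.
rewrite /xof ler_norml; have h := sqr_ge0 (z - y).
have [y0|y0] := ger0P y; have [z0|z0] := ger0P z.
- by have := mulr_ge0 y0 z0; move: h; rewrite !expr2 => *; apply/andP; split; lra.
- have := mulr_ge0_le0 y0 (ltW z0); have := sqr_ge0 z; have := sqr_ge0 y.
  by move: h; rewrite !expr2 => *; apply/andP; split; lra.
- have := mulr_le0_ge0 (ltW y0) z0; have := sqr_ge0 z; have := sqr_ge0 y.
  by move: h; rewrite !expr2 => *; apply/andP; split; lra.
- have := mulr_le0 (ltW y0) (ltW z0); have := sqr_ge0 z; have := sqr_ge0 y.
  by move: h; rewrite !expr2 => *; apply/andP; split; lra.
Qed.

Lemma is_derive_xof y : is_derive y 1 xof (`|y| / 2).
Proof. exact: is_derive_quadratic_error (xof_error y). Qed.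

Lemma continuous_xof : continuous xof.
Proof.
move=> y; apply: differentiable_continuous; apply/derivable1_diffP.
by have [] := is_derive_xof y.
Qed.

Lemma xof_le : {mono xof : x y / x <= y}.
Proof.
apply: le_mono => x y xy; rewrite /xof.
have d0 : 0 < y - x by rewrite subr_gt0.
have [y0|y0] := ger0P y; have [x0|x0] := ger0P x; last 2 first.
- by lra.
- have s0 : 0 < - x - y by lra.
  by have := mulr_gt0 d0 s0; lra.
- have s0 : 0 < x + y by lra.
  by have := mulr_gt0 d0 s0; lra.
- have s0 : 0 < - x by lra.
  by have := mulr_gt0 s0 s0; have := mulr_ge0 y0 y0; lra.
Qed.

Lemma xof_lt : {mono xof : x y / x < y}.
Proof. exact: leW_mono xof_le. Qed.

Lemma measurable_xof : measurable_fun setT xof.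
Proof. by apply: continuous_measurable_fun; exact: continuous_xof. Qed.

Lemma measurable_yof : measurable_fun setT yof.
Proof.
apply: measurable_funM.
  apply: measurable_funM => //.
  exact: measurable_sgr.
apply: measurableT_comp => //.
exact: measurable_sqrtr.
Qed.

Lemma integral_norm_half (a b : R) : a < b ->
  (\int[mu]_(y in `]a, b]) (`|y| / 2)%:E = (xof b - xof a)%:E)%E.
Proof.
move=> ab.
have cn : continuous (fun y : R => `|y| / 2).
  move=> y; apply: cvgM; [exact: norm_continuous|exact: cvg_cst].
rewrite integral_itv_obnd_cbnd; last first.
  by apply: measurable_funTS; apply/measurable_EFinP; exact: continuous_measurable_fun.
rewrite (@continuous_FTC2 _ _ xof)//.
- exact: continuous_subspaceT.
- split.
  + by move=> y _; have [] := is_derive_xof y.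
  + by apply: cvg_at_right_filter; exact: continuous_xof.
  + by apply: cvg_at_left_filter; exact: continuous_xof.
- by move=> y _; rewrite derive1E; have [] := is_derive_xof y.
Qed.

End quadratic_substitution.

Section change_of_variables.
Context {R : realType}.
Local Notation mu := (@lebesgue_measure R).
Local Notation half_norm := (fun y : R => `|y| / 2).

Let mhalf : measurable_fun setT half_norm.
Proof. by apply: measurable_funM => //; exact: measurable_normr. Qed.

Let half_ge0 (y : R) : 0 <= half_norm y.
Proof. by rewrite divr_ge0. Qed.

(** The image under [xof] of the measure [|y| / 2 dy] gives each interval []a, b]] the mass [b - a],
    by the fundamental theorem of calculus; hence it is Lebesgue measure. *)
Lemma ge0_integral_xof (f : R -> \bar R) : measurable_fun setT f ->
  (forall x, (0 <= f x)%E) ->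
  (\int[mu]_x f x = \int[mu]_y (f (xof y) * (`|y| / 2)%:E))%E.
Proof.
move=> mf f0.
have mfX : measurable_fun setT (f \o xof).
  exact: (measurableT_comp mf measurable_xof).
have fX0 y : (0 <= (f \o xof) y)%E by exact: f0.
have -> := esym (ge0_integral_density mu mhalf half_ge0 mfX fX0).
have := @ge0_integral_pushforward _ _ (measurableTypeR R) (measurableTypeR R) R xof measurable_xof
  (density mu half_norm) setT f measurableT mf (fun y _ => f0 y).
rewrite preimage_setT => <-.
apply: eq_measure_integral => /=; first exact: measurable_xof.
move=> _ A mA _; apply: lebesgue_measure_unique => //=; first exact: measurable_xof.
move=> _ _ [[a b]] _ <-; rewrite /pushforward lebesgue_measure_itv/=.
rewrite (_ : _ @^-1` _ = `]yof a, yof b]%classic); last first.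
  have e1 y : (a < xof y) = (yof a < y) by rewrite -[in LHS](yofK a) xof_lt.
  have e2 y : (xof y <= b) = (y <= yof b) by rewrite -[in LHS](yofK b) xof_le.
  by apply/seteqP; split => y /=; rewrite !in_itv/= e1 e2.
rewrite lte_fin; case: ltP => [ab|ba].
  by rewrite /density integral_norm_half ?yofK// -xof_lt !yofK.
by rewrite set_itv_ge ?measure0//= bnd_simp -leNgt -xof_le !yofK.
Qed.

End change_of_variables.

Section change_of_variables_signed.
Context {R : realType}.
Local Notation mu := (@lebesgue_measure R).
Local Notation mu2 := (lebesgue2 R).

(** The relation is only asked for [y != 0]: the solution is recovered by dividing by [y / 2], and
    the excluded point is a null set. *)
Lemma integral_xof_norm (F G : R -> \bar R) :
  measurable_fun setT F -> measurable_fun setT G ->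
  (forall x, (0 <= F x)%E) -> (forall x, (0 <= G x)%E) ->
  (forall y : R, y != 0%R -> F (xof y) * (`|y| / 2)%:E = G y)%E ->
  (\int[mu]_x F x = \int[mu]_y G y)%E.
Proof.
move=> mF mG F0 G0 FG; rewrite ge0_integral_xof//.
apply: ge0_ae_eq_integral => //.
- apply: emeasurable_funM; first exact: (measurableT_comp mF measurable_xof).
  by apply/measurable_EFinP/measurable_funM => //; exact: measurable_normr.
- by move=> y _; rewrite mule_ge0// lee_fin divr_ge0.
exists [set 0]; split => //; first exact: lebesgue_measure_set1.
move=> y /= ny; apply: contrapT => /eqP y0; apply: ny => _.
exact: FG.
Qed.

Lemma integral_xof2_norm (F G : R * R -> \bar R) :
  measurable_fun setT F -> measurable_fun setT G ->
  (forall x, (0 <= F x)%E) -> (forall x, (0 <= G x)%E) ->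
  (forall y t : R, y != 0%R -> F (xof y, t) * (`|y| / 2)%:E = G (y, t))%E ->
  (\int[mu2]_x F x = \int[mu2]_y G y)%E.
Proof.
move=> mF mG F0 G0 FG; rewrite /lebesgue2 !fubini_tonelli2//.
apply: eq_integral => t _; apply: integral_xof_norm => //.
- exact: measurable_fun_pair1.
- exact: measurable_fun_pair1.
- by move=> y; exact: FG.
Qed.

(** [F] may be unbounded near [x = 0]; its integrability is read off from the bounded [G], the
    Jacobian absorbing the singularity. The signed identity follows from the nonnegative one applied
    to positive and negative parts. *)
Lemma integrable_xof2 (F G : R * R -> R) :
  measurable_fun setT F -> tame mu2 G ->
  (forall y t, y != 0 -> F (xof y, t) * (`|y| / 2) = G (y, t)) ->
  mu2.-integrable setT (EFin \o F) /\ \int[mu2]_p F p = \int[mu2]_p G p.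
Proof.
move=> mF tG FG; have iG := tame_integrable tG; have mG := tG.1.
have h0 (y : R) : 0 <= `|y| / 2 by rewrite divr_ge0.
have aux (F' G' : R * R -> R) : measurable_fun setT F' -> measurable_fun setT G' ->
    (forall y, 0 <= F' y) -> (forall y, 0 <= G' y) ->
    (forall y t, y != 0 -> F' (xof y, t) * (`|y| / 2) = G' (y, t)) ->
    (\int[mu2]_p (F' p)%:E = \int[mu2]_p (G' p)%:E)%E.
  move=> mF' mG' F0 G0 FG'; apply: integral_xof2_norm.
  - exact/measurable_EFinP.
  - exact/measurable_EFinP.
  - by move=> x; rewrite lee_fin.
  - by move=> x; rewrite lee_fin.
  - by move=> y t y0; rewrite -EFinM FG'.
have iF : mu2.-integrable setT (EFin \o F).
  apply/integrableP; split; first exact/measurable_EFinP.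
  have [_] := integrableP _ _ _ iG.
  rewrite (_ : (\int[mu2]_x `|(EFin \o F) x| = \int[mu2]_x `|(EFin \o G) x|)%E)//.
  apply: (aux (fun p => `|F p|) (fun p => `|G p|)) => //.
  - exact: measurableT_comp.
  - exact: measurableT_comp.
  - by move=> y t y0; rewrite -(ger0_norm (h0 y)) -normrM FG.
split => //.
have E (H : R * R -> R) : mu2.-integrable setT (EFin \o H) ->
   measurable_fun setT H ->
   (\int[mu2]_p H p)%R = (\int[mu2]_p (Num.max (H p) 0)) - (\int[mu2]_p (Num.max (- H p) 0)).
  move=> iH mH; rewrite -RintegralB//; last 2 first.
  - rewrite (_ : EFin \o _ = (EFin \o H)^\+%E); first exact: integrable_funepos.
    by apply/funext => p; rewrite funeposE /= EFin_max.
  - rewrite (_ : EFin \o _ = (EFin \o H)^\-%E); first exact: integrable_funeneg.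
    by apply/funext => p; rewrite funenegE /= EFin_max.
  apply: eq_Rintegral => p _; have [h|h] := leP (H p) 0.
    by rewrite max_l ?oppr_ge0// sub0r opprK.
  by rewrite max_r ?subr0// oppr_le0 ltW.
have mx (H : R * R -> R) : measurable_fun setT H ->
    measurable_fun setT (fun p => Num.max (H p) 0).
  by move=> mH; exact: measurable_maxr.
rewrite (E F)// (E G)//; congr (fine _ - fine _); apply: aux.
- exact: mx.
- exact: mx.
- by move=> y; rewrite le_max lexx orbT.
- by move=> y; rewrite le_max lexx orbT.
- by move=> y t y0; rewrite maxr_pMl// FG// mul0r.
- by apply: mx; exact: measurableT_comp.
- by apply: mx; exact: measurableT_comp.
- by move=> y; rewrite le_max lexx orbT.
- by move=> y; rewrite le_max lexx orbT.
- by move=> y t y0; rewrite maxr_pMl// mulNr FG// mul0r.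
Qed.

End change_of_variables_signed.

(** * Difference quotients and primitives *)

Section difference_quotients.
Context {R : realType}.
Implicit Types (f : R -> R) (L C r y z : R).
Local Notation mu := (@lebesgue_measure R).

Definition lips L f := forall y z, `|f y - f z| <= L * `|y - z|.

(** Right quotients along a sequence of steps, so that their limits are measurable and dominated
    convergence applies. *)
Definition dquot f (n : nat) y : R := n.+1%:R * (f (y + n.+1%:R^-1) - f y).

Lemma lips_ge0 L f : lips L f -> 0 <= L.
Proof.
move=> /(_ 0 1); rewrite sub0r normrN normr1 mulr1; exact: le_trans.
Qed.

Lemma lips_continuous L f : lips L f -> continuous f.
Proof.
move=> lf y; apply/cvgrPdist_le => e e0.
have L1 : 0 < L + 1 by rewrite ltr_wpDl// (lips_ge0 lf).
near=> z; rewrite (le_trans (lf _ _))//.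
have : `|y - z| <= e / (L + 1).
  by near: z; apply: cvgr_dist_le; rewrite ?divr_gt0//; exact: cvg_id.
rewrite ler_pdivlMr// => h; apply: le_trans h.
by rewrite mulrC ler_wpM2l// lerDl.
Unshelve. all: by end_near. Qed.

Lemma lips_measurable L f : lips L f -> measurable_fun setT f.
Proof. by move=> /lips_continuous; exact: continuous_measurable_fun. Qed.

Lemma lipsB L1 L2 f g : lips L1 f -> lips L2 g -> lips (L1 + L2) (f \- g).
Proof.
move=> lf lg y z; have -> : (f \- g) y - (f \- g) z =
  (f y - f z) - (g y - g z) by rewrite /=; ring.
by rewrite mulrDl (le_trans (ler_normB _ _))// lerD.
Qed.

Lemma dquot_bound L f n y : lips L f -> `|dquot f n y| <= L.
Proof.
move=> lf; rewrite /dquot normrM ger0_norm// -ler_pdivlMl//.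
rewrite (le_trans (lf _ _))// addrC addKr ger0_norm ?invr_ge0//.
by rewrite mulrC.
Qed.

Lemma measurable_dquot f n : measurable_fun setT f ->
  measurable_fun setT (dquot f n).
Proof.
move=> mf; apply: measurable_funM => //; apply: measurable_funB => //.
by apply: (measurableT_comp mf); apply: measurable_funD.
Qed.

Lemma dquotB f g n y : dquot (f \- g) n y = dquot f n y - dquot g n y.
Proof. by rewrite /dquot /=; ring. Qed.

Lemma dquot_nd f n y : {homo f : x z / x <= z} -> 0 <= dquot f n y.
Proof.
by move=> ndf; rewrite mulr_ge0// subr_ge0 ndf// lerDl invr_ge0.
Qed.

Lemma is_derive_quot f y d (u : nat -> R) : is_derive y 1 f d ->
  (forall n, u n != 0) -> u n @[n --> \oo] --> 0 ->
  (u n)^-1 * (f (u n + y) - f y) @[n --> \oo] --> d.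
Proof.
move=> [df <-] u0 cu.
have dfl : (h^-1 *: (f (h *: 1 + y) - f y)) @[h --> 0^'] --> 'D_1 f y by exact: df.
have /cvgr_dnbhsP /(_ u (conj u0 cu)) := dfl.
by apply: cvg_trans; apply: near_eq_cvg; near=> n; rewrite /GRing.scale /= mulr1.
Unshelve. all: by end_near. Qed.

Lemma dquot_cvg f y d : is_derive y 1 f d -> dquot f n y @[n --> \oo] --> d.
Proof.
move=> df; have h := @is_derive_quot f y d harmonic df.
have /h : forall n, (harmonic n : R) != 0 by move=> n; rewrite invr_eq0.
move=> /(_ (@cvg_harmonic R)); apply: cvg_trans; apply: near_eq_cvg; near=> n.
by rewrite /dquot /= invrK [_ + y]addrC.
Unshelve. all: by end_near. Qed.

Lemma dquotN_cvg f y d : is_derive y 1 f d ->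
  n.+1%:R * (f (y - n.+1%:R^-1) - f y) @[n --> \oo] --> - d.
Proof.
move=> df; have h := @is_derive_quot f y d (fun n => - harmonic n) df.
have /h : forall n, - (harmonic n : R) != 0.
  by move=> n; rewrite oppr_eq0 invr_eq0.
have /[swap]/[apply] : - (harmonic n : R) @[n --> \oo] --> 0.
  by rewrite -oppr0; apply: cvgN; exact: cvg_harmonic.
move=> /cvgN; apply: cvg_trans; apply: near_eq_cvg; near=> n.
transitivity (- ((- (n.+1%:R^-1 : R))^-1 * (f (- n.+1%:R^-1 + y) - f y))) => //.
by rewrite invrN invrK mulNr opprK [- _ + y]addrC.
Unshelve. all: by end_near. Qed.

Lemma is_derive_dquot_bound f L y d : lips L f -> is_derive y 1 f d -> `|d| <= L.
Proof.
move=> lf /dquot_cvg /cvg_norm h.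
rewrite -(cvg_lim _ h)//; apply: limr_le; first exact: cvgP h.
by apply: nearW => n; exact: dquot_bound.
Qed.

(** The regularity kept by a smooth test function after composition with [xof]. *)
Record test (psi dpsi : R -> R) (r C : R) : Prop := Test {
  test_supp : forall y, r < `|y| -> psi y = 0 ;
  test_lips : lips C psi ;
  test_derive : forall y, is_derive y 1 psi (dpsi y) }.

Definition cball r : set R := `[- r, r]%classic.

Lemma cballE r y : cball r y <-> `|y| <= r.
Proof. by rewrite /cball /= in_itv/= ler_norml. Qed.

Lemma measurable_cball r : measurable (cball r).
Proof. exact: measurable_itv. Qed.

Lemma cball_fin r : (mu (cball r) < +oo)%E.
Proof. by rewrite /cball lebesgue_measure_itv/=; case: ifP => _; rewrite ?ltry. Qed.

Lemma tame_cball f r C : measurable_fun setT f -> (forall y, `|y| <= r -> `|f y| <= C) ->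
  (forall y, r < `|y| -> f y = 0) -> tame mu f.
Proof.
move=> mf fC f0; apply: (@tame_supp _ _ _ mu f (cball r) `|C|) => //.
- exact: measurable_cball.
- exact: cball_fin.
- move=> y; have [yr|yr] := leP `|y| r; last by rewrite f0// normr0.
  by rewrite (le_trans (fC _ yr))// ler_norm.
- by move=> y /cballE/negP; rewrite -ltNge; exact: f0.
Qed.

Lemma lips_bound L f r y : lips L f -> `|y| <= r -> `|f y| <= `|f 0| + L * r.
Proof.
move=> lf yr; rewrite -[f y](subrK (f 0)) addrC (le_trans (ler_normD _ _))// lerD2l.
by rewrite (le_trans (lf _ _))// subr0 ler_wpM2l// (lips_ge0 lf).
Qed.

Section test_theory.
Variables (psi dpsi : R -> R) (r C : R).
Hypothesis tpsi : test psi dpsi r C.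

Lemma test_C_ge0 : 0 <= C. Proof. exact: lips_ge0 (test_lips tpsi). Qed.

Lemma test_measurable : measurable_fun setT psi.
Proof. exact: lips_measurable (test_lips tpsi). Qed.

Lemma dtest_measurable : measurable_fun setT dpsi.
Proof.
apply: (@measurable_fun_cvg _ _ _ _ (fun n => dquot psi n)).
  by move=> n; apply: measurable_dquot; exact: test_measurable.
by move=> y _; apply: dquot_cvg; exact: test_derive tpsi y.
Qed.

Lemma dtest_bound y : `|dpsi y| <= C.
Proof. exact: is_derive_dquot_bound (test_lips tpsi) (test_derive tpsi y). Qed.

Lemma dtest_supp y : r < `|y| -> dpsi y = 0.
Proof.
move=> ry; have [_ <-] := test_derive tpsi y.
have : is_derive y 1 psi 0.
  apply: near_eq_is_derive (is_derive_cst 0 y 1).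
  near=> z; apply/esym/(test_supp tpsi).
  by near: z; apply: (@cvgr_norm_gt _ _ _ _ _ idfun y) ry; exact: cvg_id.
by case.
Unshelve. all: by end_near. Qed.

End test_theory.

End difference_quotients.

Section primitives.
Context {R : realType}.
Implicit Types (f : R -> R) (L C r y z : R).
Local Notation mu := (@lebesgue_measure R).

Lemma measurable_shift a : measurable_fun setT (fun y : R => y + a).
Proof. exact: measurable_funD. Qed.

Lemma lebesgue_measure_shift a (A : set R) : measurable A ->
  mu A = pushforward mu ((fun y => y + a) : measurableTypeR R -> measurableTypeR R) A.
Proof.
move=> mA; apply: lebesgue_measure_unique => //=; first exact: measurable_shift.
move=> _ _ [[b c]] _ <-; rewrite /pushforward.
rewrite (_ : _ @^-1` _ = `]b - a, c - a]%classic); last first.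
  by apply/seteqP; split => y /=; rewrite !in_itv/= ltrBlDr lerBrDr.
rewrite !lebesgue_measure_itv/= !lte_fin ltrD2r.
by case: ifP => // _; rewrite -!EFinD; congr EFin; ring.
Qed.

Lemma tame_shift f a : tame mu f -> tame mu (fun y => f (y + a)).
Proof.
move=> [mf [A [C [mA fA Af]]]].
split; first exact: (measurableT_comp mf (measurable_shift a)).
exists ((fun y => y + a) @^-1` A), C; split.
- by rewrite -[X in measurable X]setTI; exact: measurable_shift.
- apply: le_lt_trans fA; rewrite le_eqVlt; apply/orP; left; apply/eqP/esym.
  exact: (lebesgue_measure_shift a mA).
- by move=> x; exact: Af.
Qed.

Lemma Rint_shift f a : tame mu f -> \int[mu]_y f (y + a) = \int[mu]_y f y.
Proof.
move=> tf; rewrite /Rintegral; congr fine.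
have mphi : measurable_fun [set: measurableTypeR R]
  ((fun y => y + a) : measurableTypeR R -> measurableTypeR R) by exact: measurable_shift.
have := @integral_pushforward _ _ (measurableTypeR R) (measurableTypeR R) R
  _ mphi mu setT (EFin \o f) _ _ measurableT.
rewrite preimage_setT => <-//; last 2 first.
- by apply/measurable_EFinP; exact: tf.1.
- exact: tame_integrable (tame_shift a tf).
by apply: eq_measure_integral => //= A mA _; rewrite (lebesgue_measure_shift a mA).
Qed.

(* The signed indicator makes this the integral of [m] from [0] to [y], for either sign of [y]. *)
Definition prim (m : R -> R) y := \int[mu]_x (m x * ((x < y)%R%:R - (x < 0)%R%:R)).

Let sgnw (a b x : R) : R := (x < b)%R%:R - (x < a)%R%:R.

Let measurable_sgnw a b : measurable_fun setT (sgnw a b).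
Proof.
have h c : measurable_fun setT (fun x : R => (x < c)%R%:R : R).
  rewrite (_ : (fun _ => _) = (fun x => if x < c then 1 else 0)).
    by apply: measurable_fun_ifT => //; exact: measurable_fun_ltr.
  by apply/funext => x; case: ltP.
exact: measurable_funB.
Qed.

Let sgnw_tame (m : R -> R) (M a b : R) : measurable_fun setT m ->
  (forall y, `|m y| <= M) -> tame mu (fun x => m x * sgnw a b x).
Proof.
move=> mm mM; apply: (@tameM _ _ _ mu (sgnw a b) m M) => //.
apply: (@tame_cball _ _ (`|a| + `|b|) 1) => //.
  by move=> y _; rewrite /sgnw; do 2 case: ltP => _ /=; rewrite ler_norml; lra.
move=> y; rewrite /sgnw lter_normr => /orP h.
have := ler_norm a; have := ler_norm b; have := ler_norm (- a);
have := ler_norm (- b); have := normr_ge0 a; have := normr_ge0 b.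
by rewrite !normrN; case: h => h ? ? ? ? ? ?; do 2 case: ltP => ? /=; lra.
Qed.

Lemma prim_weight_tame (m : R -> R) (M a b : R) : measurable_fun setT m ->
  (forall y, `|m y| <= M) -> tame mu (fun x => m x * ((x < b)%R%:R - (x < a)%R%:R)).
Proof. exact: sgnw_tame. Qed.

Lemma prim_weight_le (m : R -> R) (M a b x : R) : (forall y, `|m y| <= M) ->
  `|m x * ((x < b)%R%:R - (x < a)%R%:R)| <= M * \1_(cball (`|a| + `|b|)) x.
Proof.
move=> mM; rewrite normrM indicE; case: (boolP (x \in _)) => [_|xab].
  by apply: ler_pM => //; do 2 case: ltP => _ /=; rewrite ler_norml; lra.
rewrite mulr0 -(mulr0 `|m x|) ler_wpM2l// normr_le0 subr_eq0; apply/eqP.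
have {xab}/orP h : (`|a| + `|b| < x) || (`|a| + `|b| < - x).
  rewrite -lter_normr ltNge; apply/negP => h; move/negP: xab; apply.
  by apply/mem_set/cballE.
have := ler_norm a; have := ler_norm b; have := ler_norm (- a);
have := ler_norm (- b); have := normr_ge0 a; have := normr_ge0 b.
by rewrite !normrN; case: h => h ? ? ? ? ? ?; do 2 case: ltP => ? //=; lra.
Qed.

Lemma primB (m : R -> R) (M a b : R) : measurable_fun setT m ->
  (forall y, `|m y| <= M) ->
  prim m b - prim m a = \int[mu]_x (m x * ((x < b)%R%:R - (x < a)%R%:R)).
Proof.
move=> mm mM; rewrite /prim -RintB; [|exact: sgnw_tame mm mM..].
by apply: eqRint => x; ring.
Qed.

(** Translates an order between bounded functions into the relation between potentials that [hopf]
    preserves. *)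
Lemma prim_diff_nd (m1 m2 : R -> R) (M : R) : measurable_fun setT m1 -> measurable_fun setT m2 ->
  (forall y, `|m1 y| <= M) -> (forall y, `|m2 y| <= M) ->
  (forall y, m1 y <= m2 y) ->
  {homo (prim m2 \- prim m1) : a b / a <= b}.
Proof.
move=> mm1 mm2 M1 M2 m12 a b ab /=.
suff : prim m1 b - prim m1 a <= prim m2 b - prim m2 a by lra.
rewrite (primB _ _ mm1 M1) (primB _ _ mm2 M2); apply: le_Rint.
- exact: sgnw_tame mm1 M1.
- exact: sgnw_tame mm2 M2.
- move=> x; apply: ler_wpM2r => //; case: (ltP x a) => [xa|_].
    by rewrite (lt_le_trans xa ab) subrr.
  by case: ltP => _ /=; lra.
Qed.

Lemma prim_cst (M a b : R) : a <= b -> prim (cst M) b - prim (cst M) a = M * (b - a).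
Proof.
move=> ab; rewrite (@primB _ `|M|)//.
transitivity (\int[mu]_x (M * \1_(`[a, b[%classic) x)).
  apply: eqRint => x /=; congr (_ * _); rewrite indicE mem_setE in_itv/=.
  by case: (ltP x b) => xb; case: (ltP x a) => xa //=; rewrite ?subrr ?subr0//; lra.
rewrite RintZ.
  rewrite /Rintegral integral_indic// setIT; congr (_ * _).
  have := @lebesgue_measure_itv R `[a, b[; rewrite /= lte_fin => e.
  rewrite [X in fine X](_ : _ = (b - a)%:E)//; apply: (etrans e).
  by case: ltP => //= ba; congr EFin; apply/esym/eqP; rewrite subr_eq0 eq_le ab ba.
apply: (@tame_supp _ (measurableTypeR R) R mu _ (`[a, b[%classic) 1) => //.
- have := @lebesgue_measure_itv R `[a, b[; rewrite /= => e.
  by apply: (eq_ind_r (fun v => v < +oo)%E _ e); case: ifP => _; rewrite ?ltry.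
- by move=> x; rewrite indicE normr_nat lern1 leq_b1.
- by move=> x nx; rewrite indicE memNset.
Qed.

(** Obtained by comparing [m] with the constants [M] and [- M], whose primitives are explicit. *)
Lemma prim_lips (m : R -> R) (M : R) : measurable_fun setT m ->
  (forall y, `|m y| <= M) -> lips M (prim m).
Proof.
move=> mm mM.
have M0 : 0 <= M by rewrite (le_trans _ (mM 0)).
have h a b : a <= b -> `|prim m b - prim m a| <= M * (b - a).
  move=> ab; rewrite -(prim_cst M ab) ler_norml.
  have cM (y : R) : `|(cst M : R -> R) y| <= M by rewrite ger0_norm.
  have cMN (y : R) : `|(cst (- M) : R -> R) y| <= M by rewrite normrN ger0_norm.
  have mc (c : R) : measurable_fun setT (cst c : R -> R) by [].
  have := prim_cst M ab; have := prim_cst (- M) ab.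
  have := @prim_diff_nd m (cst M) M mm (mc M) mM cM _ a b ab.
  have := @prim_diff_nd (cst (- M)) m M (mc _) mm cMN mM _ a b ab.
  have l1 (y : R) : - M <= m y by move: (mM y); rewrite ler_norml => /andP[].
  have l2 (y : R) : m y <= M by move: (mM y); rewrite ler_norml => /andP[].
  by move=> /(_ l1) /= h1 /(_ l2) /= h2 e1 e2; apply/andP; split; lra.
move=> y z; have [yz|/ltW zy] := leP y z.
  by rewrite distrC (distrC y) (ger0_norm (x := z - y)) ?subr_ge0//; exact: h.
by rewrite (ger0_norm (x := y - z)) ?subr_ge0//; exact: h.
Qed.

End primitives.

Section primitives_theory.
Context {R : realType}.
Implicit Types (f : R -> R) (L C r y z : R).
Local Notation mu := (@lebesgue_measure R).

Lemma ae_imply (P Q : R -> Prop) : (forall x, P x -> Q x) ->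
  {ae mu, forall x, P x} -> {ae mu, forall x, Q x}.
Proof.
move=> PQ [A [mA A0 sA]]; exists A; split => //.
by apply: subset_trans sA => x /=; apply: contra_not; exact: PQ.
Qed.

Lemma bounded_integrable_itv (m : R -> R) (M a b : R) : measurable_fun setT m ->
  (forall y, `|m y| <= M) -> mu.-integrable `[a, b] (EFin \o m).
Proof.
move=> mm mM; apply: measurable_bounded_integrable => //.
- have := @lebesgue_measure_itv R `[a, b]; rewrite /= => e.
  by apply: (eq_ind_r (fun v => v < +oo)%E _ e); case: ifP => _; rewrite ?ltry.
- exact: measurable_funTS.
- by exists M; split => [|M' MM' y _]; [exact: num_real|exact: (le_trans (mM y) (ltW MM'))].
Qed.

Lemma bounded_locally_integrable (m : R -> R) (M : R) : measurable_fun setT m ->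
  (forall y, `|m y| <= M) -> locally_integrable setT m.
Proof.
move=> mm mM; split => //; first exact: openT.
move=> K _ cK.
have : mu.-integrable K (EFin \o m).
  apply: measurable_bounded_integrable => //.
  - exact: compact_measurable.
  - exact: compact_finite_measure.
  - exact: measurable_funTS.
  - by exists M; split => [|M' MM' y _]; [exact: num_real|exact: (le_trans (mM y) (ltW MM'))].
by case/integrableP.
Qed.

Lemma prim_itv (m : R -> R) (M a b : R) : measurable_fun setT m ->
  (forall y, `|m y| <= M) -> a <= b ->
  prim m b = \int[mu]_(x in `[a, b]) m x + prim m a.
Proof.
move=> mm mM ab; suff : prim m b - prim m a = \int[mu]_(x in `[a, b]) m x by lra.
rewrite (primB _ _ mm mM) -Rintegral_itv_bndo_bndc; last first.
  apply: integrableS (bounded_integrable_itv a b mm mM) => //.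
  by move=> x /=; rewrite !in_itv/= => /andP[-> /ltW].
rewrite [RHS]Rintegral_mkcond; apply: eqRint => x; rewrite patchE mem_setE in_itv/=.
case: (ltP x a) => xa; case: (ltP x b) => xb //=; rewrite ?subrr ?mulr0 ?subr0 ?mulr1//.
by move: xa; rewrite ltNge (le_trans ab xb).
Qed.

Lemma prim_derive (m : R -> R) (M : R) : measurable_fun setT m ->
  (forall y, `|m y| <= M) ->
  {ae mu, forall y, is_derive y 1 (prim m) (m y)}.
Proof.
move=> mm mM.
(* The integrals start at [- n]; every point lies to the right of some [- n], and only countably
   many null sets are discarded. *)
have h n : {ae mu, forall x : R, - n%:R < x ->
    is_derive x 1 (fun x : R => \int[mu]_(t in `[- n%:R, x]) m t) (m x)}.
  have := @FTC1 R m (BLeft (- n%:R)) (fun y => bounded_integrable_itv _ y mm mM)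
    (bounded_locally_integrable mm mM).
  apply: ae_imply => x hx nx.
  have [|d1 d2] := hx; first by rewrite lte_fin.
  by apply: DeriveDef; [exact: d1|rewrite -derive1E; exact: d2].
have /ae_foralln := h.
apply: ae_imply => y hy.
have [n yn] : exists n : nat, - n%:R < y.
  exists (Num.truncn `|y|).+1.
  have := truncnS_gt `|y|; have := ler_norm (- y); rewrite normrN; lra.
apply: near_eq_is_derive (_ : is_derive y 1
   ((fun x : R => \int[mu]_(t in `[- n%:R, x]) m t) \+ cst (prim m (- n%:R))) (m y)).
  near=> z; rewrite /= -(prim_itv mm mM)//.
  by near: z; apply: (@cvgr_ge _ _ _ _ idfun y); [exact: cvg_id|].
rewrite -[m y]addr0; apply: is_deriveD; first exact: hy.
Unshelve. all: by end_near. Qed.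

Lemma continuous_locally_bounded f r : continuous f ->
  exists B : R, forall y, `|y| <= r -> `|f y| <= B.
Proof.
move=> cf.
have [M [_ hM]] : bounded_set (f @` cball r).
  apply: compact_bounded; apply: continuous_compact.
    exact: continuous_subspaceT.
  exact: segment_compact.
exists (M + 1) => y yr; apply: (hM (M + 1)); first by rewrite ltrDl.
by exists y => //; apply/cballE.
Qed.

Lemma tame_mul_test f (psi dpsi : R -> R) r C : continuous f ->
  test psi dpsi r C -> tame mu (fun y => f y * psi y).
Proof.
move=> cf tp; have [B hB] := continuous_locally_bounded r cf.
have [D hD] := continuous_locally_bounded r (lips_continuous (test_lips tp)).
apply: (@tame_cball _ _ r (`|B| * `|D|)).
- apply: measurable_funM; last exact: test_measurable tp.
  exact: continuous_measurable_fun.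
- move=> y yr; rewrite normrM ler_pM//.
    by rewrite (le_trans (hB _ yr))// ler_norm.
  by rewrite (le_trans (hD _ yr))// ler_norm.
- by move=> y ry; rewrite (test_supp tp)// mulr0.
Qed.

(* Abel summation: the difference quotient is moved to the test function. *)
Lemma dquot_ibp f (psi dpsi : R -> R) r C : continuous f -> test psi dpsi r C ->
  \int[mu]_y (dquot f n y * psi y) @[n --> \oo] -->
    - \int[mu]_y (f y * dpsi y).
Proof.
move=> cf tp.
have tfp := tame_mul_test cf tp.
(* A shift by at most 1 enlarges the support, hence the radius [r + 1]. *)
have tshift n : test (fun y => psi (y - n.+1%:R^-1)) (fun y => dpsi (y - n.+1%:R^-1))
    (r + 1) C.
  split.
  - move=> y ry; apply: (test_supp tp).
    have n1 : (n.+1%:R^-1 : R) <= 1 by rewrite invf_le1// ler1n.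
    rewrite -(ltrD2r 1) (lt_le_trans ry)//.
    rewrite -[y in X in X <= _](subrK n.+1%:R^-1) (le_trans (ler_normD _ _))// lerD2l.
    by rewrite ger0_norm.
  - by move=> y z; rewrite (le_trans (test_lips tp _ _))// opprB addrA subrK.
  - move=> y; have := test_derive tp (y - n.+1%:R^-1) => hd.
    rewrite -[dpsi _]mulr1.
    apply: (@is_derive1_comp R psi (fun y => y - n.+1%:R^-1) y (dpsi (y - n.+1%:R^-1)) 1).
    exact: is_derive_shift.
have e n : \int[mu]_y (dquot f n y * psi y) =
  \int[mu]_y (f y * (n.+1%:R * (psi (y - n.+1%:R^-1) - psi y))).
  have cfs : continuous (fun y => f (y + n.+1%:R^-1)).
    move=> y; apply: (@cvg_comp _ _ _ (fun y => y + n.+1%:R^-1) f _ _ _ _ (cf _)).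
    by apply: cvgD; [exact: cvg_id|exact: cvg_cst].
  have t1 := tame_mul_test cfs tp.
  have t2 := tame_mul_test cf (tshift n).
  transitivity (n.+1%:R * (\int[mu]_y (f (y + n.+1%:R^-1) * psi y)
      - \int[mu]_y (f y * psi y))).
    rewrite -RintB// -RintZ; last exact: tameB.
    by apply: eqRint => y; rewrite /dquot; ring.
  transitivity (n.+1%:R * (\int[mu]_y (f y * psi (y - n.+1%:R^-1))
      - \int[mu]_y (f y * psi y))); last first.
    rewrite -RintB// -RintZ; last exact: tameB.
    by apply: eqRint => y; ring.
  have /= s2 := Rint_shift n.+1%:R^-1 t2.
  rewrite -s2; congr (_ * (_ - _)).
  by apply: eqRint => y; rewrite addrK.
under eq_fun do rewrite e.
have [B hB] := continuous_locally_bounded (r + 1) cf.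
have B0 : 0 <= `|B| by [].
rewrite (_ : - _ = \int[mu]_y (f y * - dpsi y)); last first.
  rewrite -RintN; first by apply: eqRint => y; rewrite mulrN.
  apply: (@tame_cball _ _ r (`|B| * C)).
  - apply: measurable_funM; last exact: dtest_measurable tp.
    exact: continuous_measurable_fun.
  - move=> y yr; rewrite normrM; apply: ler_pM => //; last exact: (dtest_bound tp).
    by rewrite (le_trans (hB _ _)) ?ler_norm// (le_trans yr)// lerDl.
  - by move=> y ry; rewrite (dtest_supp tp)// mulr0.
apply: (@Rintegral_dominated _ _ _ mu _ _ (cball (r + 1)) (`|B| * C)).
- move=> n; apply: measurable_funM; first exact: continuous_measurable_fun.
  apply: measurable_funM => //; apply: measurable_funB.
    exact: test_measurable (tshift n).
  exact: test_measurable tp.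
- apply: measurable_funM; first exact: continuous_measurable_fun.
  by apply: measurableT_comp => //; exact: dtest_measurable tp.
- exact: measurable_cball.
- exact: cball_fin.
- move=> n y; rewrite indicE; case: (boolP (y \in _)) => [/set_mem/cballE yr|].
    rewrite mulr1 normrM ler_pM//.
      by rewrite (le_trans (hB _ yr))// ler_norm.
    rewrite normrM ger0_norm// -ler_pdivlMl// (le_trans (test_lips tp _ _))//.
    by rewrite addrAC subrr sub0r normrN ger0_norm// mulrC.
  rewrite mulr0 normr_le0 => /negP yr.
  have {}yr : r + 1 < `|y|.
    by rewrite ltNge; apply/negP => h; apply: yr; apply/mem_set/cballE.
  by rewrite (test_supp (tshift n))// (test_supp tp) ?subrr ?mulr0// (lt_trans _ yr)// ltrDl.
- apply: aeW => y; apply: cvgMr; exact: (dquotN_cvg (test_derive tp y)).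
Qed.

(** The integrals of [dquot (prim m) n] against [psi] have two limits: one by Abel summation, the
    other because the quotients converge to [m] almost everywhere and are bounded. *)
Lemma prim_ibp (m : R -> R) (M : R) (psi dpsi : R -> R) r C : measurable_fun setT m ->
  (forall y, `|m y| <= M) -> test psi dpsi r C ->
  \int[mu]_y (m y * psi y) = - \int[mu]_y (prim m y * dpsi y).
Proof.
move=> mm mM tp.
have lp := prim_lips mm mM.
have h := dquot_ibp (lips_continuous lp) tp.
rewrite -(cvg_lim _ h)//; apply/esym/cvg_lim => //.
have [D hD] := continuous_locally_bounded r (lips_continuous (test_lips tp)).
have M0 : 0 <= M by rewrite (le_trans _ (mM 0)).
have mps := test_measurable tp.
apply: (@Rintegral_dominated _ _ _ mu _ _ (cball r) (M * `|D|)).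
- move=> n; apply: measurable_funM => //.
  apply: measurable_dquot; exact: lips_measurable lp.
- exact: measurable_funM.
- exact: measurable_cball.
- exact: cball_fin.
- move=> n y; rewrite indicE; case: (boolP (y \in _)) => [/set_mem/cballE yr|].
    rewrite mulr1 normrM ler_pM//; first exact: dquot_bound.
    by rewrite (le_trans (hD _ yr))// ler_norm.
  rewrite mulr0 normr_le0 => /negP yr.
  rewrite (test_supp tp) ?mulr0// ltNge; apply/negP => h1.
  by apply: yr; apply/mem_set/cballE.
- have := prim_derive mm mM.
  apply: ae_imply => y hy.
  by apply: cvgMl; exact: dquot_cvg.
Qed.

End primitives_theory.

(** * The Hopf-Lax operator *)

Section hopf_lax.
Context {R : realType}.
Implicit Types (V : R -> R) (L h t y z c : R).

(** The cost is [h] times the Legendre transform of [p ^ 2] at [(y - z) / h]. *)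
Definition hopf h V y := inf (range (fun z => V z + (y - z) ^+ 2 / (4 * h))).

Lemma young_quarter L h s : 0 < h -> L * s <= s ^+ 2 / (4 * h) + h * L ^+ 2.
Proof.
move=> h0; rewrite -subr_ge0.
have -> : s ^+ 2 / (4 * h) + h * L ^+ 2 - L * s = (s - 2 * h * L) ^+ 2 / (4 * h).
  by field; rewrite gt_eqF.
by rewrite divr_ge0 ?sqr_ge0// mulr_ge0// ltW.
Qed.

Section fixed.
Variables (h L : R) (V : R -> R).
Hypotheses (h0 : 0 < h) (lV : lips L V).

Lemma hopf_value_ge y z : V y - h * L ^+ 2 <= V z + (y - z) ^+ 2 / (4 * h).
Proof.
have := @young_quarter L h `|y - z| h0; rewrite real_normK ?num_real//.
by have := lV y z; rewrite ler_norml => /andP[_]; lra.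
Qed.

Let hasinf y : has_inf (range (fun z => V z + (y - z) ^+ 2 / (4 * h))).
Proof.
split; first by exists (V 0 + (y - 0) ^+ 2 / (4 * h)); exists 0.
by exists (V y - h * L ^+ 2) => _ [z _ <-]; exact: hopf_value_ge.
Qed.

Lemma hopf_le y z : hopf h V y <= V z + (y - z) ^+ 2 / (4 * h).
Proof. by apply: ge_inf; [case: (hasinf y)|exists z]. Qed.

Lemma hopf_ge y c : (forall z, c <= V z + (y - z) ^+ 2 / (4 * h)) -> c <= hopf h V y.
Proof.
move=> hc; apply: lb_le_inf; first by case: (hasinf y).
by move=> _ [z _ <-].
Qed.

Lemma hopf_approx y e : 0 < e -> exists z, V z + (y - z) ^+ 2 / (4 * h) < hopf h V y + e.
Proof.
by move=> e0; have [_ [z _ <-] hz] := inf_adherent e0 (hasinf y); exists z.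
Qed.

Lemma hopf_le_self y : hopf h V y <= V y.
Proof. by rewrite (le_trans (hopf_le y y))// subrr expr0n mul0r addr0. Qed.

Lemma hopf_ge_self y : V y - h * L ^+ 2 <= hopf h V y.
Proof. by apply: hopf_ge => z; exact: hopf_value_ge. Qed.

Lemma hopf_diff_bound y : `|hopf h V y - V y| <= h * L ^+ 2.
Proof.
rewrite ler_norml; have := hopf_le_self y; have := hopf_ge_self y.
have : 0 <= h * L ^+ 2 by rewrite mulr_ge0 ?sqr_ge0// ltW.
by move=> *; apply/andP; split; lra.
Qed.

Lemma hopf_lips : lips L (hopf h V).
Proof.
have aux y y' : hopf h V y' <= hopf h V y + L * `|y - y'|.
  rewrite -lerBlDr; apply: hopf_ge => z.
  (* The competitor is moved along with the base point, so the quadratic cost does not change. *)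
  have := hopf_le y' (z + (y' - y)).
  have -> : y' - (z + (y' - y)) = y - z by ring.
  have := lV z (z + (y' - y)).
  have -> : z - (z + (y' - y)) = y - y' by ring.
  by rewrite ler_norml => /andP[]; lra.
move=> y y'; rewrite ler_norml; have := aux y y'; have := aux y' y.
by rewrite (distrC y' y) => *; apply/andP; split; lra.
Qed.

(* [hopf h V - y ^ 2 / (4 h)] is concave, hence its chord slopes are monotone. *)
Lemma hopf_chord y s r : 0 < s -> s <= r ->
  (hopf h V (y + r) - hopf h V y) / r - r / (4 * h) <=
  (hopf h V (y + s) - hopf h V y) / s - s / (4 * h).
Proof.
move=> s0 sr; have r0 := lt_le_trans s0 sr.
have s1 : 0 <= s / r by rewrite divr_ge0// ltW.
have s2 : 0 <= 1 - s / r by rewrite subr_ge0 ler_pdivrMr// mul1r.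
suff : s / r * hopf h V (y + r) + (1 - s / r) * hopf h V y - s * (r - s) / (4 * h)
    <= hopf h V (y + s).
  move=> hs; rewrite -subr_ge0.
  rewrite [leRHS](_ : _ = (hopf h V (y + s) - (s / r * hopf h V (y + r) + (1 - s / r) * hopf h V y
    - s * (r - s) / (4 * h))) / s); last by field; rewrite !gt_eqF.
  by rewrite divr_ge0 ?subr_ge0// ltW.
apply: hopf_ge => z.
have h1 := ler_wpM2l s1 (hopf_le (y + r) z).
have h2 := ler_wpM2l s2 (hopf_le y z).
apply: (le_trans (lerB (lerD h1 h2) (lexx _))).
rewrite le_eqVlt; apply/orP; left; apply/eqP; field.
by rewrite !gt_eqF.
Qed.

End fixed.

(** Take near-minimisers [z1] for [V1] at [y] and [z2] for [V2] at [y']. If [z1 <= z2], each point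
    keeps its competitor but the potentials are exchanged, which the monotonicity of [V2 - V1] pays
    for. Otherwise the potentials keep their competitors and the points are exchanged: the convex
    cost is smaller for the ordered pairing. *)
Lemma hopf_comparison h L1 L2 V1 V2 : 0 < h -> lips L1 V1 -> lips L2 V2 ->
  {homo (V2 \- V1) : y z / y <= z} ->
  {homo (hopf h V2 \- hopf h V1) : y z / y <= z}.
Proof.
move=> h0 l1 l2 ndV y y' yy' /=.
suff : hopf h V2 y + hopf h V1 y' <= hopf h V2 y' + hopf h V1 y by lra.
apply/ler_addgt0Pr => e e0; have e20 : 0 < e / 2 by rewrite divr_gt0.
have [z1 hz1] := hopf_approx h0 l1 y e20.
have [z2 hz2] := hopf_approx h0 l2 y' e20.
have [z12|z21] := leP z1 z2.
  have := hopf_le h0 l2 y z1; have := hopf_le h0 l1 y' z2.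
  by have := ndV _ _ z12; rewrite /=; lra.
have := hopf_le h0 l2 y z2; have := hopf_le h0 l1 y' z1.
suff : (y - z2) ^+ 2 / (4 * h) + (y' - z1) ^+ 2 / (4 * h) <=
   (y - z1) ^+ 2 / (4 * h) + (y' - z2) ^+ 2 / (4 * h) by lra.
rewrite -subr_ge0 -!mulrDl -mulrBl divr_ge0//; last by rewrite mulr_ge0// ltW.
have -> : (y - z1) ^+ 2 + (y' - z2) ^+ 2 - ((y - z2) ^+ 2 + (y' - z1) ^+ 2) =
   2 * ((y' - y) * (z1 - z2)) by ring.
by rewrite mulr_ge0// mulr_ge0// subr_ge0// ltW.
Qed.

Lemma hopf_semigroup h t L V y : 0 < h -> 0 < t -> lips L V ->
  hopf h (hopf t V) y = hopf (t + h) V y.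
Proof.
move=> h0 t0 lV; have lt := hopf_lips t0 lV.
have th0 : 0 < t + h by rewrite addr_gt0.
have n0 : [&& t != 0, h != 0 & t + h != 0] by rewrite !gt_eqF.
have key z x : (y - z) ^+ 2 / (4 * (t + h)) <= (x - z) ^+ 2 / (4 * t) + (y - x) ^+ 2 / (4 * h).
  rewrite -subr_ge0.
  rewrite [leRHS](_ : _ = (h * (x - z) - t * (y - x)) ^+ 2 / (4 * (t * h * (t + h)))).
    by rewrite divr_ge0 ?sqr_ge0// !mulr_ge0// ltW.
  by field; case/and3P: n0 => -> -> ->.
apply/eqP; rewrite eq_le; apply/andP; split.
  apply: (hopf_ge th0 lV) => z.
  (* The point reached at time [t] on the straight path from [z] to [y]; there the inequality [key]
     is an equality. *)
  pose x := (h * z + t * y) / (t + h).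
  have := hopf_le h0 lt y x; have := hopf_le t0 lV x z.
  suff : (x - z) ^+ 2 / (4 * t) + (y - x) ^+ 2 / (4 * h) = (y - z) ^+ 2 / (4 * (t + h)) by lra.
  by rewrite /x; field; case/and3P: n0 => -> -> ->.
apply: (hopf_ge h0 lt) => x; rewrite -lerBlDr.
apply: (hopf_ge t0 lV) => z.
by have := hopf_le th0 lV y z; have := key z x; lra.
Qed.

(** By semiconcavity the corrected quotients increase as the step shrinks, and they are bounded by
    [L]. The right derivative therefore exists everywhere, which gives a pointwise definition of the
    solution. *)
Lemma hopf_dquot_cvg t L V y : 0 < t -> lips L V ->
  cvgn (fun n => dquot (hopf t V) n y).
Proof.
move=> t0 lV.
pose q n := dquot (hopf t V) n y - n.+1%:R^-1 / (4 * t).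
have qE n : q n = (hopf t V (y + n.+1%:R^-1) - hopf t V y) / n.+1%:R^-1 - n.+1%:R^-1 / (4 * t).
  by rewrite /q /dquot invrK mulrC.
have cq : cvgn q.
  apply: nondecreasing_is_cvgn.
    move=> m n mn; rewrite !qE; apply: hopf_chord => //.
    by rewrite lef_pV2 ?posrE// ler_nat.
  exists L => _ [n _ <-]; rewrite /q.
  have := dquot_bound n y (hopf_lips t0 lV); rewrite ler_norml => /andP[_].
  have : 0 <= (n.+1%:R^-1 : R) / (4 * t) by rewrite divr_ge0// mulr_ge0// ltW.
  by move=> a0 b; rewrite lerBlDr (le_trans b)// lerDl.
have c2 : cvgn (fun n => (n.+1%:R^-1 : R) / (4 * t)).
  by apply: is_cvgM; [apply/cvg_ex; exists 0; exact: cvg_harmonic|exact: is_cvg_cst].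
move/cvg_ex: cq => [l1 q1]; move/cvg_ex: c2 => [l2 q2].
apply/cvg_ex; exists (l1 + l2).
have h : q n + n.+1%:R^-1 / (4 * t) @[n --> \oo] --> l1 + l2 by exact: cvgD.
by apply: cvg_trans h; apply: near_eq_cvg; near=> n; rewrite /q /= subrK.
Unshelve. all: by end_near. Qed.

(* This is the Hamilton-Jacobi equation [V_t + V_y ^ 2 = 0] at the initial time. *)
Lemma hopf_derive L V y (p : R) : lips L V -> is_derive y 1 V p ->
  n.+1%:R * (hopf n.+1%:R^-1 V y - V y) @[n --> \oo] --> - p ^+ 2.
Proof.
move=> lV dV.
have L0 := lips_ge0 lV.
have pL : `|p| <= L by exact: is_derive_dquot_bound lV dV.
apply/cvgrPdist_le => e e0.
(* The two bounds below have errors at most [2 * e' * L + e' ^ 2], which is at most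
   [e' * (2 * L + 1)] as [e' <= 1]. *)
pose e' := Num.min 1 (e / (2 * L + 1)).
have LL : 0 < 2 * L + 1 by rewrite ltr_wpDl// mulr_ge0.
have e'0 : 0 < e' by rewrite lt_min ltr01 divr_gt0.
have e'1 : e' <= 1 by rewrite ge_min lexx.
have e'e : e' * (2 * L + 1) <= e by rewrite -ler_pdivlMr// ge_min lexx orbT.
have [d d0 hd] : exists2 d : R, 0 < d & forall s, `|s| < d ->
    `|V (y + s) - V y - p * s| <= e' * `|s|.
  have [df dp] := dV.
  have dfl : (h^-1 * (V (h + y) - V y)) @[h --> 0^'] --> p.
    have : (h^-1 *: (V (h *: 1 + y) - V y)) @[h --> 0^'] --> 'D_1 V y by exact: df.
    rewrite dp; apply: cvg_trans; apply: near_eq_cvg; near=> s.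
    by rewrite /GRing.scale /= mulr1.
  have /cvgrPdist_le/(_ _ e'0) := dfl.
  move=> [d /= d0 hd]; exists d => // s sd.
  have [->|s0] := eqVneq s 0; first by rewrite addr0 subrr mulr0 subrr normr0 mulr0.
  have := hd s; rewrite /= sub0r normrN => /(_ sd s0).
  have -> : p - s^-1 * (V (s + y) - V y) = - (s^-1 * (V (y + s) - V y - p * s)).
    by rewrite (addrC s); field.
  by rewrite normrN normrM normfV ler_pdivrMl ?normr_gt0// [_ * e']mulrC.
near=> n.
(* Small enough that the displacement [2 * h * p] stays within [d], and that beyond distance [d] the
   quadratic cost exceeds [L * |y - z|]. *)
have hn : (n.+1%:R^-1 : R) < d / (4 * (L + 1)).
  near: n; apply: (@cvgr_lt _ _ _ _ harmonic 0); first exact: cvg_harmonic.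
  by rewrite divr_gt0// mulr_gt0// ltr_wpDl.
pose h : R := n.+1%:R^-1.
have h0 : 0 < h by rewrite invr_gt0.
have hL : h * (4 * (L + 1)) < d.
  by rewrite -ltr_pdivlMr ?mulr_gt0 ?ltr_wpDl.
have -> : n.+1%:R * (hopf n.+1%:R^-1 V y - V y) = (hopf h V y - V y) / h.
  by rewrite /h invrK mulrC.
have n2h : `|2 * h| = 2 * h by rewrite ger0_norm// mulr_ge0// ltW.
have up : hopf h V y - V y <= h * (- p ^+ 2 + 2 * e' * L).
  (* The exact minimiser if [V] were affine with slope [p]. *)
  have := hopf_le h0 lV y (y - 2 * h * p).
  have : `|- (2 * h * p)| < d.
    rewrite normrN normrM n2h.
    apply: le_lt_trans hL; rewrite (mulrC 2) -mulrA ler_wpM2l ?(ltW h0)//; lra.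
  move=> /hd; rewrite ler_norml => /andP[_].
  have -> : y - (y - 2 * h * p) = 2 * h * p by ring.
  have -> : (2 * h * p) ^+ 2 / (4 * h) = h * p ^+ 2 by field; rewrite gt_eqF.
  have : e' * `|- (2 * h * p)| <= h * (2 * e' * L).
    rewrite normrN normrM n2h.
    have := ler_wpM2l (mulr_ge0 (ltW h0) (ltW e'0)) pL; lra.
  lra.
have lo : - h * (`|p| + e') ^+ 2 <= hopf h V y - V y.
  rewrite lerBrDl; apply: (hopf_ge h0 lV) => z.
  (* Near [y] the linearisation of [V] and Young's inequality give the bound; far from [y] the cost
     alone compensates the Lipschitz decrease of [V]. *)
  have [sd|ds] := ltP `|z - y| d.
    have := hd _ sd; rewrite addrCA subrr addr0 ler_norml => /andP[+ _].
    have := young_quarter (`|p| + e') `|z - y| h0.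
    rewrite real_normK ?num_real// -(sqrrN (y - z)) opprB.
    have : - (p * (z - y)) <= `|p| * `|z - y| by rewrite -normrM -normrN ler_norm.
    lra.
  have := lV y z; rewrite ler_norml => /andP[_].
  have : L * `|y - z| <= (y - z) ^+ 2 / (4 * h).
    rewrite -(real_normK (num_real (y - z))) expr2 -mulrA mulrC ler_wpM2l//.
    rewrite ler_pdivlMr ?mulr_gt0// distrC (le_trans _ ds)// (le_trans _ (ltW hL))//.
    by move: h0; clear; clearbody h; lra.
  have : 0 <= h * (`|p| + e') ^+ 2 by rewrite mulr_ge0 ?sqr_ge0// ltW.
  lra.
have {}up : (hopf h V y - V y) / h <= - p ^+ 2 + 2 * e' * L.
  by rewrite ler_pdivrMr// mulrC.
have {}lo : - (`|p| + e') ^+ 2 <= (hopf h V y - V y) / h.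
  by rewrite ler_pdivlMr// mulrC mulrN -mulNr.
have hp := real_normK (num_real p).
have h1 : e' * `|p| <= e' * L by rewrite ler_wpM2l// ltW.
have h2 : e' * e' <= e' * 1 by rewrite ler_wpM2l// ltW.
by move: lo; rewrite ler_norml sqrrD hp !expr2 => lo; apply/andP; split; lra.
Unshelve. all: by end_near. Qed.

End hopf_lax.

(** * Comparison with the linear profiles *)

Section kruzkov_step.
Context {R : realType}.
Implicit Types (V w psi : R -> R) (k L M N h r y z a b : R).
Local Notation mu := (@lebesgue_measure R).

(* The profile of the constant state [u = k] in the variable [w = y u / 2], truncated to be
   bounded: under Burgers' equation [k y / 2] evolves into [k y / (2 (1 + k h))], and this decay
   produces the source term of the entropy inequality. *)
Definition kap k N y := Num.max (- N) (Num.min N (k * y / 2)).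

Lemma kap_bound k N y : 0 <= N -> `|kap k N y| <= N.
Proof.
move=> N0; rewrite ler_norml /kap le_max lexx /= ge_max ge_min lexx /= andbT; lra.
Qed.

Lemma kap_measurable k N : measurable_fun setT (kap k N).
Proof.
apply: measurable_maxr => //; apply: measurable_minr => //.
by apply: measurable_funM => //; apply: measurable_funM.
Qed.

Lemma kapE k N r y : `|k| * r / 2 <= N -> `|y| <= r -> kap k N y = k * y / 2.
Proof.
move=> kr yr; have : `|k * y / 2| <= N.
  rewrite !normrM [`|2^-1|]ger0_norm// (le_trans _ kr)// ler_wpM2r//.
  by rewrite ler_wpM2l.
by rewrite ler_norml => /andP[h1 h2]; rewrite /kap min_r// max_r.
Qed.

Lemma prim0 (m : R -> R) : prim m 0 = 0.
Proof.
rewrite /prim (_ : (fun _ => _) = cst 0); last by apply/funext => x; rewrite subrr mulr0.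
by rewrite Rintegral_cst// mul0r.
Qed.

Lemma is_derive_quarter_sq k y : is_derive y 1 (fun z : R => k * z ^+ 2 / 4) (k * y / 2).
Proof.
apply: (@is_derive_quadratic_error _ _ _ _ (`|k| / 4)) => z.
have -> : k * z ^+ 2 / 4 - k * y ^+ 2 / 4 - k * y / 2 * (z - y) = k / 4 * (z - y) ^+ 2 by field.
by rewrite normrM (ger0_norm (sqr_ge0 (z - y))) normrM [`|4^-1|]ger0_norm.
Qed.

Lemma prim_kapB k N r a b : `|k| * r / 2 <= N -> `|a| <= r -> `|b| <= r -> a <= b ->
  prim (kap k N) b - prim (kap k N) a = k * b ^+ 2 / 4 - k * a ^+ 2 / 4.
Proof.
move=> kr ar br; rewrite le_eqVlt => /predU1P[->|ab]; first by rewrite !subrr.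
have N0 : 0 <= N.
  by apply: le_trans kr; rewrite divr_ge0// mulr_ge0// (le_trans _ ar).
have kb y := @kap_bound k N y N0.
rewrite (prim_itv (kap_measurable k N) kb (ltW ab)) addrK.
transitivity (\int[mu]_(y in `[a, b]) (k * y / 2)).
  apply: eq_Rintegral => y.
  move=> /set_mem /=; rewrite in_itv/= => /andP[ay yb]; apply: kapE kr _.
  by move: ar br; rewrite !ler_norml => /andP[? ?] /andP[? ?]; apply/andP; split; lra.
have df y := is_derive_quarter_sq k y.
have cF : continuous (fun z : R => k * z ^+ 2 / 4).
  move=> y; apply: differentiable_continuous; apply/derivable1_diffP.
  by have [] := df y.
rewrite /Rintegral (@continuous_FTC2 _ _ (fun z => k * z ^+ 2 / 4))//.
- apply: continuous_subspaceT => y.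
  by apply: cvgM; [apply: cvgM; [exact: cvg_cst|exact: cvg_id]|exact: cvg_cst].
- split.
  + by move=> y _; have [] := df y.
  + by apply: cvg_at_right_filter; exact: cF.
  + by apply: cvg_at_left_filter; exact: cF.
- by move=> y _; rewrite derive1E; have [] := df y.
Qed.

Lemma prim_kap k N r y : `|k| * r / 2 <= N -> `|y| <= r ->
  prim (kap k N) y = k * y ^+ 2 / 4.
Proof.
move=> kr yr; have r0 : `|(0 : R)| <= r by rewrite normr0 (le_trans _ yr).
have [y0|y0] := leP 0 y.
  have := prim_kapB kr r0 yr y0; rewrite prim0 expr0n /=; lra.
have := prim_kapB kr yr r0 (ltW y0); rewrite prim0 expr0n /=; lra.
Qed.

(** Within radius [r + 1] the potential is the quadratic [k z ^ 2 / 4], and completing the square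
    gives the infimum. A competitor outside is at distance at least 1 from [y], so [4 * h * N <= 1]
    makes its cost exceed the gain allowed by the slope bound [N]: the truncation is not felt. *)
Lemma hopf_kap k N r h y : `|k| * (r + 1) / 2 <= N -> `|y| <= r -> 0 < h ->
  4 * h * N <= 1 -> `|k| * h * (r + 2) <= 1 ->
  hopf h (prim (kap k N)) y = k / (1 + k * h) * y ^+ 2 / 4.
Proof.
move=> kr yr h0 hN hk.
have r0 : 0 <= r by rewrite (le_trans _ yr).
have N0 : 0 <= N.
  by apply: le_trans kr; rewrite divr_ge0// mulr_ge0//; lra.
have kb z := @kap_bound k N z N0.
have lK : lips N (prim (kap k N)) := prim_lips (kap_measurable k N) kb.
have kh1 : `|k * h| <= (r + 2)^-1.
  by rewrite -[leRHS]mul1r ler_pdivlMr ?normrM ?(gtr0_norm h0)//; lra.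
have kh2 : (r + 2)^-1 <= 2^-1 by rewrite lef_pV2 ?posrE; lra.
have kh : 0 < 1 + k * h by move: kh1; rewrite ler_norml => /andP[]; lra.
have yr1 : `|y| <= r + 1 by lra.
apply/eqP; rewrite eq_le; apply/andP; split.
  (* The minimiser of the quadratic problem. It stays within [r + 1] because [|k h| <= (r + 2)^-1]
     and [r (r + 2) <= (r + 1) ^ 2]. *)
  pose z := y / (1 + k * h).
  have zr : `|z| <= r + 1.
    rewrite /z normrM normfV (gtr0_norm kh) ler_pdivrMr//.
    apply: (le_trans yr).
    have : (r + 1) * (1 - (r + 2)^-1) <= (r + 1) * (1 + k * h).
      rewrite ler_wpM2l//; first by lra.
      by move: kh1; rewrite ler_norml => /andP[]; lra.
    apply: le_trans; rewrite -subr_ge0.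
    rewrite [leRHS](_ : _ = (r + 2)^-1); first by rewrite invr_ge0; lra.
    by field; rewrite gt_eqF//; lra.
  apply: (le_trans (hopf_le h0 lK y z)).
  rewrite (prim_kap kr zr) le_eqVlt; apply/orP; left; apply/eqP.
  by rewrite /z; field; rewrite !gt_eqF.
apply: (hopf_ge h0 lK) => z.
have [zr|zr] := leP `|z| (r + 1).
  rewrite (prim_kap kr zr) -subr_ge0.
  rewrite [leRHS](_ : _ = ((1 + k * h) * z - y) ^+ 2 / (4 * h * (1 + k * h))).
    by rewrite divr_ge0 ?sqr_ge0// !mulr_ge0// ltW.
  by field; rewrite !gt_eqF.
have h1 := lK y z; have h2 := prim_kap kr yr1.
have h3 : k / (1 + k * h) * y ^+ 2 / 4 <= k * y ^+ 2 / 4.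
  rewrite -subr_ge0 [leRHS](_ : _ = h * (k * y) ^+ 2 / (4 * (1 + k * h))).
    by apply: divr_ge0; apply: mulr_ge0; rewrite ?sqr_ge0// ltW.
  by field; rewrite gt_eqF.
have d1 : 1 <= `|y - z|.
  by have := ler_normD (z - y) y; rewrite subrK distrC; lra.
have h4 : N * `|y - z| <= (y - z) ^+ 2 / (4 * h).
  rewrite -(real_normK (num_real (y - z))) ler_pdivlMr ?mulr_gt0//.
  have : `|y - z| * (4 * h * N) <= `|y - z| * `|y - z|.
    by rewrite ler_wpM2l// (le_trans hN).
  by rewrite expr2; lra.
move: h1; rewrite ler_norml => /andP[_]; lra.
Qed.

End kruzkov_step.

Lemma normrB_between {R : realType} (a b l u : R) :
  a <= u -> b <= u -> l <= a -> l <= b -> `|a - b| <= u - l.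
Proof. by move=> *; rewrite ler_norml; apply/andP; split; lra. Qed.

Section kruzkov_envelopes.
Context {R : realType}.
Implicit Types (V w psi : R -> R) (k L M N h r y z a b C : R).
Local Notation mu := (@lebesgue_measure R).

Lemma tame_mul_dtest (f psi dpsi : R -> R) r C : continuous f ->
  test psi dpsi r C -> tame mu (fun y => f y * dpsi y).
Proof.
move=> cf tp; have [B hB] := continuous_locally_bounded r cf.
apply: (@tame_cball _ _ r (`|B| * C)).
- apply: measurable_funM; last exact: dtest_measurable tp.
  exact: continuous_measurable_fun.
- move=> y yr; rewrite normrM; apply: ler_pM => //; last exact: (dtest_bound tp).
  by rewrite (le_trans (hB _ yr))// ler_norm.
- by move=> y ry; rewrite (dtest_supp tp)// mulr0.
Qed.

Lemma tame_bounded_test (f psi dpsi : R -> R) r C B : measurable_fun setT f ->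
  (forall y, `|y| <= r -> `|f y| <= B) ->
  test psi dpsi r C -> tame mu (fun y => f y * psi y).
Proof.
move=> mf fB tp.
have [D hD] := continuous_locally_bounded r (lips_continuous (test_lips tp)).
apply: (@tame_cball _ _ r (B * D)).
- by apply: measurable_funM => //; exact: test_measurable tp.
- by move=> y yr; rewrite normrM; apply: ler_pM => //; [exact: fB|exact: hD].
- by move=> y ry; rewrite (test_supp tp)// mulr0.
Qed.

Definition upper w k N y := Num.max (w y) (kap k N y).
Definition lower w k N y := Num.min (w y) (kap k N y).

Variables (w : R -> R) (k M N : R).
Hypotheses (mw : measurable_fun setT w) (wM : forall y, `|w y| <= M) (N0 : 0 <= N).

Let M0 : 0 <= M. Proof. by rewrite (le_trans _ (wM 0)). Qed.

Lemma upper_measurable : measurable_fun setT (upper w k N).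
Proof. by apply: measurable_maxr => //; exact: kap_measurable. Qed.

Lemma lower_measurable : measurable_fun setT (lower w k N).
Proof. by apply: measurable_minr => //; exact: kap_measurable. Qed.

Lemma upper_bound y : `|upper w k N y| <= M + N.
Proof.
rewrite /upper; have := wM y; have := kap_bound k y N0; rewrite !ler_norml.
move=> /andP[? ?] /andP[? ?]; have M1 := M0; have N1 := N0.
rewrite le_max ge_max; apply/andP; split; first by apply/orP; left; lra.
by apply/andP; split; lra.
Qed.

Lemma lower_bound y : `|lower w k N y| <= M + N.
Proof.
rewrite /lower; have := wM y; have := kap_bound k y N0; rewrite !ler_norml.
move=> /andP[? ?] /andP[? ?]; have M1 := M0; have N1 := N0.
rewrite le_min ge_min; apply/andP; split; last by apply/orP; left; lra.
by apply/andP; split; lra.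
Qed.

Lemma upper_lips : lips (M + N) (prim (upper w k N)).
Proof. exact: prim_lips upper_measurable upper_bound. Qed.

Lemma lower_lips : lips (M + N) (prim (lower w k N)).
Proof. exact: prim_lips lower_measurable lower_bound. Qed.

(** An absolute difference is maximum minus minimum, so the Kruzkov entropy is the derivative of a
    difference of two potentials on which [hopf] can act. *)
Lemma kruzkov_ibp (psi dpsi : R -> R) r C : `|k| * r / 2 <= N -> test psi dpsi r C ->
  \int[mu]_y (`|w y - k * y / 2| * psi y) =
  \int[mu]_y ((prim (lower w k N) y - prim (upper w k N) y) * dpsi y).
Proof.
move=> kr tp.
have cu := lips_continuous upper_lips; have cl := lips_continuous lower_lips.
transitivity (\int[mu]_y (prim (lower w k N) y * dpsi y) -
  \int[mu]_y (prim (upper w k N) y * dpsi y)); last first.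
  rewrite -RintB.
  - by apply: eqRint => y; rewrite mulrBl.
  - exact: tame_mul_dtest tp.
  - exact: tame_mul_dtest tp.
have := prim_ibp upper_measurable upper_bound tp.
have := prim_ibp lower_measurable lower_bound tp.
move=> e1 e2; rewrite -[X in _ = X - _]opprK -e1 addrC -e2 -RintB.
- apply: eqRint => y; rewrite -mulrBl.
  have [yr|yr] := leP `|y| r; last by rewrite (test_supp tp)// !mulr0.
  rewrite /upper /lower (kapE kr yr); congr (_ * _).
  by case: leP => h; [rewrite ler0_norm|rewrite ger0_norm]; rewrite ?subr_le0 ?subr_ge0 ?opprB// ltW.
- by apply: (@tame_bounded_test _ _ _ r C (M + N)) tp; [exact: upper_measurable|move=> y _; exact: upper_bound].
- by apply: (@tame_bounded_test _ _ _ r C (M + N)) tp; [exact: lower_measurable|move=> y _; exact: lower_bound].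
Qed.

Variables (V w' : R -> R) (h : R).
Hypotheses (lV : lips M V) (Vw : forall y, V y = V 0 + prim w y) (h0 : 0 < h).
Hypothesis (w'_lim : forall y, dquot (hopf h V) n y @[n --> \oo] --> w' y).

Let K := prim (kap k N).

Let lK : lips N K.
Proof. exact: prim_lips (kap_measurable k N) (fun y => kap_bound k y N0). Qed.

Lemma w'_measurable : measurable_fun setT w'.
Proof.
apply: (@measurable_fun_cvg _ _ _ _ (fun n => dquot (hopf h V) n)) => //.
by move=> n; apply: measurable_dquot; exact: lips_measurable (hopf_lips h0 lV).
Qed.

Lemma w'_bound y : `|w' y| <= M.
Proof.
have /cvg_norm hw := w'_lim (y := y).
rewrite -(cvg_lim _ hw)//; apply: limr_le; first exact: cvgP hw.
by apply: nearW => n; exact: dquot_bound (hopf_lips h0 lV).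
Qed.

Let kb y : `|kap k N y| <= M + N.
Proof. by rewrite (le_trans (kap_bound k y N0))// lerDr. Qed.

Let wb y : `|w y| <= M + N.
Proof. by rewrite (le_trans (wM y))// lerDl. Qed.

(** The evolved envelopes need not be the maximum and minimum of the evolved states, but by
    comparison they still bracket both, and this bounds the distance between the states. *)
Lemma dquot_hopf_envelope n y :
  `|dquot (hopf h V) n y - dquot (hopf h K) n y| <=
  dquot (hopf h (prim (upper w k N)) \- hopf h (prim (lower w k N))) n y.
Proof.
have mu_ := upper_measurable; have ml_ := lower_measurable.
have ub := upper_bound; have lb := lower_bound; have km := kap_measurable k N.
have key V1 V2 L1 L2 : lips L1 V1 -> lips L2 V2 -> {homo (V2 \- V1) : a b / a <= b} ->
    dquot (hopf h V1) n y <= dquot (hopf h V2) n y.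
  move=> l1 l2 nd; have := dquot_nd n y (hopf_comparison h0 l1 l2 nd).
  by rewrite dquotB subr_ge0.
have VE (f : R -> R) : {homo (f \- prim w) : a b / a <= b} -> {homo (f \- V) : a b / a <= b}.
  by move=> nd a b ab; have := nd a b ab; rewrite /= (Vw a) (Vw b); lra.
have VE' (f : R -> R) : {homo (prim w \- f) : a b / a <= b} -> {homo (V \- f) : a b / a <= b}.
  by move=> nd a b ab; have := nd a b ab; rewrite /= (Vw a) (Vw b); lra.
have h1 : dquot (hopf h V) n y <= dquot (hopf h (prim (upper w k N))) n y.
  apply: (key _ _ _ _ lV upper_lips); apply: VE.
  by apply: (prim_diff_nd mw mu_ wb ub) => z; rewrite /upper le_max lexx.
have h2 : dquot (hopf h K) n y <= dquot (hopf h (prim (upper w k N))) n y.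
  apply: (key _ _ _ _ lK upper_lips).
  by apply: (prim_diff_nd km mu_ kb ub) => z; rewrite /upper le_max lexx orbT.
have h3 : dquot (hopf h (prim (lower w k N))) n y <= dquot (hopf h V) n y.
  apply: (key _ _ _ _ lower_lips lV); apply: VE'.
  by apply: (prim_diff_nd ml_ mw lb wb) => z; rewrite /lower ge_min lexx.
have h4 : dquot (hopf h (prim (lower w k N))) n y <= dquot (hopf h K) n y.
  apply: (key _ _ _ _ lower_lips lK).
  by apply: (prim_diff_nd ml_ km lb kb) => z; rewrite /lower ge_min lexx orbT.
by rewrite dquotB; exact: normrB_between h1 h2 h3 h4.
Qed.

Lemma hopf_kap_dquot_cvg r y : `|k| * (r + 2) / 2 <= N -> `|y| <= r ->
  4 * h * N <= 1 -> `|k| * h * (r + 3) <= 1 ->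
  dquot (hopf h K) n y @[n --> \oo] --> k / (1 + k * h) * y / 2.
Proof.
move=> kr yr hN hk; apply: dquot_cvg.
apply: near_eq_is_derive (is_derive_quarter_sq _ y).
(* A derivative at [|y| <= r] needs the formula on a neighbourhood, hence the radius [r + 1] and the
   constants [r + 2], [r + 3] in the hypotheses. *)
near=> z; apply/esym; apply: (@hopf_kap _ k N (r + 1)) => //.
- by rewrite -addrA.
- apply/ltW; near: z; apply: (@cvgr_norm_lt _ _ _ _ _ idfun y); first exact: cvg_id.
  by rewrite (le_lt_trans yr)// ltrDl.
- by rewrite -addrA (_ : 1 + 2 = 3 :> R)//; lra.
Unshelve. all: by end_near. Qed.

Lemma kruzkov_step (psi dpsi : R -> R) r C :
  `|k| * (r + 2) / 2 <= N -> 4 * h * N <= 1 -> `|k| * h * (r + 3) <= 1 ->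
  test psi dpsi r C -> (forall y, 0 <= psi y) ->
  \int[mu]_y (`|w' y - k / (1 + k * h) * y / 2| * psi y) <=
  \int[mu]_y ((hopf h (prim (lower w k N)) y - hopf h (prim (upper w k N)) y) * dpsi y).
Proof.
move=> kr hN hk tp psi0.
have lup := hopf_lips h0 upper_lips; have llo := hopf_lips h0 lower_lips.
have lVh := hopf_lips h0 lV; have lKh := hopf_lips h0 lK.
pose D := hopf h (prim (upper w k N)) \- hopf h (prim (lower w k N)).
have lD : lips ((M + N) + (M + N)) D by exact: lipsB.
have cD := lips_continuous lD.
have hr := dquot_ibp cD tp.
have e1 : - (\int[mu]_y (D y * dpsi y)) =
  \int[mu]_y ((hopf h (prim (lower w k N)) y - hopf h (prim (upper w k N)) y) * dpsi y).
  rewrite -RintN; last exact: tame_mul_dtest tp.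
  by apply: eqRint => y; rewrite /D /=; ring.
rewrite -e1 -(cvg_lim _ hr)//.
pose A n y := `|dquot (hopf h V) n y - dquot (hopf h K) n y|.
have mA n : measurable_fun setT (A n).
  apply: measurableT_comp => //; apply: measurable_funB; apply: measurable_dquot.
    exact: lips_measurable lVh.
  exact: lips_measurable lKh.
have bA n y : `|A n y| <= M + N.
  rewrite /A normr_id (le_trans (ler_normB _ _))// lerD//; exact: dquot_bound.
have tA n : tame mu (fun y => A n y * psi y).
  by apply: (@tame_bounded_test _ _ _ r C (M + N)) tp => // y _; exact: bA.
have [D' hD'] := continuous_locally_bounded r (lips_continuous (test_lips tp)).
have hl : \int[mu]_y (A n y * psi y) @[n --> \oo] -->
    \int[mu]_y (`|w' y - k / (1 + k * h) * y / 2| * psi y).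
  apply: (@Rintegral_dominated _ _ _ mu _ _ (cball r) ((M + N) * `|D'|)).
  - by move=> n; exact: (tA n).1.
  - apply: measurable_funM; last exact: test_measurable tp.
    apply: measurableT_comp => //; apply: measurable_funB; first exact: w'_measurable.
    by apply: measurable_funM => //; apply: measurable_funM.
  - exact: measurable_cball.
  - exact: cball_fin.
  - move=> n y; rewrite indicE; case: (boolP (y \in _)) => [/set_mem/cballE yr|].
      rewrite mulr1 normrM; apply: ler_pM => //.
      by rewrite (le_trans (hD' _ yr))// ler_norm.
    rewrite mulr0 normr_le0 => /negP yr.
    rewrite (test_supp tp) ?mulr0// ltNge; apply/negP => h1.
    by apply: yr; apply/mem_set/cballE.
  - apply: aeW => y; have [yr|yr] := leP `|y| r; last first.
      rewrite (test_supp tp)// mulr0; under eq_fun do rewrite mulr0.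
      exact: cvg_cst.
    apply: cvgMl; apply: cvg_norm; apply: cvgB; first exact: w'_lim.
    exact: (hopf_kap_dquot_cvg kr yr hN hk).
rewrite -(cvg_lim _ hl)//; apply: ler_lim.
- exact: cvgP hl.
- exact: cvgP hr.
apply: nearW => n; apply: le_Rint => //.
  apply: (@tame_bounded_test _ _ _ r C (M + N + (M + N))) tp.
    exact: measurable_dquot (lips_measurable lD).
  by move=> y _; exact: dquot_bound.
by move=> y; apply: ler_wpM2r => //; exact: dquot_hopf_envelope.
Qed.

End kruzkov_envelopes.

Section kruzkov_fixed_constant.
Context {R : realType}.
Implicit Types (V w psi : R -> R) (k L M N h r y z a b C : R).
Local Notation mu := (@lebesgue_measure R).

(** Convexity of the absolute value; [Num.sg a] is a subgradient also at [a = 0]. It exchanges the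
    moved profile for the original one at the price of a source. *)
Lemma normr_subgrad (a x : R) : `|a| + Num.sg a * x <= `|a + x|.
Proof.
case: (sgrP a) => [->|a0|a0]; first by rewrite mul0r !add0r.
  by rewrite mul1r ler_norm.
by rewrite mulN1r -opprD -normrN ler_norm.
Qed.

Lemma ae_both (P Q : R -> Prop) : {ae mu, forall x, P x} -> {ae mu, forall x, Q x} ->
  {ae mu, forall x, P x /\ Q x}.
Proof.
move=> hP hQ; have := negligibleU hP hQ; apply: negligibleS => x /=.
by move=> /not_andP[?|?]; [left|right].
Qed.

Lemma measurable_sg_sub (f g : R -> R) : measurable_fun setT f -> measurable_fun setT g ->
  measurable_fun setT (fun y => Num.sg (f y - g y)).
Proof.
by move=> mf mg; apply: (measurableT_comp (@measurable_sgr R)); exact: measurable_funB.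
Qed.

Lemma normr_sg_le1 (x : R) : `|Num.sg x| <= 1.
Proof. by rewrite normr_sg; case: (x != 0). Qed.

Lemma measurable_halfmul k : measurable_fun setT (fun y : R => k * y / 2).
Proof. by apply: measurable_funM => //; apply: measurable_funM. Qed.

Variables (w : R -> R) (k M N : R).
Hypotheses (mw : measurable_fun setT w) (wM : forall y, `|w y| <= M) (N0 : 0 <= N).
Local Notation P := (prim (upper w k N)).
Local Notation Q := (prim (lower w k N)).

(** To first order a potential with slope [p] changes by [- h p ^ 2], so this is [h] times the
    difference of the squares of the envelopes, that is, the Kruzkov entropy flux. *)
Definition flux_defect h y := (hopf h Q y - Q y) - (hopf h P y - P y).

Lemma flux_defect_bound h y : 0 < h -> `|flux_defect h y| <= h * (2 * (M + N) ^+ 2).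
Proof.
move=> h0; have lu := upper_lips k mw wM N0; have ll := lower_lips k mw wM N0.
have := hopf_diff_bound h0 lu y; have := hopf_diff_bound h0 ll y.
move=> h1 h2; rewrite (le_trans (ler_normB _ _))//; lra.
Qed.

Lemma measurable_flux_defect h : 0 < h -> measurable_fun setT (flux_defect h).
Proof.
move=> h0; have lu := upper_lips k mw wM N0; have ll := lower_lips k mw wM N0.
have lu' := hopf_lips h0 lu; have ll' := hopf_lips h0 ll.
exact: measurable_funB (measurable_funB (lips_measurable ll') (lips_measurable ll))
  (measurable_funB (lips_measurable lu') (lips_measurable lu)).
Qed.

Lemma flux_defect_cvg : {ae mu, forall y,
  n.+1%:R * flux_defect n.+1%:R^-1 y @[n --> \oo] -->
  upper w k N y ^+ 2 - lower w k N y ^+ 2}.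
Proof.
have lu := upper_lips k mw wM N0; have ll := lower_lips k mw wM N0.
have h1 := prim_derive (upper_measurable k N mw) (upper_bound k wM N0).
have h2 := prim_derive (lower_measurable k N mw) (lower_bound k wM N0).
have h12 : {ae mu, forall y, is_derive y 1 P (upper w k N y) /\ is_derive y 1 Q (lower w k N y)}.
  exact: ae_both.
apply: ae_imply h12 => y [d1 d2].
have c1 := hopf_derive lu d1; have c2 := hopf_derive ll d2.
have -> : upper w k N y ^+ 2 - lower w k N y ^+ 2 = - lower w k N y ^+ 2 - - upper w k N y ^+ 2.
  by rewrite opprK addrC.
under eq_fun do rewrite /flux_defect mulrBr.
exact: cvgB.
Qed.

Lemma flux_sqrB r y : `|k| * r / 2 <= N -> `|y| <= r ->
  upper w k N y ^+ 2 - lower w k N y ^+ 2 =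
  Num.sg (w y - k * y / 2) * (w y ^+ 2 - (k * y / 2) ^+ 2).
Proof.
move=> kr yr; rewrite /upper /lower (kapE kr yr).
set x := w y; set x' := k * y / 2.
case: (ltgtP x x') => [h|h|->].
- by rewrite ltr0_sg ?subr_lt0//; ring.
- by rewrite gtr0_sg ?subr_gt0//; ring.
- by rewrite !subrr sgr0 mul0r.
Qed.

Lemma flux_defect_integral_cvg (psi_ dpsi_ : nat -> R -> R) (dpsi : R -> R) r C :
  `|k| * r / 2 <= N -> (forall n, test (psi_ n) (dpsi_ n) r C) ->
  (forall y, dpsi_ n y @[n --> \oo] --> dpsi y) ->
  \int[mu]_y (n.+1%:R * flux_defect n.+1%:R^-1 y * dpsi_ n y) @[n --> \oo] -->
  \int[mu]_y (Num.sg (w y - k * y / 2) * (w y ^+ 2 - (k * y / 2) ^+ 2) * dpsi y).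
Proof.
move=> kr tp dp.
have mdpsi : measurable_fun setT dpsi.
  apply: (@measurable_fun_cvg _ _ _ _ (fun n => dpsi_ n)) => // n.
  exact: dtest_measurable (tp n).
have dpsi0 y : r < `|y| -> dpsi y = 0.
  move=> ry; rewrite -(cvg_lim _ (dp y))//.
  under eq_fun do rewrite (dtest_supp (tp _) ry).
  exact: lim_cst.
have C0 : 0 <= C := test_C_ge0 (tp 0%N).
apply: (@Rintegral_dominated _ _ _ mu _ _ (cball r) (2 * (M + N) ^+ 2 * C)).
- move=> n; apply: measurable_funM; last exact: dtest_measurable (tp n).
  by apply: measurable_funM => //; exact: measurable_flux_defect.
- apply: measurable_funM => //; apply: measurable_funM.
    by apply: measurable_sg_sub => //; exact: measurable_halfmul.
  apply: measurable_funB; apply: measurable_funX => //; exact: measurable_halfmul.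
- exact: measurable_cball.
- exact: cball_fin.
- move=> n y; rewrite indicE; case: (boolP (y \in _)) => [/set_mem/cballE yr|].
    rewrite mulr1 normrM; apply: ler_pM => //; last exact: (dtest_bound (tp n)).
    rewrite normrM ger0_norm// -ler_pdivlMl//; apply: flux_defect_bound.
    by rewrite invr_gt0.
  rewrite mulr0 normr_le0 => /negP yr.
  rewrite (dtest_supp (tp n)) ?mulr0// ltNge; apply/negP => h1.
  by apply: yr; apply/mem_set/cballE.
- apply: ae_imply flux_defect_cvg => y hy.
  have [yr|yr] := leP `|y| r; last first.
    rewrite (dpsi0 _ yr) mulr0.
    under eq_fun do rewrite (dtest_supp (tp _) yr) mulr0.
    exact: cvg_cst.
  by rewrite -(flux_sqrB kr yr); exact: cvgM.
Qed.

Variables (V w' : R -> R) (h : R).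
Hypotheses (lV : lips M V) (Vw : forall y, V y = V 0 + prim w y) (h0 : 0 < h).
Hypothesis (w'_lim : forall y, dquot (hopf h V) n y @[n --> \oo] --> w' y).

Lemma kruzkov_step_fixed (psi dpsi : R -> R) r C :
  0 <= r -> `|k| * (r + 2) / 2 <= N -> 4 * h * N <= 1 -> `|k| * h * (r + 3) <= 1 ->
  test psi dpsi r C -> (forall y, 0 <= psi y) ->
  \int[mu]_y (`|w' y - k * y / 2| * psi y) +
    h / (1 + k * h) * \int[mu]_y (Num.sg (w' y - k * y / 2) * (k ^+ 2 * y / 2) * psi y) <=
  \int[mu]_y (`|w y - k * y / 2| * psi y) + \int[mu]_y (flux_defect h y * dpsi y).
Proof.
move=> r0 kr hN hk tp psi0.
have lu := upper_lips k mw wM N0; have ll := lower_lips k mw wM N0.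
have lu' := hopf_lips h0 lu; have ll' := hopf_lips h0 ll.
have mw' := w'_measurable (M := M) lV h0 w'_lim.
have bw' := w'_bound lV h0 w'_lim.
have kr' : `|k| * r / 2 <= N.
  by apply: le_trans kr; rewrite ler_pM2r// ler_wpM2l// lerDl.
have kh : 0 < 1 + k * h.
  have : `|k * h| * (r + 3) <= 1 by rewrite normrM (gtr0_norm h0).
  have : 0 <= `|k * h| * r by rewrite mulr_ge0.
  have := ler_norm (- (k * h)); rewrite normrN; lra.
rewrite (kruzkov_ibp mw wM N0 kr' tp) -RintD; last 2 first.
- apply: tame_mul_dtest tp; exact: lips_continuous (lipsB ll lu).
- apply: tame_mul_dtest tp.
  exact: lips_continuous (lipsB (lipsB ll' ll) (lipsB lu' lu)).
have -> : \int[mu]_y ((Q y - P y) * dpsi y + flux_defect h y * dpsi y) =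
  \int[mu]_y ((hopf h Q y - hopf h P y) * dpsi y).
  by apply: eqRint => y; rewrite /flux_defect; ring.
apply: le_trans (kruzkov_step mw wM N0 lV Vw h0 w'_lim kr hN hk tp psi0).
have half_bound c y : `|y| <= r -> `|c * y / 2| <= `|c| * r.
  move=> yr; rewrite !normrM [`|2^-1|]ger0_norm//.
  have := ler_wpM2l (normr_ge0 c) yr; have := mulr_ge0 (normr_ge0 c) (normr_ge0 y); lra.
have t1 c : tame mu (fun y => `|w' y - c * y / 2| * psi y).
  apply: (@tame_bounded_test _ _ _ _ r C (M + `|c| * r)) tp.
    apply: measurableT_comp => //; apply: measurable_funB => //; exact: measurable_halfmul.
  by move=> y yr; rewrite normr_id (le_trans (ler_normB _ _))// lerD// half_bound.
have t2 : tame mu (fun y => Num.sg (w' y - k * y / 2) * (k ^+ 2 * y / 2) * psi y).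
  apply: (@tame_bounded_test _ _ _ _ r C (1 * (`|k ^+ 2| * r))) tp.
    apply: measurable_funM; last exact: measurable_halfmul.
    by apply: measurable_sg_sub => //; exact: measurable_halfmul.
  by move=> y yr; rewrite normrM; apply: ler_pM => //; [exact: normr_sg_le1|exact: half_bound].
rewrite -RintZ// -RintD//; last exact: tameZ.
apply: le_Rint => //; first by apply: tameD => //; exact: tameZ.
move=> y; rewrite !mulrA -mulrDl ler_wpM2r//.
(* The displacement of the profile is [k - k / (1 + k h) = h k ^ 2 / (1 + k h)], times [y / 2]. *)
have := normr_subgrad (w' y - k * y / 2) (h / (1 + k * h) * (k ^+ 2 * y / 2)).
congr (_ <= _); first by ring.
by congr (`|_|); field; rewrite gt_eqF.
Qed.

End kruzkov_fixed_constant.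

(** * The Hopf-Lax solution of the Burgers equation *)

Section hopf_lax_solution.
Context {R : realType}.
Implicit Types (V U : R -> R) (k L M N h r y z a b C t : R).
Local Notation mu := (@lebesgue_measure R).

Lemma prim_shift (m : R -> R) (M a e : R) : measurable_fun setT m -> (forall y, `|m y| <= M) ->
  prim (fun y => m (y + e)) a = prim m (a + e) - prim m e.
Proof.
move=> mm mM; rewrite (primB _ _ mm mM).
have mme : measurable_fun setT (fun y => m (y + e)).
  exact: (measurableT_comp mm (measurable_shift e)).
rewrite /prim -[RHS](Rint_shift e).
  by apply: eqRint => x; rewrite ltrD2r (gtrDr e).
exact: prim_weight_tame mm mM.
Qed.

Lemma prim_error (m : R -> R) (M L y z : R) : measurable_fun setT m -> (forall y, `|m y| <= M) ->
  lips L m -> `|prim m z - prim m y - m y * (z - y)| <= L * (z - y) ^+ 2.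
Proof.
move=> mm mM lm.
have L0 := lips_ge0 lm.
have M0 : 0 <= M by rewrite (le_trans _ (mM 0)).
have aux a b c : a <= b -> (forall x, a <= x <= b -> `|m x - c| <= L * (b - a)) ->
    `|prim m b - prim m a - c * (b - a)| <= L * (b - a) * (b - a).
  move=> ab hc; rewrite (prim_itv mm mM ab) addrK.
  have im := bounded_integrable_itv a b mm mM.
  have ic c' : mu.-integrable `[a, b] (EFin \o cst c').
    by apply: (@bounded_integrable_itv _ _ `|c'|).
  have Icst c' : \int[mu]_(x in `[a, b]) c' = c' * (b - a).
    rewrite Rintegral_cst//; congr (_ * _).
    have := @lebesgue_measure_itv R `[a, b]; rewrite /= lte_fin => e.
    rewrite [X in fine X](_ : _ = (b - a)%:E)//; apply: (etrans e).
    by case: ltP => //= ba; congr EFin; apply/esym/eqP; rewrite subr_eq0 eq_le ab ba.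
  rewrite ler_norml; apply/andP; split.
    have : (c - L * (b - a)) * (b - a) <= \int[mu]_(x in `[a, b]) m x.
      rewrite -(Icst (c - L * (b - a))); apply: le_Rintegral => //; first exact: ic.
      move=> x /=; rewrite in_itv/= => /hc.
      by rewrite ler_norml => /andP[? ?]; lra.
    by move: (\int[mu]_(x in `[a, b]) m x); clear=> I; lra.
  have : \int[mu]_(x in `[a, b]) m x <= (c + L * (b - a)) * (b - a).
    rewrite -(Icst (c + L * (b - a))); apply: le_Rintegral => //; first exact: ic.
    move=> x /=; rewrite in_itv/= => /hc.
    by rewrite ler_norml => /andP[? ?]; lra.
  by move: (\int[mu]_(x in `[a, b]) m x); clear=> I; lra.
have [yz|/ltW zy] := leP y z.
  rewrite expr2 mulrA; apply: aux => // x /andP[yx xz].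
  by rewrite (le_trans (lm _ _))// ler_wpM2l// ger0_norm ?subr_ge0// lerB.
have := aux z y (m y) zy _; rewrite -normrN.
have -> : - (prim m y - prim m z - m y * (y - z)) = prim m z - prim m y - m y * (z - y) by ring.
have -> : L * (y - z) * (y - z) = L * (z - y) ^+ 2 by ring.
apply=> x /andP[zx xy].
rewrite distrC (le_trans (lm _ _))// ler_wpM2l// ger0_norm ?subr_ge0// lerB//.
Qed.

Lemma normr_maxB (c x z : R) : `|Num.max c x - Num.max c z| <= `|x - z|.
Proof.
have := ler_norm (x - z); have := ler_norm (z - x); rewrite (distrC z x) => h1 h2.
by rewrite ler_norml; case: (leP c x) => ?; case: (leP c z) => ?; apply/andP; split; lra.
Qed.

Lemma normr_minB (c x z : R) : `|Num.min c x - Num.min c z| <= `|x - z|.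
Proof.
have := ler_norm (x - z); have := ler_norm (z - x); rewrite (distrC z x) => h1 h2.
by rewrite ler_norml; case: (leP c x) => ?; case: (leP c z) => ?; apply/andP; split; lra.
Qed.

(** The primitive of a difference quotient is a difference of difference quotients of the primitive.
    It thus converges to the increment of [U], and by domination also to [prim u y]. *)
Lemma prim_dquot_lim U (u : R -> R) L y : lips L U ->
  (forall x, dquot U n x @[n --> \oo] --> u x) -> U y = U 0 + prim u y.
Proof.
move=> lU hu.
(* [prim] is controlled for bounded functions, so [U] is truncated at a level not reached on
   [|x| <= |y| + 1]; the extra 1 leaves room for the steps of the quotients. *)
pose B : R := `|U 0| + L * (`|y| + 1).
have L0 := lips_ge0 lU.
have UB x : `|x| <= `|y| + 1 -> `|U x| <= B by exact: lips_bound lU.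
pose T (x : R) : R := Num.max (- B) (Num.min B (U x)).
have B0 : 0 <= B by rewrite /B addr_ge0// mulr_ge0// addr_ge0.
have TE x : `|x| <= `|y| + 1 -> T x = U x.
  by move=> /UB; rewrite ler_norml => /andP[? ?]; rewrite /T min_r// max_r.
have TB x : `|T x| <= B.
  by rewrite ler_norml /T le_max lexx /= ge_max ge_min lexx /= andbT; lra.
have lT : lips L T.
  move=> x z; apply: le_trans (lU x z); rewrite /T.
  exact: le_trans (normr_maxB _ _ _) (normr_minB _ _ _).
have mT := lips_measurable lT.
have uL x : `|u x| <= L.
  have /cvg_norm hw := hu x; rewrite -(cvg_lim _ hw)//; apply: limr_le; first exact: cvgP hw.
  by apply: nearW => n; exact: dquot_bound lU.
have mu_ : measurable_fun setT u.
  apply: (@measurable_fun_cvg _ _ _ _ (fun n => dquot U n)) => //.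
  by move=> n; apply: measurable_dquot; exact: lips_measurable lU.
have mTs n : measurable_fun setT (fun x : R => T (x + n.+1%:R^-1)).
  exact: (measurableT_comp mT (measurable_shift _)).
have e n : prim (dquot T n) y = dquot (prim T) n y - dquot (prim T) n 0.
  have -> : prim (dquot T n) y = n.+1%:R * (prim (fun x : R => T (x + n.+1%:R^-1)) y - prim T y).
    rewrite /prim -RintB; last 2 first.
    - by apply: (@prim_weight_tame _ _ B) => // x; exact: TB.
    - exact: prim_weight_tame mT TB.
    rewrite -RintZ; last by apply: tameB; apply: (@prim_weight_tame _ _ B) => // x; exact: TB.
    by apply: eqRint => x; rewrite /dquot; ring.
  rewrite (prim_shift _ _ mT TB) /dquot add0r prim0; ring.
have h1 : prim (dquot T n) y @[n --> \oo] --> T y - T 0.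
  under eq_fun do rewrite e.
  have dT (x : R) : is_derive x 1 (prim T) (T x).
    apply: (@is_derive_quadratic_error _ _ _ _ L) => z.
    exact: (prim_error _ _ mT TB lT).
  by apply: cvgB; exact: dquot_cvg.
have h2 : prim (dquot T n) y @[n --> \oo] --> prim u y.
  apply: (@Rintegral_dominated _ _ _ mu _ _ (cball (`|0| + `|y|)) L).
  - by move=> n; exact: (prim_weight_tame 0 y (measurable_dquot n mT) (fun x => dquot_bound n x lT)).1.
  - exact: (prim_weight_tame 0 y mu_ uL).1.
  - exact: measurable_cball.
  - exact: cball_fin.
  - by move=> n x; apply: prim_weight_le => z; exact: dquot_bound.
  - apply: aeW => x; have [xy|xy] := leP `|x| `|y|; last first.
      rewrite (_ : (x < y)%R%:R - (x < 0)%R%:R = 0 :> R); last first.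
        have := xy; rewrite lter_normr => /orP h.
        have := ler_norm y; have := ler_norm (- y); rewrite normrN; have := normr_ge0 y.
        by case: h => h ? ? ?; do 2 case: ltP => ? //=; lra.
      by rewrite mulr0; under eq_fun do rewrite mulr0; exact: cvg_cst.
    apply: cvgMl; have := hu x; apply: cvg_trans; apply: near_eq_cvg; near=> n.
    rewrite /dquot !TE//; first by rewrite (le_trans xy)// lerDl.
    by rewrite (le_trans (ler_normD _ _))// lerD// ger0_norm// invf_le1// ler1n.
have e2 : T y - T 0 = prim u y.
  by rewrite -(cvg_lim _ h1)//; exact: (cvg_lim _ h2).
by rewrite -e2 !TE ?normr0 ?lerDl ?addr_ge0//; ring.
Unshelve. all: by end_near. Qed.

Variables (w0 : R -> R) (M : R).
Hypotheses (mw0 : measurable_fun setT w0) (w0M : forall y, `|w0 y| <= M).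

Definition potential t : R -> R := if 0 < t then hopf t (prim w0) else prim w0.

(** At time 0 the value is [w0] itself and not a derivative of its primitive, so the initial datum
    is attained at every point. *)
Definition burgers (p : R * R) : R :=
  if 0 < p.2 then limn (fun n => dquot (potential p.2) n p.1) else w0 p.1.

Let lV0 : lips M (prim w0). Proof. exact: prim_lips. Qed.

Lemma potential_lips t : lips M (potential t).
Proof. by rewrite /potential; case: ltP => // t0; exact: hopf_lips. Qed.

Lemma potentialD t h : 0 <= t -> 0 < h -> hopf h (potential t) = potential (t + h).
Proof.
move=> t0 h0; apply/funext => y; rewrite /potential ltr_wpDl//.
case: ltP => t1; first exact: hopf_semigroup.
by have -> : t = 0; [apply/eqP; rewrite eq_le t0 t1|rewrite add0r].
Qed.

Lemma burgers_dquot t y : 0 < t ->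
  dquot (potential t) n y @[n --> \oo] --> burgers (y, t).
Proof.
move=> t0; rewrite /burgers /= t0 /potential t0.
exact: hopf_dquot_cvg.
Qed.

Lemma burgers_step t h y : 0 <= t -> 0 < h ->
  dquot (hopf h (potential t)) n y @[n --> \oo] --> burgers (y, t + h).
Proof. by move=> t0 h0; rewrite potentialD//; apply: burgers_dquot; rewrite ltr_wpDl. Qed.

Lemma burgers_bound p : `|burgers p| <= M.
Proof.
case: p => y t; have [t0|t0] := ltP 0 t; last by rewrite /burgers /= ltNge t0 /=.
have /cvg_norm hw := @burgers_dquot t y t0.
rewrite -(cvg_lim _ hw)//; apply: limr_le; first exact: cvgP hw.
by apply: nearW => n; exact: dquot_bound (potential_lips t).
Qed.

Lemma potentialE t y : 0 <= t ->
  potential t y = potential t 0 + prim (fun z => burgers (z, t)) y.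
Proof.
rewrite le_eqVlt => /predU1P[<-|t0].
  rewrite /potential ltxx prim0 add0r; congr (prim _ _); apply/funext => z.
  by rewrite /burgers /= ltxx.
exact: prim_dquot_lim (potential_lips t) (fun z => @burgers_dquot t z t0).
Qed.

Lemma potential_time_lips s t y : 0 <= s -> 0 <= t ->
  `|potential s y - potential t y| <= M ^+ 2 * `|s - t|.
Proof.
wlog st : s t / s <= t.
  move=> hw s0 t0; have [st|/ltW ts] := leP s t; first exact: hw.
  by rewrite distrC (distrC s); exact: hw.
move=> s0 t0; move: st; rewrite le_eqVlt => /predU1P[->|st].
  by rewrite !subrr normr0 mulr0.
have h0 : 0 < t - s by rewrite subr_gt0.
have := hopf_diff_bound h0 (potential_lips s) y; rewrite potentialD// subrKC.
by rewrite distrC (distrC s) (gtr0_norm h0) mulrC.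
Qed.

(** Joint measurability: the potential is Lipschitz in space and time, hence continuous in the plane
    once frozen for negative times, and [burgers] is a pointwise limit of its spatial quotients. *)
Lemma burgers_measurable : measurable_fun setT burgers.
Proof.
pose U (p : R * R) := potential (Num.max 0 p.2) p.1.
have lU p q : `|U p - U q| <= (M + M ^+ 2) * (`|p.1 - q.1| + `|p.2 - q.2|).
  have M0 : 0 <= M by rewrite (le_trans _ (w0M 0)).
  have mx (c : R) : 0 <= Num.max 0 c by rewrite le_max lexx.
  have h1 := potential_lips (Num.max 0 p.2) p.1 q.1.
  have h2 := potential_time_lips q.1 (mx p.2) (mx q.2).
  have h3 : M ^+ 2 * `|Num.max 0 p.2 - Num.max 0 q.2| <= M ^+ 2 * `|p.2 - q.2|.
    by rewrite ler_wpM2l ?sqr_ge0// normr_maxB.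
  have h4 : 0 <= M * `|p.2 - q.2| by rewrite mulr_ge0.
  have h5 : 0 <= M ^+ 2 * `|p.1 - q.1| by rewrite mulr_ge0 ?sqr_ge0.
  rewrite /U -[X in `|X|](subrKA (potential (Num.max 0 p.2) q.1)).
  by rewrite (le_trans (ler_normD _ _))//; lra.
have mU e : measurable_fun setT (fun p : R * R => U (p.1 + e, p.2)).
  apply: continuous_measurable_fun2; apply: (@lips2_continuous _ (M + M ^+ 2)) => p q.
  apply: le_trans (lU _ _) _ => /=.
  by rewrite (_ : p.1 + e - (q.1 + e) = p.1 - q.1)//; ring.
pose F n (p : R * R) : R := if 0 < p.2 then dquot (potential p.2) n p.1 else w0 p.1.
have mpos : measurable_fun setT (fun p : R * R => 0 < p.2).
  by apply: measurable_fun_ltr => //; exact: measurable_snd.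
apply: (@measurable_fun_cvg _ _ _ _ F).
  move=> n; rewrite (_ : F n = fun p => if 0 < p.2 then
      n.+1%:R * (U (p.1 + n.+1%:R^-1, p.2) - U (p.1 + 0, p.2)) else w0 p.1); last first.
    apply/funext => -[y t]; rewrite /F /U /=; case: ifP => // t0.
    by rewrite max_r ?(ltW t0)// addr0.
  apply: measurable_fun_ifT => //.
    by apply: measurable_funM => //; exact: measurable_funB.
  exact: (measurableT_comp mw0 measurable_fst).
move=> [y t] _; rewrite /F /=; case: ltP => t0; first exact: burgers_dquot.
by rewrite /burgers /= ltNge t0 /=; exact: cvg_cst.
Qed.

End hopf_lax_solution.

(** * The entropy inequality for the Burgers equation *)

Section box_integrals.
Context {R : realType}.
Implicit Types (y t r T B C : R) (H : R * R -> R).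
Local Notation mu := (@lebesgue_measure R).
Local Notation mu2 := (lebesgue2 R).

Definition boxed H r T B := [/\ measurable_fun setT H, (forall p, `|H p| <= B),
  (forall y t, r < `|y| -> H (y, t) = 0) & (forall y t, T < `|t| -> H (y, t) = 0)].

Lemma boxed_tame H r T B : boxed H r T B -> tame mu2 H.
Proof.
move=> [mH HB Hr HT].
have m1 (s : R) : measurable (cball s : set (measurableTypeR R)) by exact: measurable_cball.
apply: (@tame_supp _ _ _ mu2 H (cball r `*` cball T) B) => //.
- exact: measurableX.
- have e := @product_measure1E _ _ _ _ _ mu mu _ _ (m1 r) (m1 T).
  apply: (@eq_ind_r _ _ (fun v => v < +oo)%E _ _ e).
  by apply: lte_mul_pinfty => //; rewrite ?ge0_fin_numE//; exact: cball_fin.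
- move=> [y t] /= nA; have [yr|yr] := leP `|y| r; last exact: Hr.
  apply: HT; rewrite ltNge; apply/negP => tT; apply: nA.
  by split; apply/cballE.
Qed.

Lemma boxed_section H r T B t : boxed H r T B ->
  [/\ measurable_fun setT (fun y => H (y, t)), (forall y, `|H (y, t)| <= B * \1_(cball r) y)
    & tame mu (fun y => H (y, t))].
Proof.
move=> [mH HB Hr HT].
have m1 : measurable_fun setT (fun y => H (y, t)) by exact: measurable_fun_pair1.
have b1 y : `|H (y, t)| <= B * \1_(cball r) y.
  rewrite indicE; case: (boolP (y \in _)) => [_|/negP yr]; first by rewrite mulr1.
  rewrite mulr0 normr_le0 Hr// ltNge; apply/negP => h1.
  by apply: yr; apply/mem_set/cballE.
split => //; apply: (@tame_dom _ _ _ mu _ (cball r) B) => //.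
  exact: measurable_cball.
exact: cball_fin.
Qed.

Definition cball_size r : R := fine (mu (cball r)).

Lemma cball_size_ge0 r : 0 <= cball_size r.
Proof. by rewrite fine_ge0. Qed.

Lemma boxed_int_le H r T B t : boxed H r T B ->
  `|\int[mu]_y H (y, t)| <= B * cball_size r.
Proof.
move=> bH; have [m1 b1 _] := boxed_section t bH.
exact: (@normr_Rint_le _ (measurableTypeR R) R mu _ (cball r) B m1 (measurable_cball r) (cball_fin r) b1).
Qed.

Lemma boxed_int H r T B : boxed H r T B ->
  [/\ measurable_fun setT (fun t => \int[mu]_y H (y, t)),
      (forall t, `|\int[mu]_y H (y, t)| <= B * cball_size r * \1_(cball T) t),
      tame mu (fun t => \int[mu]_y H (y, t)) &
      \int[mu2]_p H p = \int[mu]_t \int[mu]_y H (y, t)].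
Proof.
move=> bH; have tH := boxed_tame bH; have iH := tame_integrable tH.
have EG t : fubini_G mu (EFin \o H) t = (\int[mu]_y H (y, t))%:E.
  rewrite /Rintegral fineK//; apply: integrable_fin_num => //.
  by have [_ _ /tame_integrable] := boxed_section t bH.
have mG : measurable_fun setT (fun t => \int[mu]_y H (y, t)).
  apply/measurable_EFinP; have := measurable_fubini_G iH.
  by congr measurable_fun; apply/funext => t; exact: EG.
have bG t : `|\int[mu]_y H (y, t)| <= B * cball_size r * \1_(cball T) t.
  rewrite indicE; case: (boolP (t \in _)) => [_|/negP tT].
    by rewrite mulr1; exact: boxed_int_le bH.
  rewrite mulr0 normr_le0; apply/eqP; have [_ _ _ HT] := bH.
  rewrite (_ : (fun y => H (y, t)) = cst 0); first by rewrite Rintegral_cst// mul0r.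
  apply/funext => y; apply: HT; rewrite ltNge; apply/negP => h1.
  by apply: tT; apply/mem_set/cballE.
split => //.
  exact: (@tame_dom _ (measurableTypeR R) R mu _ (cball T) _ mG (measurable_cball T) (cball_fin T) bG).
rewrite /Rintegral /lebesgue2 -integral21_prod_meas1//; congr fine.
by apply: eq_integral => t _; exact: EG.
Qed.

End box_integrals.

Section halfline.
Context {R : realType}.
Implicit Types (t : R).
Local Notation mu := (@lebesgue_measure R).

Lemma singleton_ae (c : R) : {ae mu, forall t, t != c}.
Proof.
exists [set c]; split; [exact: measurable_set1|exact: lebesgue_measure_set1|].
by move=> t /=; case: eqP.
Qed.

(** Written so that [halfline t - halfline (t - h)] is literally the signed indicator used in
    [prim]. *)
Definition halfline (t : R) : R := 1 - (t < 0)%R%:R.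

Lemma halfline_ge0 t : 0 <= t -> halfline t = 1.
Proof. by move=> t0; rewrite /halfline ltNge t0 subr0. Qed.

Lemma halfline_lt0 t : t < 0 -> halfline t = 0.
Proof. by move=> t0; rewrite /halfline t0 subrr. Qed.

Lemma halfline_bound t : `|halfline t| <= 1.
Proof.
have [t0|t0] := leP 0 t; first by rewrite halfline_ge0// normr1.
by rewrite halfline_lt0// normr0.
Qed.

Lemma measurable_halfline : measurable_fun setT halfline.
Proof.
apply: measurable_funB => //; apply: (measurableT_comp (f := fun b : bool => b%:R : R)) => //.
exact: measurable_fun_ltr.
Qed.

Lemma halfline_shift_cvg (u : nat -> R) t : t != 0 -> u n @[n --> \oo] --> 0 ->
  halfline (t - u n) @[n --> \oo] --> halfline t.
Proof.
move=> t0 u0; apply: cvg_near_cst.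
have t1 : 0 < `|t| by rewrite normr_gt0.
have : \forall n \near \oo, `|u n| < `|t|.
  by have /cvgrPdist_lt/(_ _ t1) := u0; apply: filterS => n; rewrite sub0r normrN.
apply: filterS => n; rewrite /halfline; have [t2|t2] := ltP t 0.
  rewrite (ltr0_norm t2) ltr_norml opprK => /andP[h1 _].
  by rewrite (_ : t - u n < 0)//; lra.
rewrite (ger0_norm t2) ltr_norml => /andP[_ h1].
by rewrite (_ : (t - u n < 0) = false)//; apply/negbTE; rewrite -leNgt; lra.
Qed.

End halfline.

Lemma layer_arith {R : realType} (A S I1 I2 A0 Z1 Z2 Z3 t : R) :
  A + S <= I1 + I2 -> I2 <= t * Z3 -> I1 <= A0 + t * Z2 -> - (2 * t * Z1) <= S ->
  A <= A0 + (2 * Z1 + Z2 + Z3) * t.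
Proof. by move=> *; lra. Qed.

(** Division of a time step by its length: [q] is the inverse step and [x] is [1 + k h]. *)
Lemma step_arith {R : realType} (q x S a1 a2 I J : R) : 0 < q ->
  a2 + q^-1 / x * S <= I + J -> q * (a2 - a1) + x^-1 * S - q * (I - a1) <= q * J.
Proof.
move=> q0 /(ler_wpM2l (ltW q0)); rewrite mulrDr !mulrA divff ?gt_eqF// mul1r mulrDr.
by rewrite !mulrBr; lra.
Qed.

Section time_integration.
Context {R : realType}.
Implicit Types (y t h : R).
Local Notation mu := (@lebesgue_measure R).

(** The continuity of [Phiy] in time allows the test function to be evaluated at the end [t + h] of
    each step. *)
Record test2 (Phi Phiy Phit : R * R -> R) (r T C : R) : Prop := Test2 {
  test2_y : forall t, test (fun y => Phi (y, t)) (fun y => Phiy (y, t)) r C ;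
  test2_t : forall y, test (fun t => Phi (y, t)) (fun t => Phit (y, t)) T C ;
  test2_bound : forall p, `|Phi p| <= C ;
  test2_ycvg : forall y t (u : nat -> R), u n @[n --> \oo] --> 0 ->
    Phiy (y, t + u n) @[n --> \oo] --> Phiy (y, t) ;
  test2_measurable : [/\ measurable_fun setT Phi, measurable_fun setT Phiy
    & measurable_fun setT Phit] }.

Lemma boxed_mul (G K : R * R -> R) r T A B : measurable_fun setT G -> 0 <= A ->
  (forall y t, `|y| <= r -> `|G (y, t)| <= A) -> boxed K r T B ->
  boxed (fun p => G p * K p) r T (A * B).
Proof.
move=> mG A0 GA [mK KB Kr KT]; split.
- exact: measurable_funM.
- move=> [y t]; have [yr|yr] := leP `|y| r.
    by rewrite normrM ler_pM// GA.
  by rewrite Kr// mulr0 normr0 mulr_ge0// (le_trans _ (KB (y, t))).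
- by move=> y t yr; rewrite Kr// mulr0.
- by move=> y t yr; rewrite KT// mulr0.
Qed.

Variables (w0 : R -> R) (M k r T C : R) (Phi Phiy Phit : R * R -> R).
Hypotheses (mw0 : measurable_fun setT w0) (w0M : forall y, `|w0 y| <= M).
Hypotheses (r0 : 0 <= r) (tPhi : test2 Phi Phiy Phit r T C).
Hypothesis Phi_ge0 : forall y t, 0 <= t -> 0 <= Phi (y, t).

Let C0 : 0 <= C. Proof. exact: le_trans (test2_bound tPhi (0, 0)). Qed.
Let M0 : 0 <= M. Proof. exact: le_trans (w0M 0). Qed.

Lemma test2_boxed : boxed Phi r T C.
Proof.
have [m1 _ _] := test2_measurable tPhi; split => //; first exact: test2_bound tPhi.
  by move=> y t yr; exact: (test_supp (test2_y tPhi t)).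
by move=> y t yr; exact: (test_supp (test2_t tPhi y)).
Qed.

Lemma test2y_boxed : boxed Phiy r T C.
Proof.
have [_ m1 _] := test2_measurable tPhi; split => //.
- by move=> [y t]; exact: (dtest_bound (test2_y tPhi t) y).
- by move=> y t yr; exact: (dtest_supp (test2_y tPhi t) yr).
- move=> y t tT; have [_ <-] := test_derive (test2_y tPhi t) y.
  have -> : (fun y => Phi (y, t)) = cst 0.
    by apply/funext => z; exact: (test_supp (test2_t tPhi z)).
  exact: derive_cst.
Qed.

Lemma test2t_boxed : boxed Phit r T C.
Proof.
have [_ _ m1] := test2_measurable tPhi; split => //.
- by move=> [y t]; exact: (dtest_bound (test2_t tPhi y) t).
- move=> y t yr; have [_ <-] := test_derive (test2_t tPhi y) t.
  have -> : (fun t => Phi (y, t)) = cst 0.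
    by apply/funext => z; exact: (test_supp (test2_y tPhi z)).
  exact: derive_cst.
- by move=> y t yr; exact: (dtest_supp (test2_t tPhi y) yr).
Qed.

Let W := burgers w0.
Let mW : measurable_fun setT W. Proof. exact: burgers_measurable mw0 w0M. Qed.
Let WM p : `|W p| <= M. Proof. exact: burgers_bound. Qed.

Definition kruzkov_eta (p : R * R) : R := `|W p - k * p.1 / 2|.
(** This is [f_x (x, k) = k ^ 2] with its sign and the Jacobian; the sign of [y] passes from the
    argument of [Num.sg] to the factor [y / 2], leaving [|y| / 2]. *)
Definition kruzkov_source (p : R * R) : R :=
  Num.sg (W p - k * p.1 / 2) * (k ^+ 2 * p.1 / 2).
Definition kruzkov_flux (p : R * R) : R :=
  Num.sg (W p - k * p.1 / 2) * (W p ^+ 2 - (k * p.1 / 2) ^+ 2).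

Let half_bound (c y : R) : `|y| <= r -> `|c * y / 2| <= `|c| * r.
Proof.
move=> yr; rewrite !normrM [`|2^-1|]ger0_norm//.
have := ler_wpM2l (normr_ge0 c) yr; have := mulr_ge0 (normr_ge0 c) (normr_ge0 y); lra.
Qed.

Let mlin (c : R) : measurable_fun setT (fun p : R * R => c * p.1 / 2).
Proof. by apply: measurable_funM => //; apply: measurable_funM => //; exact: measurable_fst. Qed.

Let msg : measurable_fun setT (fun p : R * R => Num.sg (W p - k * p.1 / 2)).
Proof.
apply: (measurableT_comp (@measurable_sgr R)).
by apply: measurable_funB => //; exact: mlin.
Qed.

Lemma kruzkov_eta_measurable : measurable_fun setT kruzkov_eta.
Proof. by apply: measurableT_comp => //; apply: measurable_funB => //; exact: mlin. Qed.

Lemma kruzkov_source_measurable : measurable_fun setT kruzkov_source.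
Proof. by apply: measurable_funM => //; exact: mlin. Qed.

Lemma kruzkov_flux_measurable : measurable_fun setT kruzkov_flux.
Proof.
apply: measurable_funM => //; apply: measurable_funB; exact: measurable_funX.
Qed.

Let EB : R := M + `|k| * r.
Let SB : R := `|k ^+ 2| * r.
Let FB : R := M ^+ 2 + (`|k| * r) ^+ 2.

Let EB0 : 0 <= EB. Proof. by rewrite addr_ge0// mulr_ge0. Qed.
Let SB0 : 0 <= SB. Proof. by rewrite mulr_ge0. Qed.
Let FB0 : 0 <= FB. Proof. by rewrite addr_ge0// sqr_ge0. Qed.

Let eta_bound y t : `|y| <= r -> `|kruzkov_eta (y, t)| <= EB.
Proof.
move=> yr; rewrite /kruzkov_eta normr_id (le_trans (ler_normB _ _))// lerD//.
exact: half_bound.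
Qed.

Let source_bound y t : `|y| <= r -> `|kruzkov_source (y, t)| <= SB.
Proof.
move=> yr; rewrite /kruzkov_source normrM -[SB]mul1r; apply: ler_pM => //.
  exact: normr_sg_le1.
exact: half_bound.
Qed.

Let flux_bound y t : `|y| <= r -> `|kruzkov_flux (y, t)| <= FB.
Proof.
move=> yr; rewrite /kruzkov_flux normrM -[FB]mul1r; apply: ler_pM => //.
  exact: normr_sg_le1.
rewrite (le_trans (ler_normB _ _))// lerD// normrX ler_pXn2r ?nnegrE ?mulr_ge0//.
exact: half_bound.
Qed.

Lemma kruzkov_eta_boxed (K : R * R -> R) T' B : boxed K r T' B ->
  boxed (fun p => kruzkov_eta p * K p) r T' (EB * B).
Proof.
by move=> bK; apply: boxed_mul bK => //; first [exact: kruzkov_eta_measurable|exact: eta_bound].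
Qed.

Lemma kruzkov_source_boxed (K : R * R -> R) T' B : boxed K r T' B ->
  boxed (fun p => kruzkov_source p * K p) r T' (SB * B).
Proof.
by move=> bK; apply: boxed_mul bK => //; first [exact: kruzkov_source_measurable|exact: source_bound].
Qed.

Lemma kruzkov_flux_boxed (K : R * R -> R) T' B : boxed K r T' B ->
  boxed (fun p => kruzkov_flux p * K p) r T' (FB * B).
Proof.
by move=> bK; apply: boxed_mul bK => //; first [exact: kruzkov_flux_measurable|exact: flux_bound].
Qed.

Let a t := \int[mu]_y (kruzkov_eta (y, t) * Phi (y, t)).
Let s t := \int[mu]_y (kruzkov_source (y, t) * Phi (y, t)).
Let beta t := \int[mu]_y (kruzkov_eta (y, t) * Phit (y, t)).
Let gamma t := \int[mu]_y (kruzkov_flux (y, t) * Phiy (y, t)).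

Let N : R := `|k| * (r + 2) / 2.
Let N0 : 0 <= N. Proof. by rewrite divr_ge0// mulr_ge0// addr_ge0. Qed.
(** Adds up the two smallness conditions on the step, so that [h * X <= 1] implies both. *)
Let X : R := 4 * N + `|k| * (r + 3).
Let X0 : 0 <= X. Proof. by rewrite addr_ge0// mulr_ge0// addr_ge0. Qed.
Let D h t y := flux_defect (fun z => W (z, t)) k N h y.
Let kr : `|k| * r / 2 <= N.
Proof. by rewrite /N ler_pM2r// ler_wpM2l// lerDl. Qed.

Let mWt t : measurable_fun setT (fun y => W (y, t)).
Proof. exact: measurable_fun_pair1. Qed.

Let small_step h : 0 < h -> h * X <= 1 ->
  [/\ 4 * h * N <= 1, `|k| * h * (r + 3) <= 1 & `|k * h| <= 3^-1].
Proof.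
move=> h0; have -> : h * X = 4 * h * N + `|k| * h * (r + 3) by rewrite /X; ring.
have n1 : 0 <= 4 * h * N.
  by apply: mulr_ge0; [apply: mulr_ge0 => //; exact: ltW|exact: N0].
have n2 : 0 <= `|k| * h * r by rewrite !mulr_ge0// ltW.
have n3 : 0 <= `|k| * h by rewrite mulr_ge0// ltW.
by move=> hX; split; rewrite ?normrM ?(gtr0_norm h0); lra.
Qed.

Let time_step t h : 0 <= t -> 0 < h -> h * X <= 1 ->
  a (t + h) + h / (1 + k * h) * s (t + h) <=
  \int[mu]_y (kruzkov_eta (y, t) * Phi (y, t + h)) +
  \int[mu]_y (D h t y * Phiy (y, t + h)).
Proof.
move=> t0 h0 hX.
have th0 : 0 <= t + h by rewrite addr_ge0// ltW.
apply: (@kruzkov_step_fixed _ (fun y => W (y, t)) k M N (mWt t) (fun y => WM (y, t)) N0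
  (potential w0 t) (fun y => W (y, t + h)) h _ _ h0 _ (fun y => Phi (y, t + h))
  (fun y => Phiy (y, t + h)) r C) => //.
- exact: potential_lips.
- by move=> y; exact: potentialE t0.
- by move=> y; exact: burgers_step.
- by case: (small_step h0 hX).
- by case: (small_step h0 hX).
- exact: test2_y tPhi (t + h).
- by move=> y; exact: Phi_ge0.
Qed.

Let bPhi := test2_boxed.
Let bPhiy := test2y_boxed.
Let bPhit := test2t_boxed.

Let a_int := boxed_int (kruzkov_eta_boxed bPhi).
Let s_int := boxed_int (kruzkov_source_boxed bPhi).
Let beta_int := boxed_int (kruzkov_eta_boxed bPhit).
Let gamma_int := boxed_int (kruzkov_flux_boxed bPhiy).

Let defect_le t h t' : 0 < h ->
  `|\int[mu]_y (D h t y * Phiy (y, t'))| <= h * (2 * (M + N) ^+ 2) * C * cball_size r.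
Proof.
move=> h0; have mD : measurable_fun setT (D h t).
  exact: (measurable_flux_defect k (mWt t) (fun y => WM (y, t)) N0 h0).
have [_ _ bm _] := bPhiy; have [m1 b1 _] := boxed_section t' bPhiy.
apply: (@normr_Rint_le _ (measurableTypeR R) R mu _ (cball r) _ _ (measurable_cball r) (cball_fin r)).
  exact: measurable_funM.
move=> y; rewrite normrM -[leRHS]mulrA; apply: (ler_pM _ _ _ (b1 y)) => //.
exact: (flux_defect_bound k (mWt t) (fun y => WM (y, t)) N0 y h0).
Qed.

Let kh_pos h : `|k * h| <= 3^-1 -> 2 / 3 <= 1 + k * h.
Proof. by rewrite ler_norml => /andP[]; lra. Qed.

(** A single step of length [t] from time 0. This one-sided continuity of the entropy at the initial
    time is what [first_term] requires. *)
Let initial_layer : exists2 C' : R, 0 <= C' & forall t, 0 <= t -> t * X <= 1 ->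
  a t <= a 0 + C' * t.
Proof.
pose size := cball_size r; have size0 : 0 <= size := cball_size_ge0 r.
exists (2 * (SB * C * size) + EB * C * size + 2 * (M + N) ^+ 2 * C * size).
  have z1 := mulr_ge0 (mulr_ge0 SB0 C0) size0.
  have z2 := mulr_ge0 (mulr_ge0 EB0 C0) size0.
  have z3 := mulr_ge0 (mulr_ge0 (sqr_ge0 (M + N)) C0) size0.
  by rewrite -!mulrA in z1 z2 z3 *; rewrite !addr_ge0// mulr_ge0.
move=> t; rewrite le_eqVlt => /predU1P[<- _|t0 tX]; first by rewrite mulr0 addr0.
have [_ _ kt] := small_step t0 tX; have kt1 := kh_pos kt.
have := time_step (lexx 0) t0 tX; rewrite !add0r => h1.
have := defect_le 0 t t0; rewrite ler_norml => /andP[_ h2].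
have := boxed_int_le t (kruzkov_source_boxed bPhi); rewrite ler_norml => /andP[h3 _].
have h4 : \int[mu]_y (kruzkov_eta (y, 0) * Phi (y, t)) <= a 0 + EB * (C * t) * size.
  have [_ _ t1] := boxed_section 0 (kruzkov_eta_boxed bPhi).
  have [mp _ _] := boxed_section t bPhi; have [mp0 _ _] := boxed_section 0 bPhi.
  have me : measurable_fun setT (fun y => kruzkov_eta (y, 0)).
    exact: measurable_fun_pair1 kruzkov_eta_measurable.
  have bd y : `|kruzkov_eta (y, 0) * (Phi (y, t) - Phi (y, 0))| <= EB * (C * t) * \1_(cball r) y.
    rewrite indicE; case: (boolP (y \in _)) => [/set_mem/cballE yr|/negP yr].
      rewrite mulr1 normrM; apply: ler_pM => //; first exact: eta_bound.
      have := test_lips (test2_t tPhi y) t 0.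
      by rewrite subr0 (gtr0_norm t0).
    have yr' : r < `|y|.
      by rewrite ltNge; apply/negP => h; apply: yr; apply/mem_set/cballE.
    by rewrite !(test_supp (test2_y tPhi _) yr') subrr mulr0 normr0 mulr0.
  have md : measurable_fun setT (fun y => kruzkov_eta (y, 0) * (Phi (y, t) - Phi (y, 0))).
    by apply: measurable_funM => //; exact: measurable_funB.
  have td := @tame_dom _ (measurableTypeR R) R mu _ (cball r) _ md (measurable_cball r) (cball_fin r) bd.
  have := @normr_Rint_le _ (measurableTypeR R) R mu _ (cball r) _ md (measurable_cball r) (cball_fin r) bd.
  rewrite ler_norml => /andP[_]; rewrite -lerBlDl => h5; apply: le_trans h5.
  rewrite le_eqVlt; apply/orP; left; apply/eqP; rewrite /a -RintB//.
    by apply: eqRint => y; ring.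
  have -> : (fun y => kruzkov_eta (y, 0) * Phi (y, t)) =
    (fun y => kruzkov_eta (y, 0) * (Phi (y, t) - Phi (y, 0))) \+ (fun y => kruzkov_eta (y, 0) * Phi (y, 0)).
    by apply/funext => y /=; ring.
  exact: tameD.
have h5 : - (2 * t * (SB * C * size)) <= t / (1 + k * t) * s t.
  have c0 : 0 <= t / (1 + k * t) by rewrite divr_ge0 ?(ltW t0)//; lra.
  (* Here [1 + k * t >= 2 / 3], by [kh_pos]. *)
  have c1 : t / (1 + k * t) <= 2 * t by rewrite ler_pdivrMr; nra.
  have Z : 0 <= SB * C * size by rewrite !mulr_ge0.
  have := ler_wpM2l c0 h3; have := ler_wpM2r Z c1; rewrite /s -/size; lra.
have {}h2 : \int[mu]_y (D t 0 y * Phiy (y, t)) <= t * (2 * (M + N) ^+ 2 * C * size).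
  by rewrite !mulrA in h2 *.
have {}h4 : \int[mu]_y (kruzkov_eta (y, 0) * Phi (y, t)) <= a 0 + t * (EB * C * size).
  by rewrite (mulrC C) !mulrA in h4; rewrite !mulrA (mulrC t).
exact: (layer_arith h1 h2 h4 h5).
Qed.

(** Shifting the index by [n0] makes every step [(q n)^-1] admissible from the first one on. *)
Let n0 := Num.truncn X.
Let q n : R := (n + n0).+1%:R.
Let q_gt0 n : 0 < q n. Proof. by rewrite ltr0n. Qed.
Let q_small n : 0 < (q n)^-1 /\ (q n)^-1 * X <= 1.
Proof.
split; first by rewrite invr_gt0.
rewrite mulrC ler_pdivrMr// mul1r (le_trans (ltW (truncnS_gt X)))// ler_nat ltnS.
exact: leq_addl.
Qed.

Let qV_cvg : (q n)^-1 @[n --> \oo] --> (0 : R).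
Proof. by have := @cvg_harmonic R; rewrite -(cvg_shiftn n0). Qed.

Let qV_le1 n : (q n)^-1 <= 1.
Proof. by rewrite invf_le1// ler1n. Qed.

Let shifted_boxed h : 0 <= h -> h <= 1 ->
  boxed (fun p : R * R => Phi (p.1, p.2 + h)) r (T + 1) C.
Proof.
move=> h0 h1; have [m1 b1 s1 s2] := bPhi; split => //.
- apply: (measurableT_comp m1); apply: measurable_fun_pair => /=; first exact: measurable_fst.
  by apply: measurable_funD => //; exact: measurable_snd.
- by move=> y t; exact: s1.
- move=> y t tT; apply: s2 => /=; have := ler_normB (t + h) h; rewrite addrK (ger0_norm h0); lra.
Qed.

Let quotient_boxed n :
  boxed (fun p : R * R => q n * (Phi (p.1, p.2 + (q n)^-1) - Phi p)) r (T + 1) C.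
Proof.
have [h0 _] := q_small n; have h1 := qV_le1 n.
have [m1 b1 s1 s2] := shifted_boxed (ltW h0) h1; have [m2 b2 s3 s4] := bPhi; split.
- by apply: measurable_funM => //; exact: measurable_funB.
- move=> [y t] /=; have := test_lips (test2_t tPhi y) (t + (q n)^-1) t.
  rewrite (_ : t + (q n)^-1 - t = (q n)^-1); last by rewrite addrAC subrr add0r.
  rewrite normrM (gtr0_norm (q_gt0 n)) (gtr0_norm h0) => h.
  by rewrite mulrC -ler_pdivlMr.
- by move=> y t yr; rewrite s1// s3// subr0 mulr0.
- move=> y t tT; rewrite s2// s4 ?subr0 ?mulr0//; lra.
Qed.

Let b n t := \int[mu]_y (kruzkov_eta (y, t) * (q n * (Phi (y, t + (q n)^-1) - Phi (y, t)))).
Let b_int n := boxed_int (kruzkov_eta_boxed (quotient_boxed n)).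

Let bE n t : b n t =
  q n * (\int[mu]_y (kruzkov_eta (y, t) * Phi (y, t + (q n)^-1)) - a t).
Proof.
have [h0 _] := q_small n.
have [_ _ t1] := boxed_section t (kruzkov_eta_boxed (shifted_boxed (ltW h0) (qV_le1 n))).
have [_ _ t2] := boxed_section t (kruzkov_eta_boxed bPhi).
rewrite /b /a -(RintB t1 t2) -RintZ; last exact: tameB.
by apply: eqRint => y /=; ring.
Qed.

Let b_cvg t : b n t @[n --> \oo] --> beta t.
Proof.
have me : measurable_fun setT (fun y => kruzkov_eta (y, t)).
  exact: measurable_fun_pair1 kruzkov_eta_measurable.
have [mp _ _] := boxed_section t bPhit.
have cr := measurable_cball r; have cf := cball_fin r.
apply: (@Rintegral_dominated _ (measurableTypeR R) R mu _ _ (cball r) (EB * C)) => //.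
- by move=> n; have [] := boxed_section t (kruzkov_eta_boxed (quotient_boxed n)).
- exact: measurable_funM.
- by move=> n y; have [] := boxed_section t (kruzkov_eta_boxed (quotient_boxed n)).
- apply: aeW => y; apply: cvgMl_tmp.
  have := dquot_cvg (test_derive (test2_t tPhi y) t).
  by rewrite -(cvg_shiftn n0); exact.
Qed.

Let c n t := \int[mu]_y (q n * D (q n)^-1 t y * Phiy (y, t + (q n)^-1)).

Let cE n t : c n t = q n * \int[mu]_y (D (q n)^-1 t y * Phiy (y, t + (q n)^-1)).
Proof.
have [h0 _] := q_small n.
rewrite /c -RintZ; first by apply: eqRint => y; rewrite mulrA.
have [_ _ tp] := boxed_section (t + (q n)^-1) bPhiy.
have mD := measurable_flux_defect k (mWt t) (fun y => WM (y, t)) N0 h0.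
exact: (@tameM _ (measurableTypeR R) R mu _ _ _ mD
  (fun y => flux_defect_bound k (mWt t) (fun y => WM (y, t)) N0 y h0) tp).
Qed.

Let c_bound n t :
  `|c n t| <= 2 * (M + N) ^+ 2 * C * cball_size r * \1_(cball (T + 1)) t.
Proof.
have [h0 _] := q_small n.
have K0 : 0 <= 2 * (M + N) ^+ 2 * C * cball_size r.
  exact: mulr_ge0 (mulr_ge0 (mulr_ge0 (ler0n _ _) (sqr_ge0 _)) C0) (cball_size_ge0 r).
rewrite indicE; case: (boolP (t \in _)) => [_|/negP tT].
  have := defect_le t (t + (q n)^-1) h0.
  rewrite cE.
  move=> h; rewrite normrM (gtr0_norm (q_gt0 n)) mulr1.
  rewrite mulrC -ler_pdivlMr// (le_trans h)// le_eqVlt; apply/orP; left; apply/eqP; ring.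
have tT' : T < `|t + (q n)^-1|.
  have : T + 1 < `|t| by rewrite ltNge; apply/negP => h; apply: tT; apply/mem_set/cballE.
  have := ler_normB (t + (q n)^-1) (q n)^-1; rewrite addrK (gtr0_norm h0).
  by have := qV_le1 n; move: (q n)^-1 => e; lra.
have [_ _ _ sT] := bPhiy.
have -> : c n t = 0.
  rewrite cE (@eqRint _ _ _ mu _ (cst 0)) ?Rintegral_cst ?mul0r ?mulr0// => y.
  by rewrite sT// mulr0.
by rewrite normr0 mulr0.
Qed.

Let c_cvg t : c n t @[n --> \oo] --> gamma t.
Proof.
have tn n : test (fun y => Phi (y, t + n.+1%:R^-1)) (fun y => Phiy (y, t + n.+1%:R^-1)) r C.
  exact: test2_y tPhi _.
have cn y : Phiy (y, t + n.+1%:R^-1) @[n --> \oo] --> Phiy (y, t).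
  by apply: (test2_ycvg tPhi); exact: cvg_harmonic.
have := flux_defect_integral_cvg (mWt t) (fun y => WM (y, t)) N0 kr tn cn.
by rewrite -(cvg_shiftn n0); exact.
Qed.

Let tame_half f : tame mu f -> tame mu (fun t => halfline t * f t).
Proof. by move=> tf;
  exact: (@tameM _ (measurableTypeR R) R mu _ _ _ measurable_halfline halfline_bound tf). Qed.

(** The left side of the step inequality divided by the step; writing [Phi] at the later time as
    [Phi] at [t] plus an increment separates the quotient of [a] from [b n]. *)
Let Bn n t := halfline t * (q n * (a (t + (q n)^-1) - a t) +
  (1 + k * (q n)^-1)^-1 * s (t + (q n)^-1) - b n t).

Let Bn_tame n : tame mu (Bn n).
Proof.
have [_ _ ta _] := a_int; have [_ _ ts _] := s_int; have [_ _ tb _] := b_int n.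
apply: tame_half; apply: tameB => //; apply: tameD; apply: tameZ; last exact: tame_shift.
by apply: tameB => //; exact: tame_shift.
Qed.

Let Bn_le n t : Bn n t <= halfline t * c n t.
Proof.
rewrite /Bn; have [t0|t0] := ltP t 0; first by rewrite halfline_lt0// !mul0r.
rewrite halfline_ge0// !mul1r; have [h0 hX] := q_small n.
have := time_step t0 h0 hX.
rewrite bE.
rewrite cE.
by apply: step_arith.
Qed.

Let half_int f : tame mu f -> forall h,
  \int[mu]_t (halfline t * f (t + h)) = \int[mu]_t (halfline (t - h) * f t).
Proof.
move=> tf h.
have mh : measurable_fun setT (fun t => halfline (t - h)).
  exact: (measurableT_comp measurable_halfline (measurable_shift (- h))).
have t1 : tame mu (fun t => halfline (t - h) * f t).
  exact: (@tameM _ (measurableTypeR R) R mu _ _ _ mh (fun t => halfline_bound (t - h)) tf).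
by rewrite -(Rint_shift h t1); apply: eqRint => t /=; rewrite addrK.
Qed.

(** After a translation in [t] the quotient telescopes to minus the mean of [a] over [[0, h[], which
    [initial_layer] bounds from below. *)
Let first_term : exists2 C' : R, 0 <= C' & forall n,
  - (a 0 + C' * (q n)^-1) <=
  \int[mu]_t (halfline t * (q n * (a (t + (q n)^-1) - a t))).
Proof.
have [C' C'0 C'P] := initial_layer; exists C' => // n.
have [h0 hX] := q_small n; set h := (q n)^-1 in h0 hX *.
have [ma _ ta _] := a_int.
have aB t : `|a t| <= EB * C * cball_size r.
  exact: boxed_int_le (kruzkov_eta_boxed bPhi).
have wt : tame mu (fun t => a t * ((t < h)%R%:R - (t < 0)%R%:R)) by exact: prim_weight_tame ma aB.
have mcK : measurable_fun setT (cst (a 0 + C' * h) : R -> R) by exact: measurable_cst.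
have wc : tame mu (fun t => (a 0 + C' * h) * ((t < h)%R%:R - (t < 0)%R%:R)).
  by apply: (@prim_weight_tame R (cst (a 0 + C' * h)) `|a 0 + C' * h|) => //.
have -> : \int[mu]_t (halfline t * (q n * (a (t + h) - a t))) =
    q n * (- \int[mu]_t (a t * ((t < h)%R%:R - (t < 0)%R%:R))).
  have t1 := tame_half ta; have t2 := tame_half (tame_shift h ta).
  have mh : measurable_fun setT (fun t => halfline (t - h)).
    exact: (measurableT_comp measurable_halfline (measurable_shift (- h))).
  have t3 : tame mu (fun t => halfline (t - h) * a t).
    exact: (@tameM _ (measurableTypeR R) R mu _ _ _ mh (fun t => halfline_bound (t - h)) ta).
  have -> : \int[mu]_t (halfline t * (q n * (a (t + h) - a t))) =
      \int[mu]_t (q n * (halfline t * a (t + h) - halfline t * a t)).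
    by apply: eqRint => t; ring.
  rewrite RintZ; last exact: tameB.
  congr (_ * _); rewrite (RintB t2 t1) (half_int ta) -(RintB t3 t1) -(RintN wt).
  by apply: eqRint => t; rewrite /halfline subr_lt0 -/(a t); move: (a t) => z; ring.
rewrite mulrN lerN2.
have : \int[mu]_t (a t * ((t < h)%R%:R - (t < 0)%R%:R)) <=
    \int[mu]_t ((a 0 + C' * h) * ((t < h)%R%:R - (t < 0)%R%:R)).
  apply: le_Rint => // t; have [t0|t0] := ltP t 0.
    by rewrite (lt_trans t0 h0) subrr !mulr0.
  rewrite subr0; have [th|_] := ltP t h; last by rewrite !mulr0.
  rewrite !mulr1 (le_trans (C'P t t0 _))//.
    by rewrite (le_trans _ hX)// ler_wpM2r// ltW.
  by rewrite lerD2l ler_wpM2l// ltW.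
have <- := @primB R (cst (a 0 + C' * h)) `|a 0 + C' * h| 0 h mcK (fun=> lexx _).
rewrite (prim_cst _ (ltW h0)) subr0 => ineq.
by rewrite mulrC -ler_pdivlMr.
Qed.

(** No continuity of [s] is at hand, so the translation is moved onto [halfline], which is
    continuous except at 0. *)
Let source_cvg : \int[mu]_t (halfline t * s (t + (q n)^-1)) @[n --> \oo] -->
  \int[mu]_t (halfline t * s t).
Proof.
have [ms sB ts _] := s_int.
have -> : (fun n => \int[mu]_t (halfline t * s (t + (q n)^-1))) =
    fun n => \int[mu]_t (halfline (t - (q n)^-1) * s t).
  by apply/funext => n; exact: half_int.
have mh n : measurable_fun setT (fun t => halfline (t - (q n)^-1)).
  exact: (measurableT_comp measurable_halfline (measurable_shift (- (q n)^-1))).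
apply: (@Rintegral_dominated _ (measurableTypeR R) R mu _ _ (cball T) (SB * C * cball_size r)).
- by move=> n; apply: measurable_funM => //; exact: mh.
- by apply: measurable_funM => //; exact: measurable_halfline.
- exact: measurable_cball.
- exact: cball_fin.
- move=> n t; rewrite normrM (le_trans _ (sB t))// -[leRHS]mul1r ler_wpM2r//.
  exact: halfline_bound.
- apply: ae_imply (singleton_ae 0) => t t0; apply: cvgMr_tmp.
  exact: halfline_shift_cvg.
Qed.

Let beta_cvg : \int[mu]_t (halfline t * b n t) @[n --> \oo] -->
  \int[mu]_t (halfline t * beta t).
Proof.
have [mb _ tb _] := beta_int.
apply: (@Rintegral_dominated _ (measurableTypeR R) R mu _ _ (cball (T + 1)) (EB * C * cball_size r)).
- by move=> n; have [m1 _ _ _] := b_int n; apply: measurable_funM => //; exact: measurable_halfline.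
- by apply: measurable_funM => //; exact: measurable_halfline.
- exact: measurable_cball.
- exact: cball_fin.
- move=> n t; have [_ b1 _ _] := b_int n.
  rewrite normrM (le_trans _ (b1 t))// -[leRHS]mul1r ler_wpM2r//.
  exact: halfline_bound.
- by apply: aeW => t; apply: cvgMl_tmp; exact: b_cvg.
Qed.

Lemma burgers_entropy_iterated :
  \int[mu]_t (halfline t * s t) <= \int[mu]_t (halfline t * beta t) +
    \int[mu]_t (halfline t * gamma t) + a 0.
Proof.
have [mg _ tg _] := gamma_int.
have mhg : measurable_fun setT (fun t => halfline t * gamma t).
  by apply: measurable_funM => //; exact: measurable_halfline.
have cb n t : `|halfline t * c n t| <= 2 * (M + N) ^+ 2 * C * cball_size r * \1_(cball (T + 1)) t.
  rewrite normrM (le_trans _ (c_bound n t))// -[leRHS]mul1r ler_wpM2r//.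
  exact: halfline_bound.
have hc t : halfline t * c n t @[n --> \oo] --> halfline t * gamma t.
  by apply: cvgMl_tmp; exact: c_cvg.
have [sq [sq_cvg sqP]] := Rintegral_cvg_le Bn_tame mhg (measurable_cball _) (cball_fin _) Bn_le cb hc.
have [C' C'0 C'P] := first_term.
have [_ _ ta _] := a_int; have [_ _ ts _] := s_int.
have lower n : - (a 0 + C' * (q n)^-1) +
    (1 + k * (q n)^-1)^-1 * \int[mu]_t (halfline t * s (t + (q n)^-1)) -
    \int[mu]_t (halfline t * b n t) <= sq n.
  apply: le_trans (sqP n); have [_ _ tb _] := b_int n.
  have t1 : tame mu (fun t => halfline t * (q n * (a (t + (q n)^-1) - a t))).
    by apply: tame_half; apply: tameZ; apply: tameB => //; exact: tame_shift.
  have t2 : tame mu (fun t => halfline t * s (t + (q n)^-1)).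
    by apply: tame_half; exact: tame_shift.
  have -> : \int[mu]_t Bn n t = \int[mu]_t (halfline t * (q n * (a (t + (q n)^-1) - a t))) +
      (1 + k * (q n)^-1)^-1 * \int[mu]_t (halfline t * s (t + (q n)^-1)) -
      \int[mu]_t (halfline t * b n t).
    rewrite -(RintZ _ t2) -(RintD t1 (tameZ _ t2)) -(RintB (tameD t1 (tameZ _ t2)) (tame_half tb)).
    apply: eqRint => t; rewrite /Bn /= -/(b n t).
    have E (x z1 z2 z3 z4 : R) : x * (z1 + z2 * z3 - z4) = x * z1 + z2 * (x * z3) - x * z4.
      by ring.
    exact: E.
  by rewrite !lerD2r.
have lim : - (a 0 + C' * (q n)^-1) +
    (1 + k * (q n)^-1)^-1 * \int[mu]_t (halfline t * s (t + (q n)^-1)) -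
    \int[mu]_t (halfline t * b n t) @[n --> \oo] -->
    - (a 0 + C' * 0) + (1 + k * 0)^-1 * \int[mu]_t (halfline t * s t) -
    \int[mu]_t (halfline t * beta t).
  apply: cvgB beta_cvg; apply: cvgD.
    by apply: cvgN; apply: cvgD; [exact: cvg_cst|apply: cvgMl_tmp; exact: qV_cvg].
  apply: cvgM source_cvg; apply: cvgV; first by rewrite mulr0 addr0.
  by apply: cvgD; [exact: cvg_cst|apply: cvgMl_tmp; exact: qV_cvg].
have := ler_lim (cvgP _ lim) (cvgP _ sq_cvg) (nearW _ lower).
rewrite (cvg_lim _ lim)// (cvg_lim _ sq_cvg)// !mulr0 !addr0 invr1 mul1r.
have E (x1 x2 x3 x4 : R) : - x1 + x2 - x3 <= x4 -> x2 <= x3 + x4 + x1 by lra.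
by move=> /(_ _ _) h; apply: E; exact: h.
Qed.

End time_integration.

(** * Back to the original variables *)

Section test_functions.
Context {R : realType}.
Implicit Types (x y t : R) (phi : R * R -> R).

Lemma is_derive_lips (f df : R -> R) (C : R) :
  (forall y, is_derive y 1 f (df y)) -> (forall y, `|df y| <= C) -> lips C f.
Proof.
move=> dF dC.
have cf : continuous f.
  move=> y; apply/differentiable_continuous/derivable1_diffP.
  by have [] := dF y.
have main y z : y < z -> `|f z - f y| <= C * `|z - y|.
  move=> yz; have [] := @MVT R f df y z yz.
    exact: continuous_subspaceT.
  by move=> c _ ->; rewrite normrM ler_wpM2r.
move=> y z; have [yz|yz|->] := ltgtP y z.
- by rewrite distrC (distrC y); exact: main.
- exact: main.
- by rewrite !subrr normr0 mulr0.
Qed.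

Lemma is_derive_partial_x phi x t : derivable phi (x, t) (1, 0) ->
  is_derive x 1 (fun x => phi (x, t)) (partial_x phi (x, t)).
Proof.
have E : (fun h : R => h^-1 *: ((phi \o shift (x, t)) (h *: ((1, 0) : R * R)) - phi (x, t))) =
    fun h : R => h^-1 *: (((fun x => phi (x, t)) \o shift x) (h *: (1 : R)) - phi (x, t)).
  apply/funext => h /=; congr (_ *: (phi _ - _)).
  by congr pair; rewrite /= scaler0 add0r.
rewrite /derivable E => d; apply: DeriveDef => //.
by rewrite /partial_x /derive E.
Qed.

Lemma is_derive_partial_t phi x t : derivable phi (x, t) (0, 1) ->
  is_derive t 1 (fun t => phi (x, t)) (partial_t phi (x, t)).
Proof.
have E : (fun h : R => h^-1 *: ((phi \o shift (x, t)) (h *: ((0, 1) : R * R)) - phi (x, t))) =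
    fun h : R => h^-1 *: (((fun t => phi (x, t)) \o shift t) (h *: (1 : R)) - phi (x, t)).
  apply/funext => h /=; congr (_ *: (phi _ - _)).
  by congr pair; rewrite /= scaler0 add0r.
rewrite /derivable E => d; apply: DeriveDef => //.
by rewrite /partial_t /derive E.
Qed.

Lemma derive_supp (f df : R -> R) (K : R) : (forall y, is_derive y 1 f (df y)) ->
  (forall y, K < `|y| -> f y = 0) -> forall y, K < `|y| -> df y = 0.
Proof.
move=> dF f0 y Ky; have d0 : is_derive y 1 f 0.
  apply: (@near_eq_is_derive R R R (cst 0)).
    near=> z; apply/esym/f0; near: z.
    by apply: (cvgr_gt `|y|) => //; exact: norm_continuous.
by have [_ <-] := dF y; have [_ ->] := d0.
Unshelve. all: by end_near. Qed.

Lemma continuous_box_bound phi (K : R) : continuous phi ->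
  exists2 B : R, 0 <= B & forall x t, `|x| <= K -> `|t| <= K -> `|phi (x, t)| <= B.
Proof.
move=> cphi.
have cK : compact (`[- K, K]%classic `*` `[- K, K]%classic : set (R * R)).
  by apply: compact_setX; exact: segment_compact.
have /compact_bounded[B [_ BP]] : compact (phi @` (`[- K, K]%classic `*` `[- K, K]%classic)).
  by apply: continuous_compact => //; exact: continuous_subspaceT.
exists (`|B| + 1); first by rewrite addr_ge0.
move=> x t xK tK; apply: (BP (`|B| + 1)).
  by rewrite (le_lt_trans (ler_norm B))// ltrDl.
by exists (x, t) => //; split; rewrite /= in_itv /= -ler_norml.
Qed.

Lemma compact_support_box phi : compact (closure [set p | phi p != 0]) ->
  exists2 K : R, 0 <= K & (forall x t, K < `|x| -> phi (x, t) = 0) /\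
    (forall x t, K < `|t| -> phi (x, t) = 0).
Proof.
move=> /compact_bounded[B [_ BP]].
have BB p : phi p != 0 -> `|p| <= `|B| + 1.
  move=> p0; apply: (BP (`|B| + 1)); last exact: subset_closure.
  by rewrite (le_lt_trans (ler_norm B))// ltrDl.
exists (`|B| + 1); first by rewrite addr_ge0.
split=> x t h; apply/eqP; apply: contraTT h => /BB h; rewrite -leNgt (le_trans _ h)//.
  by rewrite prod_normE /= le_max lexx.
by rewrite prod_normE /= le_max lexx orbT.
Qed.

Lemma xof_norm y : `|xof y| = `|y| ^+ 2 / 4.
Proof. by rewrite /xof !normrM normr_id (ger0_norm (_ : 0 <= 4^-1)). Qed.

Definition pull phi (p : R * R) := phi (xof p.1, p.2).

Lemma measurable_pull phi : measurable_fun setT phi -> measurable_fun setT (pull phi).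
Proof.
move=> m; apply: (measurableT_comp m); apply: measurable_fun_pair; last exact: measurable_snd.
by apply: (measurableT_comp measurable_xof); exact: measurable_fst.
Qed.

Definition pull_x phi (p : R * R) := partial_x phi (xof p.1, p.2) * (`|p.1| / 2).

Lemma test_function_pull phi : nonneg_test_function phi -> exists r T C : R,
  0 <= r /\ test2 (pull phi) (pull_x phi) (pull (partial_t phi)) r T C.
Proof.
move=> [/(_ 1%N)[cphi [dx dt [cx _] [ct _]]] /compact_support_box[K K0 [Kx Kt]] _].
have isx x t := is_derive_partial_x (dx (x, t)).
have ist x t := is_derive_partial_t (dt (x, t)).
have Kpx x t : K < `|x| -> partial_x phi (x, t) = 0.
  move=> h; apply: (derive_supp (f := fun x => phi (x, t)) (df := fun x => partial_x phi (x, t)) (K := K)) => //.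
  by move=> z; exact: Kx.
have Kpt x t : K < `|t| -> partial_t phi (x, t) = 0.
  move=> h; apply: (derive_supp (f := fun t => phi (x, t)) (df := fun t => partial_t phi (x, t)) (K := K)) => //.
  by move=> z; exact: Kt.
have Ktx x t : K < `|t| -> partial_x phi (x, t) = 0.
  move=> h; have [_ <-] := isx x t.
  have -> : (fun x => phi (x, t)) = cst 0 by apply/funext => z; exact: Kt.
  exact: derive_cst.
have Kxt x t : K < `|x| -> partial_t phi (x, t) = 0.
  move=> h; have [_ <-] := ist x t.
  have -> : (fun t => phi (x, t)) = cst 0 by apply/funext => z; exact: Kx.
  exact: derive_cst.
have bnd (f : R * R -> R) : continuous f -> (forall x t, K < `|x| -> f (x, t) = 0) ->
    (forall x t, K < `|t| -> f (x, t) = 0) -> exists2 B : R, 0 <= B & forall p : R * R, `|f p| <= B.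
  move=> cf f1 f2; have [B B0 BP] := continuous_box_bound K cf; exists B => // -[x t].
  have [xK|xK] := leP `|x| K; last by rewrite f1// normr0.
  have [tK|tK] := leP `|t| K; last by rewrite f2// normr0.
  exact: BP.
have [A A0 AP] := bnd _ cphi Kx Kt.
have [B B0 BP] := bnd _ cx Kpx Ktx.
have [D D0 DP] := bnd _ ct Kxt Kpt.
(* Chosen so that [|y| > r] forces [|xof y| = y ^ 2 / 4 > K]. *)
pose r := K + 4; have r0 : 0 <= r by rewrite addr_ge0.
have xr y : r < `|y| -> K < `|xof y|.
  rewrite xof_norm /r => h; rewrite ltr_pdivlMr// expr2; nra.
(* One constant above the bounds of [phi] and of both derivatives; [r / 2] bounds the derivative of
   [xof] on the support. *)
pose C := A + B * (r / 2) + D.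
have BR0 : 0 <= B * (r / 2) by rewrite mulr_ge0// divr_ge0.
have AC : A <= C by rewrite /C; lra.
have BC : B * (r / 2) <= C by rewrite /C; lra.
have DC : D <= C by rewrite /C; lra.
exists r, K, C; split=> //; split.
- move=> t.
  have px_bound y : `|pull_x phi (y, t)| <= C.
    rewrite /pull_x /=; have [yr|yr] := leP `|y| r; last by rewrite Kpx ?mul0r ?normr0 ?(le_trans A0)//; exact: xr.
    rewrite (le_trans _ BC)// normrM ler_pM//.
    by rewrite ger0_norm ?divr_ge0// ler_pM2r.
  have dp y : is_derive y 1 (fun y => pull phi (y, t)) (pull_x phi (y, t)).
    exact: (is_derive1_comp (isx (xof y) t) (is_derive_xof y)).
  split=> //; last exact: is_derive_lips dp px_bound.
  by move=> y yr; apply: Kx; exact: xr.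
- move=> y; split.
  + by move=> t; exact: Kt.
  + have dC t : `|partial_t phi (xof y, t)| <= C by rewrite (le_trans _ DC).
    exact: (is_derive_lips (ist (xof y)) dC).
  + by move=> t; exact: (ist (xof y) t).
- by move=> p; rewrite (le_trans (AP _)).
- move=> y t u u0; rewrite /pull_x /=; apply: cvgMr_tmp.
  apply: (continuous_cvg _ (cx (xof y, t))).
  have tu : t + u n @[n --> \oo] --> t.
    by rewrite -[X in _ --> X]addr0; apply: cvgD => //; exact: cvg_cst.
  exact: (cvg_pair (cvg_cst (xof y)) tu).
- split.
  + by apply: measurable_pull; exact: continuous_measurable_fun2.
  + apply: measurable_funM.
      exact: measurable_pull (continuous_measurable_fun2 cx).
    apply: measurable_funM => //; apply: measurableT_comp => //; exact: measurable_fst.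
  + by apply: measurable_pull; exact: continuous_measurable_fun2.
Qed.

End test_functions.

Section solution.
Context {R : realType}.
Implicit Types (x y t : R) (phi : R * R -> R).
Local Notation mu := (@lebesgue_measure R).
Local Notation mu2 := (lebesgue2 R).

Lemma measurable_invr : measurable_fun setT (@GRing.inv R).
Proof.
rewrite (_ : @GRing.inv R = fun x => Num.sg x * (`|x| `^ (- 1))).
  apply: measurable_funM; first exact: measurable_sgr.
  by apply: (measurableT_comp (measurable_powR _)); exact: normr_measurable.
apply/funext => x; rewrite powR_inv1// -normfV mulrC.
by rewrite -{1}[x^-1]mulr_sg_norm sgrV mulrC.
Qed.

(** [w] may be singular at [x = 0], but times the Jacobian it becomes the locally bounded [G]. *)
Lemma locally_integrable_xof (w G : R * R -> R) :
  measurable_fun setT w -> measurable_fun setT G ->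
  (forall r : R, exists B : R, forall y t, `|y| <= r -> `|G (y, t)| <= B) ->
  (forall y t, y != 0 -> w (xof y, t) * (`|y| / 2) = G (y, t)) ->
  locally_integrable_half_plane w.
Proof.
move=> mw mG bG wG K cK _.
have [b b0 bK] : exists2 b : R, 0 <= b & forall x t, K (x, t) -> `|x| <= b /\ `|t| <= b.
  have [B [_ BP]] := compact_bounded cK; exists (`|B| + 1); first by rewrite addr_ge0.
  have BB : B < `|B| + 1 by rewrite (le_lt_trans (ler_norm B))// ltrDl.
  by move=> x t /(BP _ BB); rewrite /= prod_normE ge_max => /andP.
(* Indicator of a square containing [K]: multiplying by it changes nothing on [K] and makes the
   pulled back function bounded with bounded support. *)
pose e1 : R -> R := \1_(cball b); pose e (p : R * R) := e1 p.1 * e1 p.2.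
have e1_in x : `|x| <= b -> e1 x = 1 by move=> h; rewrite /e1 indicE mem_set//; exact/cballE.
have e1_out x : b < `|x| -> e1 x = 0.
  by move=> h; rewrite /e1 indicE memNset// => /cballE; rewrite leNgt h.
have e1_le x : `|e1 x| <= 1.
  by rewrite /e1 indicE; case: (_ \in _); rewrite /= ?normr1 ?normr0.
have me1 : measurable_fun setT e1 by apply: measurable_indic; exact: measurable_cball.
have me : measurable_fun setT e.
  apply: measurable_funM; first exact: (measurableT_comp me1 measurable_fst).
  exact: (measurableT_comp me1 measurable_snd).
have bx y : b + 4 < `|y| -> b < `|xof y|.
  by rewrite xof_norm => h; rewrite ltr_pdivlMr// expr2; nra.
have [A AP] := bG (b + 4).
have bE : boxed (fun p => G p * e (xof p.1, p.2)) (b + 4) b `|A|.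
  split.
  - by apply: measurable_funM => //; exact: (measurable_pull me).
  - move=> [y t]; have [yb|yb] := leP `|y| (b + 4).
      rewrite normrM -[leRHS]mulr1 ler_pM// ?(le_trans (AP _ _ yb)) ?ler_norm//.
      by rewrite /e normrM -[leRHS]mulr1 ler_pM.
    by rewrite /e /= e1_out ?mul0r ?mulr0 ?normr0//; exact: bx.
  - by move=> y t yb; rewrite /e /= e1_out ?mul0r ?mulr0//; exact: bx.
  - by move=> y t tb; rewrite /e /= (e1_out _ tb) !mulr0.
have mF : measurable_fun setT (fun p => w p * e p) by exact: measurable_funM.
have wGe (y t : R) : y != 0 -> w (xof y, t) * e (xof y, t) * (`|y| / 2) = G (y, t) * e (xof y, t).
  by move=> y0; rewrite mulrAC wG.
have [iF _] := integrable_xof2 mF (boxed_tame bE) wGe.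
have mK : measurable K by apply: closed_measurable2; exact: compact_closed.
have iK : mu2.-integrable K (EFin \o (fun p => w p * e p)).
  by apply: (@integrableS _ _ R mu2 setT K) => //; exact: iF.
apply: (@eq_integrable _ _ R mu2 K mK _ _ _ iK) => p /set_mem Kp.
case: p Kp => x t /bK[xb tb] /=.
by rewrite /e /= !e1_in// !mulr1.
Qed.

Variables (v0 : R -> R) (C : R).
Hypotheses (mv0 : measurable_fun setT v0) (v0C : forall x, `|x| * v0 x ^+ 2 <= C).

Let w0 y := y / 2 * v0 (xof y).
Let W := burgers w0.

(** On the null set [x = 0] the convention [0^-1 = 0] gives the value 0. *)
Definition solution (p : R * R) : R := burgers w0 (yof p.1, p.2) / (yof p.1 / 2).

Let mw0 : measurable_fun setT w0.
Proof.
apply: measurable_funM; last exact: (measurableT_comp mv0 measurable_xof).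
exact: measurable_funM.
Qed.

Let M := Num.sqrt C.

Let w0M y : `|w0 y| <= M.
Proof.
rewrite -sqrtr_sqr ler_wsqrtr// /w0 exprMn (le_trans _ (v0C (xof y)))// ler_wpM2r ?sqr_ge0//.
by rewrite xof_norm exprMn exprVn real_normK ?num_real// -natrX.
Qed.

Let mW : measurable_fun setT W. Proof. exact: burgers_measurable mw0 w0M. Qed.
Let WM p : `|W p| <= M. Proof. exact: burgers_bound. Qed.

Lemma measurable_solution : measurable_fun setT solution.
Proof.
have my : measurable_fun setT (fun p : R * R => yof p.1).
  exact: (measurableT_comp measurable_yof measurable_fst).
apply: measurable_funM.
  by apply: (measurableT_comp mW); apply: measurable_fun_pair => //; exact: measurable_snd.
by apply: (measurableT_comp measurable_invr); exact: measurable_funM.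
Qed.

Lemma solution_xof y t : y != 0 -> W (y, t) = y / 2 * solution (xof y, t).
Proof.
by move=> y0; rewrite /solution /= xofK mulrCA divff ?mulr1// mulf_neq0// invr_eq0.
Qed.

Lemma solution_locally_integrable : locally_integrable_half_plane solution.
Proof.
apply: (@locally_integrable_xof _ (fun p => Num.sg p.1 * W p)).
- exact: measurable_solution.
- by apply: measurable_funM => //; apply: (measurableT_comp (@measurable_sgr R)); exact: measurable_fst.
- move=> r; exists M => y t _; rewrite normrM -[leRHS]mul1r ler_pM//; exact: normr_sg_le1.
- by move=> y t y0; rewrite solution_xof//= normrEsg; ring.
Qed.

Lemma flux_solution_locally_integrable :
  locally_integrable_half_plane (fun p => flux p.1 (solution p)).
Proof.
apply: (@locally_integrable_xof _ (fun p => p.1 / 2 * W p ^+ 2)).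
- apply: measurable_funM; first exact: measurable_fst.
  by apply: measurable_funX; exact: measurable_solution.
- apply: measurable_funM; last exact: measurable_funX.
  by apply: measurable_funM => //; exact: measurable_fst.
- move=> r; exists (r / 2 * M ^+ 2) => y t yr; rewrite normrM ler_pM//.
    by rewrite normrM [`|2^-1|]ger0_norm// ler_pM2r.
  by rewrite normrX ler_pXn2r ?nnegrE ?sqrtr_ge0.
- move=> y t y0; rewrite solution_xof// /flux /xof /=.
  have E : `|y| * `|y| = y * y by rewrite -!expr2 real_normK ?num_real.
  transitivity (y / 2 * (`|y| * `|y| / 4 * solution (y * `|y| / 4, t) ^+ 2)); first by field.
  by rewrite E; field.
Qed.

Let sgsq y : Num.sg y * y = `|y|. Proof. by rewrite normrEsg. Qed.

Let eta_solution k y t : y != 0 ->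
  `|solution (xof y, t) - k| * (`|y| / 2) = kruzkov_eta w0 k (y, t).
Proof.
move=> y0; rewrite /kruzkov_eta -/W solution_xof//=.
rewrite (_ : y / 2 * _ - k * y / 2 = (solution (xof y, t) - k) * (y / 2)); last by ring.
by rewrite normrM [X in _ = _ * X]normrM [`|2^-1|]ger0_norm.
Qed.

Let sg_solution k y t : y != 0 ->
  Num.sg (W (y, t) - k * y / 2) = Num.sg y * Num.sg (solution (xof y, t) - k).
Proof.
move=> y0; rewrite solution_xof//.
rewrite (_ : y / 2 * _ - k * y / 2 = y * ((solution (xof y, t) - k) / 2)); last by ring.
by rewrite !sgrM [Num.sg 2^-1]gtr0_sg// mulr1.
Qed.

Let flux_solution k y t : y != 0 ->
  Num.sg (solution (xof y, t) - k) * (flux (xof y) (solution (xof y, t)) - flux (xof y) k) =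
  kruzkov_flux w0 k (y, t).
Proof.
move=> y0; rewrite /kruzkov_flux -/W sg_solution// solution_xof//= /flux.
by move: (solution _) => z; rewrite /xof -sgsq; field.
Qed.

Let source_solution k y t : y != 0 ->
  Num.sg (solution (xof y, t) - k) * k ^+ 2 * (`|y| / 2) = kruzkov_source w0 k (y, t).
Proof.
move=> y0; rewrite /kruzkov_source -/W sg_solution//= -sgsq; ring.
Qed.

Lemma boxedD (H1 H2 : R * R -> R) r T B1 B2 : boxed H1 r T B1 -> boxed H2 r T B2 ->
  boxed (fun p => H1 p + H2 p) r T (B1 + B2).
Proof.
move=> [m1 b1 r1 t1] [m2 b2 r2 t2]; split.
- exact: measurable_funD.
- by move=> p; rewrite (le_trans (ler_normD _ _))// lerD.
- by move=> y t yr; rewrite r1// r2// addr0.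
- by move=> y t tT; rewrite t1// t2// addr0.
Qed.

Lemma half_plane_xof (F H : R * R -> R) r T B :
  measurable_fun setT F -> boxed H r T B ->
  (forall y t, y != 0 -> F (xof y, t) * (`|y| / 2) = H (y, t)) ->
  \int[mu2]_(p in half_plane R) F p =
  \int[mu]_t (halfline t * \int[mu]_y H (y, t)).
Proof.
move=> mF bH FH.
have mh : measurable_fun setT (fun p : R * R => halfline p.2).
  exact: (measurableT_comp measurable_halfline measurable_snd).
have bhH : boxed (fun p => halfline p.2 * H p) r T (1 * B).
  by apply: boxed_mul bH => // y t _; exact: halfline_bound.
have [_ _ _ E] := boxed_int bhH.
have FHh y t : y != 0 -> halfline t * F (xof y, t) * (`|y| / 2) = halfline t * H (y, t).
  by move=> y0; rewrite -mulrA FH.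
have [_ E'] := integrable_xof2 (measurable_funM mh mF) (boxed_tame bhH) FHh.
transitivity (\int[mu2]_p (halfline p.2 * F p)).
  rewrite Rintegral_mkcond; apply: eqRint => p; rewrite patchE.
  case: (boolP (p \in half_plane R)) => [/set_mem h|/negP h].
    by rewrite halfline_ge0// mul1r.
  rewrite halfline_lt0 ?mul0r// ltNge; apply/negP => p0; apply: h; exact/mem_set.
rewrite E' E; apply: eqRint => t.
have [_ _ tH] := boxed_section t bH.
by rewrite -(RintZ _ tH).
Qed.

Lemma derive1_flux k x : derive1 (fun y => flux y k) x = k ^+ 2.
Proof.
rewrite /flux derive1E; have : is_derive x 1 (fun y : R => y * k ^+ 2) (k ^+ 2 *: (1 : R)).
  have -> : (fun y : R => y * k ^+ 2) = k ^+ 2 \*: id by apply/funext => y /=; rewrite mulrC.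
  exact: is_deriveZ.
by move=> d; rewrite derive_val /GRing.scale /= mulr1.
Qed.

(** [burgers] at time 0 is literally [w0], so the initial integral is an exact change of variables,
    after replacing [u0] by [v0] almost everywhere. *)
Let initial_term (u0 : R -> R) k phi : measurable_fun setT u0 ->
  {ae mu, forall x, u0 x = v0 x} -> measurable_fun setT phi ->
  (forall p, half_plane R p -> 0 <= phi p) ->
  \int[mu]_x (`|u0 x - k| * phi (x, 0)) =
  \int[mu]_y (kruzkov_eta w0 k (y, 0) * pull phi (y, 0)).
Proof.
move=> mu0 uv mphi phi0.
have mp : measurable_fun setT (fun x => phi (x, 0)) by exact: measurable_fun_pair1.
have mF (u : R -> R) : measurable_fun setT u -> measurable_fun setT (fun x => (`|u x - k| * phi (x, 0))%:E).
  move=> mu1; apply/measurable_EFinP/measurable_funM => //.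
  by apply: measurableT_comp => //; exact: measurable_funB.
congr fine; transitivity (\int[mu]_x (`|v0 x - k| * phi (x, 0))%:E)%E.
  apply: ae_eq_integral => //; [exact: mF|exact: mF|].
  by apply: ae_imply uv => x ->.
apply: integral_xof_norm => //; first exact: mF.
- apply/measurable_EFinP/measurable_funM.
    exact: measurable_fun_pair1 (kruzkov_eta_measurable k mw0 w0M).
  exact: measurable_fun_pair1 (measurable_pull mphi).
- by move=> x; rewrite lee_fin mulr_ge0// phi0// /half_plane/=.
- move=> x; rewrite lee_fin; apply: mulr_ge0; first exact: normr_ge0.
  by apply: phi0; rewrite /half_plane/=.
move=> y y0; rewrite -EFinM -eta_solution// /solution /burgers /= ltxx xofK.
have -> : w0 y / (y / 2) = v0 (xof y).
  by rewrite /w0 mulrC mulKf// mulf_neq0// invr_eq0.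
by rewrite mulrAC.
Qed.

Theorem entropy_solution_xof (u0 : R -> R) : measurable_fun setT u0 ->
  {ae mu, forall x, u0 x = v0 x} -> entropy_solution (@flux R) u0 solution.
Proof.
move=> mu0 uv; split.
- exact: solution_locally_integrable.
- exact: flux_solution_locally_integrable.
move=> k phi tphi; have [r [T [B [r0 tP]]]] := test_function_pull tphi.
have [/(_ 1%N)[cphi [_ _ [cx _] [ct _]]] _ phi0] := tphi.
have mphi := continuous_measurable_fun2 cphi.
have mpx := continuous_measurable_fun2 cx.
have mpt := continuous_measurable_fun2 ct.
have Phi_ge0 y t : 0 <= t -> 0 <= pull phi (y, t) by move=> t0; exact: phi0.
have := burgers_entropy_iterated k mw0 w0M r0 tP Phi_ge0.
have ms := measurable_solution.
have msk : measurable_fun setT (fun p => solution p - k) by exact: measurable_funB.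
have msg := measurableT_comp (@measurable_sgr R) msk.
have bS := kruzkov_source_boxed k mw0 w0M r0 (test2_boxed tP).
have bE := kruzkov_eta_boxed k mw0 w0M r0 (test2t_boxed tP).
have bF := kruzkov_flux_boxed k mw0 w0M r0 (test2y_boxed tP).
rewrite (initial_term k mu0 uv mphi phi0).
have -> : \int[mu2]_(p in half_plane R)
    (Num.sg (solution p - k) * derive1 (fun y => flux y k) p.1 * phi p) =
    \int[mu]_t (halfline t * \int[mu]_y (kruzkov_source w0 k (y, t) * pull phi (y, t))).
  transitivity (\int[mu2]_(p in half_plane R) (Num.sg (solution p - k) * k ^+ 2 * phi p)).
    by apply: eq_Rintegral => p _; rewrite derive1_flux.
  apply: half_plane_xof bS _.
    by apply: measurable_funM => //; exact: measurable_funM.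
  by move=> y t y0; rewrite mulrAC source_solution.
have -> : \int[mu2]_(p in half_plane R) (`|solution p - k| * partial_t phi p
    + Num.sg (solution p - k) * (flux p.1 (solution p) - flux p.1 k) * partial_x phi p) =
    \int[mu]_t (halfline t * \int[mu]_y (kruzkov_eta w0 k (y, t) * pull (partial_t phi) (y, t)
      + kruzkov_flux w0 k (y, t) * pull_x phi (y, t))).
  apply: half_plane_xof (boxedD bE bF) _.
    apply: measurable_funD.
      by apply: measurable_funM => //; exact: measurableT_comp.
    apply: measurable_funM => //; apply: measurable_funM => //; apply: measurable_funB.
      by apply: measurable_funM; [exact: measurable_fst|exact: measurable_funX].
    by apply: measurable_funM => //; exact: measurable_fst.
  move=> y t y0; rewrite mulrDl mulrAC eta_solution// /= flux_solution//.
  by rewrite /pull_x /pull /= mulrA.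
have mh := @measurable_halfline R.
have [_ _ tE _] := boxed_int bE; have [_ _ tF _] := boxed_int bF.
have th f : tame mu f -> tame mu (fun t => halfline t * f t).
  exact: (@tameM _ (measurableTypeR R) R mu _ _ _ mh (@halfline_bound R)).
have -> : \int[mu]_t (halfline t * \int[mu]_y (kruzkov_eta w0 k (y, t) * pull (partial_t phi) (y, t)
      + kruzkov_flux w0 k (y, t) * pull_x phi (y, t))) =
  \int[mu]_t (halfline t * \int[mu]_y (kruzkov_eta w0 k (y, t) * pull (partial_t phi) (y, t))) +
  \int[mu]_t (halfline t * \int[mu]_y (kruzkov_flux w0 k (y, t) * pull_x phi (y, t))).
  rewrite -(RintD (th _ tE) (th _ tF)); apply: eqRint => t.
  have [_ _ t1] := boxed_section t bE; have [_ _ t2] := boxed_section t bF.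
  by rewrite (RintD t1 t2) mulrDr.
by rewrite lerBlDr.
Qed.

End solution.

(** * The bound on the initial datum and the conclusion *)

Section initial_data.
Context {R : realType}.
Local Notation mu := (@lebesgue_measure R).

Lemma BV_line_bounded (w : R -> R) : BV_line w ->
  exists C : R, {ae mu, forall x, `|w x| <= C}.
Proof.
move=> [h [wh [C hC]]]; exists (`|h 0| + C).
apply: ae_imply wh => x ->.
have hx : `|h x - h 0| <= C.
  have [x0|x0] := leP 0 x; rewrite -lee_fin.
    exact: le_trans (total_variation_ge _ x0) (hC _ _ x0).
  rewrite distrC; exact: le_trans (total_variation_ge _ (ltW x0)) (hC _ _ (ltW x0)).
by rewrite -(subrK (h 0) (h x)) addrC (le_trans (ler_normD _ _))// lerD2l.
Qed.

Lemma normr_signed_flux (x v : R) : `|signed_flux x v| = `|x| * v ^+ 2.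
Proof.
rewrite /signed_flux /flux !normrM normr_sg -expr2 real_normK ?num_real//.
by have [->|v0] := eqVneq v 0; rewrite ?expr0n ?mulr0 ?mul0r// mul1r.
Qed.

(** The bound on [|x| u0 ^ 2] holds almost everywhere, while the transformed datum must be bounded
    at every point; setting [u0] to 0 where the bound fails changes it on a null set. Taking [|C|]
    makes the bound hold for the value 0 as well. *)
Lemma bounded_flux_representative (u0 : R -> R) : measurable_fun setT u0 ->
  BV_line (fun x => signed_flux x (u0 x)) ->
  exists (v0 : R -> R) (C : R), [/\ measurable_fun setT v0,
    (forall x, `|x| * v0 x ^+ 2 <= C) & {ae mu, forall x, u0 x = v0 x}].
Proof.
move=> mu0 /BV_line_bounded[C uC].
exists (fun x => if `|x| * u0 x ^+ 2 <= `|C| then u0 x else 0), `|C|; split.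
- apply: measurable_fun_ifT => //; apply: measurable_fun_ler => //.
  by apply: measurable_funM; [exact: normr_measurable|exact: measurable_funX].
- by move=> x; case: ifPn => // _; rewrite expr0n /= mulr0.
- by apply: ae_imply uC => x; rewrite normr_signed_flux => /le_trans -> //; exact: ler_norm.
Qed.

End initial_data.

Theorem mainTheorem3 (R : realType) (u0 : R -> R)
  (u0_Linfty : u0 \in Lfun (@lebesgue_measure R) +oo%E)
  (g_u0_BV : BV_line (fun x => signed_flux x (u0 x))) :
  exists u : R * R -> R, entropy_solution (@flux R) u0 u.
Proof.
have mu0 : measurable_fun setT u0 := set_mem (sub_Lfun_mfun u0_Linfty).
have [v0 [C [mv0 v0C uv]]] := bounded_flux_representative mu0 g_u0_BV.
by exists (solution v0); exact: (entropy_solution_xof mv0 v0C mu0 uv).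
Qed.
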